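(* Suppose that there exists $T>0$ such that the system $$\partial_t u + iAu = 0,\qquad y = B^*u$$ is observable in time $T$. Then the damped wave system $$\partial_t^2 u + Au + BB^*\partial_t u = 0,\qquad (u,\partial_t u)|_{t=0} = (u_0,u_1)\in\mathcal{H}$$ is stable at rate $\frac{1}{\sqrt{t}}$.
   Context: $H$ and $Y$ are Hilbert spaces with norms $\|\cdot\|_H,\|\cdot\|_Y$. $A:D(A)\subset H\to H$ is a nonnegative selfadjoint operator with compact resolvent, and $B\in\mathcal{L}(Y;H)$ is a bounded operator with adjoint $B^*\in\mathcal{L}(H;Y)$. The system $\partial_t u+iAu=0$, $y=B^*u$ is observable in time $T$ if there is a constant $K_T>0$ such that every solution satisfies $\|u(0)\|_H^2\le K_T\int_0^T\|y(t)\|_Y^2\,dt$. $\mathcal{H}=D(A^{1/2})\times H$ is equipped with the norm $\|(u_0,u_1)\|_{\mathcal{H}}^2=\|(A+\mathrm{Id})^{1/2}u_0\|_H^2+\|u_1\|_H^2$ and the seminorm $|(u_0,u_1)|_{\mathcal{H}}^2=\|A^{1/2}u_0\|_H^2+\|u_1\|_H^2$. The damped wave system is written $\partial_t U=\mathcal{A}U$ with $U=(u,\partial_t u)$ and $$\mathcal{A}=\begin{pmatrix}0&\mathrm{Id}\\-A&-BB^*\end{pmatrix},\qquad D(\mathcal{A})=D(A)\times D(A^{1/2}).$$ The energy of a solution is $E(u,t)=\frac12\big(\|A^{1/2}u(t)\|_H^2+\|\partial_tu(t)\|_H^2\big)$. For a function $f$ with $f(t)\to0$ as $t\to+\infty$,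 the damped wave system is stable at rate $f(t)$ if there exists $C>0$ such that for all $(u_0,u_1)\in D(\mathcal{A})$ and all $t>0$, $E(u,t)^{1/2}\le Cf(t)\,|\mathcal{A}(u_0,u_1)|_{\mathcal{H}}$. *)

(* Defs.v *)
From HB Require Import structures.
From mathcomp Require Import all_boot all_order all_algebra.
From mathcomp Require Export all_classical all_reals all_analysis.
From mathcomp Require Export complex.

Set Implicit Arguments.
Unset Strict Implicit.
Unset Printing Implicit Defensive.

Import Order.TTheory GRing.Theory Num.Theory.
Import numFieldNormedType.Exports.

Local Open Scope classical_set_scope.
Local Open Scope ring_scope.
Local Open Scope complex_scope.

(* In a [normedModType R[i]] the norm takes its values in R[i]; [rnorm] is the
   same norm, as a real number. *)
Definition rnorm (R : realType) (V : normedModType R[i]) (x : V) : R :=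
  complex.Re `|x|.

(* The (complete) norm of H comes from the inner product [dot], which is linear
   in its first argument and conjugate-linear in the second one. *)
Definition hilbert (R : realType) (H : completeNormedModType R[i])
    (dot : {dot H for @conjc R}) : Prop :=
  forall x : H, `|x| ^+ 2 = dot x x.

Section Operators.
Context {R : realType}.

(* Unbounded operators: the values of [app] outside [dom] are irrelevant. *)
Record operator (V : lmodType R[i]) := Operator {
  dom : set V;
  app :> V -> V
}.

Definition linear_operator (V : lmodType R[i]) (A : operator V) : Prop :=
  dom A 0 /\
  forall (a : R[i]) (x y : V), dom A x -> dom A y ->
    dom A (a *: x + y) /\ A (a *: x + y) = a *: A x + A y.

Definition add_id (V : lmodType R[i]) (A : operator V) : operator V :=
  Operator (dom A) (fun x => A x + x).

Definition scale_operator (V : lmodType R[i]) (a : R[i]) (A : operator V) :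
  operator V := Operator (dom A) (fun x => a *: A x).

Context {H : completeNormedModType R[i]}.
Implicit Types (dot : {dot H for @conjc R}) (A S : operator H).

Definition adjoint_graph dot A (y z : H) : Prop :=
  forall x, dom A x -> dot (A x) y = dot x z.

(* A is linear, densely defined, and equal to its adjoint as a graph. *)
Definition selfadjoint dot A : Prop :=
  [/\ linear_operator A,
      closure (dom A) = setT &
      forall y z, adjoint_graph dot A y z <-> dom A y /\ A y = z].

(* Nonnegativity in R[i] includes being real. *)
Definition nonnegative dot A : Prop :=
  forall x, dom A x -> 0 <= dot (A x) x.

Definition compact_operator (K : H -> H) : Prop :=
  forall E : set H, bounded_set E -> precompact (K @` E).

Definition is_resolvent A (lambda : R[i]) (K : H -> H) : Prop :=
  (forall x, dom A (K x) /\ A (K x) - lambda *: K x = x) /\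
  (forall x, dom A x -> K (A x - lambda *: x) = x).

(* By the resolvent identity one lambda in the resolvent set is enough. *)
Definition compact_resolvent A : Prop :=
  exists (lambda : R[i]) (K : {linear H -> H}),
    [/\ continuous K, is_resolvent A lambda K & compact_operator K].

(* S = A^{1/2}: the nonnegative selfadjoint S with S^2 = A, domains included. *)
Definition is_sqrt dot A S : Prop :=
  [/\ selfadjoint dot S, nonnegative dot S &
      forall x, (dom A x <-> dom S x /\ dom S (S x)) /\
                (dom A x -> A x = S (S x))].

End Operators.

(* Mild solutions on [0, +oo[ of  u' = G u  in a subspace X of V, normed by N:
   u is continuous and  u(t) = u(0) + G (\int_0^t u),  where the vector-valued
   integral is given as the primitive v of u with v(0) = 0. *)
Section MildSolutions.
Context {R : realType} {V : lmodType R[i]}.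
Variables (X : set V) (N : V -> R).

Definition continuous_in (u : R -> V) : Prop :=
  forall t : R, 0 <= t ->
    N (u s - u t) @[s --> within `[0, +oo[ (nbhs t)] --> (0 : R).

Definition has_derivative_in (v u : R -> V) : Prop :=
  forall t : R, 0 <= t ->
    N (((s - t)^-1)%:C *: (v s - v t) - u t)
      @[s --> within `[0, +oo[ t^'] --> (0 : R).

Definition mild_solution (G : operator V) (u : R -> V) : Prop :=
  [/\ forall t, 0 <= t -> X (u t),
      continuous_in u &
      exists v : R -> V,
        [/\ v 0 = 0,
            has_derivative_in v u &
            forall t, 0 <= t -> dom G (v t) /\ u t = u 0 + G (v t)]].

End MildSolutions.

Section Systems.
Context {R : realType} {H Y : completeNormedModType R[i]}.

Definition schrodinger_solution (A : operator H) (u : R -> H) : Prop :=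
  mild_solution setT (@rnorm R H) (scale_operator (- 'i) A) u.

Definition observable (A : operator H) (Bs : H -> Y) (T : R) : Prop :=
  exists2 K : R, 0 < K &
    forall u : R -> H, schrodinger_solution A u ->
      (((rnorm (u 0)) ^+ 2)%:E <=
       K%:E * \int[lebesgue_measure]_(t in `[0%R, T]) ((rnorm (Bs (u t))) ^+ 2)%:E)%E.

(* Below, S and S1 stand for A^{1/2} and (A + Id)^{1/2}. *)
Definition energy_space (S : operator H) : set (H * H) :=
  [set U | dom S U.1].

Definition energy_norm (S1 : operator H) (U : H * H) : R :=
  Num.sqrt (rnorm (S1 U.1) ^+ 2 + rnorm U.2 ^+ 2).

Definition energy_seminorm (S : operator H) (U : H * H) : R :=
  Num.sqrt (rnorm (S U.1) ^+ 2 + rnorm U.2 ^+ 2).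

Definition wave_operator (A S : operator H) (B : Y -> H) (Bs : H -> Y) :
    operator (H * H)%type :=
  Operator [set U : H * H | dom A U.1 /\ dom S U.2]
           (fun U => (U.2, - A U.1 - B (Bs U.2))).

(* U stands for (u, \partial_t u). *)
Definition wave_solution (A S S1 : operator H) (B : Y -> H) (Bs : H -> Y)
    (U : R -> H * H) : Prop :=
  mild_solution (energy_space S) (energy_norm S1) (wave_operator A S B Bs) U.

Definition energy (S : operator H) (U : H * H) : R :=
  2^-1 * (rnorm (S U.1) ^+ 2 + rnorm U.2 ^+ 2).

Definition stable_at_rate (A S S1 : operator H) (B : Y -> H) (Bs : H -> Y)
    (f : R -> R) : Prop :=
  f t @[t --> +oo] --> (0 : R) /\
  exists2 C : R, 0 < C &
    forall u0 u1 : H, dom (wave_operator A S B Bs) (u0, u1) ->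
    forall U : R -> H * H, wave_solution A S S1 B Bs U -> U 0 = (u0, u1) ->
    forall t : R, 0 < t ->
      Num.sqrt (energy S (U t)) <=
        C * f t * energy_seminorm S (wave_operator A S B Bs (u0, u1)).

End Systems.

(* Main.v *)
(* Testing observability on finite sums of eigenvectors, where exp(-itA) is explicit, and comparing
   exp(-itA) x with exp(-i mu t) x gives the resolvent estimate
     |x| <= C (|(A - mu) x| + |B^* x|)   for all real mu and x in dom A.
   Diagonalising a real symmetric matrix D and applying the estimate in each eigenspace yields
     sum |w_j|^2 <= 2 C^2 sum (|A w_j - (D w)_j|^2 + |B^* w_j|^2)
   for vectors w_j in dom A.  Taking for D the opposite of the Dirichlet second difference on a
   grid of [0, t], with w_j = chi u'(s_j) and chi(s) = s (t - s) / t^2, and refining the grid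
   bounds the integral of chi^2 |u'|^2 by the integrals of |B^* u'|^2 and |B^* u''|^2, which the
   energy identities for u and u' control by |\mathcal{A} U_0|^2.  The integral of
   chi^2 |A^{1/2} u|^2 follows by equipartition, A having a spectral gap above its kernel.  As the
   energy is nonincreasing, t E(t) <= C |\mathcal{A} U_0|^2.  Mild solutions are regularised by
   difference quotients of their primitives. *)

(* Passing from fixed frequencies to time usually takes a Fourier transform in t. Here a symmetric
   matrix does this: its unitary eigenbasis gives a finite Plancherel identity, and its eigenvalues
   are real frequencies for the resolvent estimate. The sign of D is forced: A w - D w is then close
   to A w + w'', and for w = chi u' this is - chi BB* u'' plus terms with a derivative of chi, hence
   a factor 1/t. Working with u' rather than u makes the observation the dissipated quantity; the
   price is B* u'', which only the energy of u' controls. This loss of one derivative is why the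
   generator applied to the data appears. Two obstacles shape the rest. No semigroup is given, so a
   bound on U' is replaced by a Lipschitz bound on U, from contraction of increments and a
   short-time estimate. And u' need not take values in dom A, so in w it is replaced by a difference
   quotient at distance O(h), with h sent to 0 after the grid is refined. What remains is the energy
   of the data, which a stationary estimate bounds by the generator. *)
Require Import Defs.
From mathcomp Require Import all_boot all_order all_algebra.
From mathcomp Require Import ring lra spectral sesquilinear measurable_realfun.
Import Order.TTheory GRing.Theory Num.Theory.
Import numFieldNormedType.Exports.
Set Implicit Arguments.
Unset Strict Implicit.
Unset Printing Implicit Defensive.
Local Open Scope classical_set_scope.
Local Open Scope ring_scope.
Local Open Scope complex_scope.

(** * Hilbert space geometry *)

Section ComplexNorm.
Context {R : realType} {V : normedModType R[i]}.
Implicit Types (x y : V) (r : R).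

Lemma normE x : `|x| = (rnorm x)%:C.
Proof. by rewrite /rnorm RRe_real// ger0_real. Qed.

Lemma rnorm_ge0 x : 0 <= rnorm x.
Proof. by rewrite -ler0c -normE. Qed.

Lemma rnorm0 : rnorm (0 : V) = 0.
Proof. by rewrite /rnorm normr0. Qed.

Lemma rnorm_eq0 x : rnorm x = 0 -> x = 0.
Proof. by move=> h; apply/eqP; rewrite -normr_eq0 normE h. Qed.

Lemma rnorm_gt0 x : x != 0 -> 0 < rnorm x.
Proof.
move=> x0; rewrite lt_neqAle rnorm_ge0 andbT eq_sym.
by apply: contra x0 => /eqP/rnorm_eq0/eqP.
Qed.

Lemma ler_rnormD x y : rnorm (x + y) <= rnorm x + rnorm y.
Proof. by rewrite -lecR rmorphD /= -!normE ler_normD. Qed.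

Lemma rnormN x : rnorm (- x) = rnorm x.
Proof. by rewrite /rnorm normrN. Qed.

Lemma rnormBC x y : rnorm (x - y) = rnorm (y - x).
Proof. by rewrite -rnormN opprB. Qed.

Lemma ler_rnormB x y : rnorm (x - y) <= rnorm x + rnorm y.
Proof. by rewrite -(rnormN y) ler_rnormD. Qed.

Lemma ler_rnormDB z x y : rnorm (x - y) <= rnorm (x - z) + rnorm (z - y).
Proof. by rewrite -{1}(subrK z x) -addrA ler_rnormD. Qed.

Lemma ler_rnorm_dist x y : rnorm x <= rnorm y + rnorm (x - y).
Proof. by rewrite -{1}(subrKC y x) ler_rnormD. Qed.

Lemma rnormZC (a : R[i]) x : rnorm (a *: x) = complex.Re `|a| * rnorm x.
Proof.
have := normr_ge0 a.
rewrite {1}/rnorm normrZ. rewrite (normE x).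
case: (`|a|) => u v. by rewrite lecE /= => /andP[/eqP -> _]; rewrite mulr0 subr0.
Qed.

Lemma rnormZ r x : rnorm (r%:C *: x) = `|r| * rnorm x.
Proof. by rewrite rnormZC normc_def/= expr0n addr0 sqrtr_sqr. Qed.

Lemma rnormi x : rnorm ('i *: x) = rnorm x.
Proof. by rewrite rnormZC normc_def/= expr0n add0r expr1n sqrtr1 mul1r. Qed.

Lemma rnorm_ball x y (e : R) : 0 < e -> (ball x e%:C y : Prop) <-> rnorm (x - y) < e.
Proof.
by move=> e0; rewrite -ball_normE /ball_ /= normE ltcR.
Qed.

End ComplexNorm.

Section ComplexParts.
Context {R : realType}.
Implicit Types (u v : R[i]).

Lemma ReD u v : complex.Re (u + v) = complex.Re u + complex.Re v.
Proof. by case: u; case: v. Qed.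

Lemma ReN u : complex.Re (- u) = - complex.Re u.
Proof. by case: u. Qed.

Lemma ReZr (r : R) u : complex.Re (r%:C * u) = r * complex.Re u.
Proof. by case: u => a b /=; rewrite mul0r subr0. Qed.

Lemma Rei u : complex.Re ('i * u) = - complex.Im u.
Proof. by case: u => a b /=; rewrite mul0r mul1r sub0r. Qed.

Lemma Imi u : complex.Im ('i * u) = complex.Re u.
Proof. by case: u => a b /=; rewrite mul0r mul1r add0r. Qed.

Lemma ReJ u : complex.Re (conjc u) = complex.Re u.
Proof. by case: u. Qed.

Lemma ImJ u : complex.Im (conjc u) = - complex.Im u.
Proof. by case: u. Qed.

End ComplexParts.

Section RealInner.
Context {R : realType} {H : completeNormedModType R[i]}.
Variables (dot : {dot H for @conjc R}).
Hypothesis (Hdot : hilbert dot).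
Implicit Types (x y z : H) (r : R).

Definition inner x y : R := complex.Re (dot x y).
Local Notation ip := inner.

Lemma innerC x y : ip x y = ip y x.
Proof. by rewrite /inner hermC /= expr0 mul1r ReJ. Qed.

Lemma innerDl x y z : ip (x + y) z = ip x z + ip y z.
Proof. by rewrite /inner linearDl ReD. Qed.

Lemma innerDr x y z : ip z (x + y) = ip z x + ip z y.
Proof. by rewrite !(innerC z) innerDl. Qed.

Lemma innerNl x z : ip (- x) z = - ip x z.
Proof. by rewrite /inner linearNl ReN. Qed.

Lemma innerNr x z : ip z (- x) = - ip z x.
Proof. by rewrite !(innerC z) innerNl. Qed.

Lemma innerZl r x y : ip (r%:C *: x) y = r * ip x y.
Proof. by rewrite /inner linearZl_LR ReZr. Qed.

Lemma innerZr r x y : ip y (r%:C *: x) = r * ip y x.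
Proof. by rewrite !(innerC y) innerZl. Qed.

Lemma inner0l x : ip 0 x = 0.
Proof. by rewrite /inner linear0l. Qed.

Lemma inner0r x : ip x 0 = 0.
Proof. by rewrite innerC inner0l. Qed.

Lemma inneril x y : ip ('i *: x) y = - complex.Im (dot x y).
Proof. by rewrite /inner linearZl_LR Rei. Qed.

Lemma innerir x y : ip x ('i *: y) = complex.Im (dot x y).
Proof. by rewrite innerC inneril hermC /= expr0 mul1r ImJ opprK. Qed.

Lemma dotE x y : dot x y = ip x y +i* ip x ('i *: y).
Proof. by rewrite innerir /ip; case: (dot x y). Qed.

Lemma inner_rnorm x : ip x x = rnorm x ^+ 2.
Proof.
have := Hdot x; rewrite normE -rmorphXn /= /inner => <- //.
Qed.

(** Vector identities with real coefficients are proved below by testing them against an arbitrary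
    vector, which leaves a scalar identity for [ring] or [field]. *)
Lemma inner_ext x y : (forall z, ip x z = ip y z) -> x = y.
Proof.
move=> h; apply/eqP; rewrite -subr_eq0; apply/eqP/rnorm_eq0.
apply/eqP; rewrite -sqrf_eq0 -inner_rnorm.
by rewrite innerDl innerNl h subrr.
Qed.

Lemma rnormD_sqr x y :
  rnorm (x + y) ^+ 2 = rnorm x ^+ 2 + rnorm y ^+ 2 + 2 * ip x y.
Proof.
rewrite -!inner_rnorm innerDl !innerDr (innerC y x); ring.
Qed.

Lemma rnormB_sqr x y :
  rnorm (x - y) ^+ 2 = rnorm x ^+ 2 + rnorm y ^+ 2 - 2 * ip x y.
Proof. rewrite rnormD_sqr rnormN innerNr; ring. Qed.

Lemma inner_le x y : ip x y <= rnorm x * rnorm y.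
Proof.
have [->|x0] := eqVneq x 0; first by rewrite inner0l rnorm0 mul0r.
have [->|y0] := eqVneq y 0; first by rewrite inner0r rnorm0 mulr0.
have hx := rnorm_gt0 x0; have hy := rnorm_gt0 y0.
have := sqr_ge0 (rnorm ((rnorm y)%:C *: x - (rnorm x)%:C *: y)).
rewrite rnormB_sqr !rnormZ innerZl innerZr !ger0_norm ?rnorm_ge0//.
set a := rnorm x in hx *; set b := rnorm y in hy *.
have ab : 0 < a * b by apply: mulr_gt0.
move=> h; rewrite -(ler_pM2l ab); nra.
Qed.

Lemma inner_abs x y : `|ip x y| <= rnorm x * rnorm y.
Proof.
rewrite ler_norml inner_le andbT lerNl -innerNl (le_trans (inner_le _ _))//.
by rewrite rnormN.
Qed.

Lemma parallelogram x y :
  rnorm (x + y) ^+ 2 + rnorm (x - y) ^+ 2 = 2 * rnorm x ^+ 2 + 2 * rnorm y ^+ 2.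
Proof. rewrite rnormD_sqr rnormB_sqr; ring. Qed.

Lemma rnormD_sqr_le x y : rnorm (x + y) ^+ 2 <= 2 * rnorm x ^+ 2 + 2 * rnorm y ^+ 2.
Proof. rewrite -parallelogram; have := sqr_ge0 (rnorm (x - y)); lra. Qed.

End RealInner.

Definition cvg_rnorm (R : realType) (V : normedModType R[i]) (x : nat -> V) (l : V) :=
  forall e : R, 0 < e -> exists N, forall k, (N <= k)%N -> rnorm (x k - l) < e.

Section Completeness.
Context {R : realType} {H : completeNormedModType R[i]}.

Lemma gt0_complex (e : R[i]) : 0 < e -> exists2 r : R, 0 < r & e = r%:C.
Proof.
case: e => a b; rewrite ltcE /= => /andP[/eqP -> a0].
by exists a.
Qed.

Lemma rnorm_complete (x : nat -> H) :
  (forall e : R, 0 < e -> exists N, forall m k, (N <= m)%N -> (N <= k)%N ->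
     rnorm (x m - x k) < e) ->
  exists l, cvg_rnorm x l.
Proof.
move=> hC.
have cF : cauchy (x k @[k --> \oo]).
  apply: cauchy_exP => _ /gt0_complex[e e0 ->].
  have [N hN] := hC _ e0; exists (x N).
  exists N => // k /= Nk.
  by apply/rnorm_ball => //; apply: hN.
have /cvg_ex[l hl] : cvg (x k @[k --> \oo]) by apply: cauchy_cvg.
exists l => e e0.
have ec : 0 < e%:C by rewrite ltcR.
have /cvgrPdist_lt/(_ _ ec) := hl.
case=> N _ hN; exists N => k Nk.
have := hN k Nk; by rewrite /= normE ltcR rnormBC.
Qed.

End Completeness.

Section Projection.
Context {R : realType} {H : completeNormedModType R[i]}.
Variables (dot : {dot H for @conjc R}).
Hypothesis (Hdot : hilbert dot).
Local Notation ip := (inner dot).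
Local Notation n := (@rnorm R H).
Implicit Types (M : set H) (x y z : H).

Lemma invS_gt0 k : 0 < k.+1%:R^-1 :> R.
Proof. by rewrite invr_gt0 ltr0n. Qed.

Lemma inv_natS_lt (e : R) : 0 < e ->
  exists N, forall k, (N <= k)%N -> k.+1%:R^-1 < e.
Proof.
move=> e0; have [N _ hN] := near_infty_natSinv_lt (PosNum e0).
by exists N => k Nk; apply: hN.
Qed.

(** Real scalars suffice: the projection argument perturbs only along real multiples, and
    orthogonality is meant for the real product [inner]. *)
Definition real_subspace M :=
  [/\ M 0, forall x y, M x -> M y -> M (x + y) & forall (r : R) x, M x -> M (r%:C *: x)].

Definition seq_closed M :=
  forall x, (forall e : R, 0 < e -> exists2 y, M y & n (x - y) < e) -> M x.

Lemma subspaceB M x y : real_subspace M -> M x -> M y -> M (x - y).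
Proof.
move=> [_ MD MZ] Mx My; apply: MD => //.
by have := MZ (-1) _ My; rewrite rmorphN /= scaleN1r.
Qed.

Lemma quadratic_ge0_eq0 (q c : R) : 0 <= q ->
  (forall r, 0 <= r ^+ 2 * q - 2 * r * c) -> c = 0.
Proof.
(* The minimiser would be c / q; dividing by q + 1 also covers q = 0 and still makes the value
   negative unless c = 0. *)
move=> q0 h; have := h (c / (q + 1)).
have q1 : 0 < q + 1 by lra.
have -> : (c / (q + 1)) ^+ 2 * q - 2 * (c / (q + 1)) * c
  = - (c ^+ 2 * ((q + 2) / (q + 1) ^+ 2)).
  by field; rewrite gt_eqF.
rewrite oppr_ge0 pmulr_lle0 => [|]; last first.
  by apply: divr_gt0; [lra | apply: exprn_gt0].
by move=> c0; apply/eqP; rewrite -sqrf_eq0 eq_le c0 sqr_ge0.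
Qed.

(** A minimising sequence for the distance to M is Cauchy by the parallelogram law, its midpoints
    lying in M; orthogonality is the first variation at the minimiser. *)
Lemma projection M x : real_subspace M -> seq_closed M ->
  exists2 p, M p & forall y, M y -> ip (x - p) y = 0.
Proof.
move=> Msub Mcl; have [M0 MD MZ] := Msub.
pose E := [set n (x - y) ^+ 2 | y in M].
have E0 : E !=set0 by exists (n (x - 0) ^+ 2); exists 0.
have Elb : has_lbound E by exists 0 => _ [y _ <-]; apply: sqr_ge0.
have hE : has_inf E by split.
pose d := inf E.
have dle y : M y -> d <= n (x - y) ^+ 2 by move=> My; apply: ge_inf => //; exists y.
have /choice[f hf] (k : nat) : exists y, M y /\ n (x - y) ^+ 2 < d + k.+1%:R^-1.
  have [_ [y My <-] hy] := inf_adherent (eps := k.+1%:R^-1) (invS_gt0 k) hE.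
  by exists y.
have fC (m k : nat) : n (f m - f k) ^+ 2 <= 2 * m.+1%:R^-1 + 2 * k.+1%:R^-1.
  have [Mm hm] := hf m; have [Mk hk] := hf k.
  have := parallelogram Hdot (x - f m) (x - f k).
  have -> : x - f m - (x - f k) = f k - f m by apply: (inner_ext Hdot) => z; rewrite !(innerDl, innerNl); ring.
  have -> : x - f m + (x - f k) = 2%:C *: (x - (2^-1)%:C *: (f m + f k)).
    by apply: (inner_ext Hdot) => z; rewrite !(innerDl, innerNl, innerZl); field.
  rewrite rnormZ ger0_norm// exprMn (rnormBC (f k)).
  move: hm hk (dle _ (MZ 2^-1 _ (MD _ _ Mm Mk))).
  move: (m.+1%:R^-1) (k.+1%:R^-1) => u v; lra.
have [p hp] : exists p, cvg_rnorm f p.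
  apply: rnorm_complete => e e0.
  have e4 : 0 < e ^+ 2 / 4 by apply: divr_gt0 => //; apply: exprn_gt0.
  have [N hN] := inv_natS_lt e4; exists N => m k Nm Nk.
  move: (fC m k) (hN _ Nm) (hN _ Nk).
  move: (m.+1%:R^-1) (k.+1%:R^-1) => u v h1 h2 h3.
  have h4 : n (f m - f k) ^+ 2 < e ^+ 2 by lra.
  by rewrite -(ltr_pXn2r (n := 2)) ?nnegrE ?rnorm_ge0// ltW.
have Mp : M p.
  apply: Mcl => e e0; have [N hN] := hp _ e0; exists (f N); first by case: (hf N).
  by rewrite rnormBC hN.
have pmin y : M y -> n (x - p) <= n (x - y).
  move=> My; rewrite leNgt; apply/negP => hlt.
  set b := n (x - y) in hlt; set g := n (x - p) - b.
  have g0 : 0 < g by rewrite subr_gt0.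
  have g2 : 0 < g / 2 by lra.
  have g4 : 0 < g ^+ 2 / 4 by apply: divr_gt0 => //; apply: exprn_gt0.
  have [N1 h1] := hp _ g2; have [N2 h2] := inv_natS_lt g4.
  pose k := maxn N1 N2.
  have hk1 := h1 k (leq_maxl _ _); have hk2 := h2 k (leq_maxr _ _).
  have [_ hk3] := hf k; have := dle _ My; rewrite -/b => hb.
  move: hk2 hk3; move: (k.+1%:R^-1) => u hk2 hk3.
  have := ler_rnormDB (f k) x p => htri.
  have b0 : 0 <= b by apply: rnorm_ge0.
  have := rnorm_ge0 (x - f k) => hk0.
  have hlow : b + g / 2 < n (x - f k) by rewrite /g in hk1 *; lra.
  have : (b + g / 2) ^+ 2 < n (x - f k) ^+ 2 by rewrite ltr_pXn2r ?nnegrE //; lra.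
  nra.
exists p => // y My.
apply: (@quadratic_ge0_eq0 (n y ^+ 2)); first exact: sqr_ge0.
move=> r.
have := pmin _ (MD _ _ Mp (MZ r _ My)) => hle.
have : n (x - p) ^+ 2 <= n (x - p - r%:C *: y) ^+ 2.
  by rewrite ler_pXn2r ?nnegrE ?rnorm_ge0// -addrA -opprD.
rewrite (rnormB_sqr Hdot (x - p)) rnormZ exprMn innerZr real_normK ?num_real//.
lra.
Qed.

End Projection.

(** * Nonnegative selfadjoint operators with compact resolvent *)

Section SelfAdjoint.
Context {R : realType} {H : completeNormedModType R[i]}.
Variables (dot : {dot H for @conjc R}).
Hypothesis (Hdot : hilbert dot).
Local Notation ip := (inner dot).
Local Notation n := (@rnorm R H).

Section Linear.
Variable A : operator H.
Hypothesis Alin : linear_operator A.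

Lemma dom0 : dom A 0. Proof. by case: Alin. Qed.

Lemma domD x y : dom A x -> dom A y -> dom A (x + y).
Proof. by move=> hx hy; have [_ /(_ 1 x y hx hy)[]] := Alin; rewrite scale1r. Qed.

Lemma opD x y : dom A x -> dom A y -> A (x + y) = A x + A y.
Proof. by move=> hx hy; have [_ /(_ 1 x y hx hy)[_]] := Alin; rewrite !scale1r. Qed.

Lemma op0 : A 0 = 0.
Proof.
apply/eqP; rewrite -(subr_eq0 _ 0) subr0; apply/eqP.
have := opD dom0 dom0; rewrite addr0 => /(congr1 (fun z => z - A 0)).
by rewrite subrr addrK.
Qed.

Lemma domZ a x : dom A x -> dom A (a *: x).
Proof. by move=> hx; have [_ /(_ a x 0 hx dom0)[]] := Alin; rewrite addr0. Qed.

Lemma opZ a x : dom A x -> A (a *: x) = a *: A x.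
Proof.
by move=> hx; have [_ /(_ a x 0 hx dom0)[_]] := Alin; rewrite op0 !addr0.
Qed.

Lemma domN x : dom A x -> dom A (- x).
Proof. by rewrite -scaleN1r; apply: domZ. Qed.

Lemma opN x : dom A x -> A (- x) = - A x.
Proof. by rewrite -scaleN1r => /opZ ->; rewrite scaleN1r. Qed.

Lemma domB x y : dom A x -> dom A y -> dom A (x - y).
Proof. by move=> hx hy; apply: domD => //; apply: domN. Qed.

Lemma opB x y : dom A x -> dom A y -> A (x - y) = A x - A y.
Proof. by move=> hx hy; rewrite opD ?opN//; apply: domN. Qed.

Lemma dom_sum (I : Type) (r : seq I) (P : pred I) (F : I -> H) :
  (forall i, P i -> dom A (F i)) -> dom A (\sum_(i <- r | P i) F i).
Proof. by move=> h; apply: big_ind => //; [exact: dom0 | exact: domD]. Qed.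

Lemma op_sum (I : Type) (r : seq I) (P : pred I) (F : I -> H) :
  (forall i, P i -> dom A (F i)) ->
  A (\sum_(i <- r | P i) F i) = \sum_(i <- r | P i) A (F i).
Proof.
move=> h.
suff [_ ->] : dom A (\sum_(i <- r | P i) F i) /\
  A (\sum_(i <- r | P i) F i) = \sum_(i <- r | P i) A (F i) by [].
apply: (big_ind2 (fun x y => dom A x /\ A x = y)).
- by split; [exact: dom0 | exact: op0].
- by move=> x1 x2 y1 y2 [d1 <-] [d2 <-]; split; [exact: domD | exact: opD].
- by move=> i Pi; split => //; apply: h.
Qed.

End Linear.

Variable A : operator H.
Hypotheses (Asa : selfadjoint dot A) (Age0 : nonnegative dot A).

Let Alin : linear_operator A. Proof. by case: Asa. Qed.

Lemma sa_linear : linear_operator A. Proof. exact: Alin. Qed.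

Lemma sa_sym x y : dom A x -> dom A y -> ip (A x) y = ip x (A y).
Proof.
move=> dx dy; have [_ _ /(_ y (A y))[_ h]] := Asa.
by rewrite /inner (h (conj dy erefl)).
Qed.

(** The adjoint graph asks for a complex identity. Its imaginary part is the real identity applied
    to ['i *: x], which stays in the domain. *)
Lemma sa_maximal y z : (forall x, dom A x -> ip (A x) y = ip x z) ->
  dom A y /\ A y = z.
Proof.
move=> h; have [_ _ /(_ y z)[hi _]] := Asa; apply: hi => x dx.
rewrite !dotE (h _ dx); congr (_ +i* _).
by rewrite !innerir; apply: oppr_inj; rewrite -!inneril -(opZ Alin)// h//; apply: domZ.
Qed.

Lemma sa_dense x (e : R) : 0 < e -> exists2 y, dom A y & n (x - y) < e.
Proof.
move=> e0; have [_ hd _] := Asa.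
have : topology_structure.closure (dom A) x by rewrite hd.
move=> /(_ (ball x e%:C)) []; first by apply: nbhsx_ballx; rewrite ltcR.
by move=> y [dy /rnorm_ball hy]; exists y => //; apply: hy.
Qed.

Lemma sa_ge0 x : dom A x -> 0 <= ip (A x) x.
Proof. by move=> /Age0; rewrite lecE /inner => /andP[]. Qed.

(** Adjoints are closed: the pairing with each fixed w of the domain passes to the limit, and
    [sa_maximal] reads the result back. *)
Lemma sa_closed x z :
  (forall e : R, 0 < e -> exists y, [/\ dom A y, n (y - x) < e & n (A y - z) < e]) ->
  dom A x /\ A x = z.
Proof.
move=> h; apply: sa_maximal => w dw.
apply/eqP; rewrite -subr_eq0 -normr_le0; apply/ler_addgt0Pl => e e0; rewrite addr0.
pose c := n (A w) + n w + 1.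
have c0 : 0 < c by have := rnorm_ge0 (A w); have := rnorm_ge0 w; rewrite /c; lra.
have [y [dy h1 h2]] := h _ (divr_gt0 e0 c0).
have -> : ip (A w) x - ip w z = ip w (A y - z) - ip (A w) (y - x).
  by rewrite !(innerDr, innerNr) (sa_sym dw dy); ring.
apply: (le_trans (ler_normB _ _)).
have := inner_abs Hdot w (A y - z); have := inner_abs Hdot (A w) (y - x) => h3 h4.
have e' : e / c * c = e by field; rewrite gt_eqF.
have := rnorm_ge0 (A w); have := rnorm_ge0 w.
have h5 : n w * n (A y - z) <= n w * (e / c) by rewrite ler_wpM2l ?rnorm_ge0 ?ltW.
have h6 : n (A w) * n (y - x) <= n (A w) * (e / c) by rewrite ler_wpM2l ?rnorm_ge0 ?ltW.
have := divr_gt0 e0 c0; rewrite /c in e' *; nra.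
Qed.

Lemma shift_lower (c : R) x : 0 < c -> dom A x -> c * n x <= n (A x + c%:C *: x).
Proof.
move=> c0 dx.
rewrite -(ler_pXn2r (n := 2)) ?nnegrE ?rnorm_ge0//; last by rewrite mulr_ge0 ?rnorm_ge0 ?ltW.
rewrite (rnormD_sqr Hdot) rnormZ innerZr (ger0_norm (ltW c0)) exprMn.
have := mulr_ge0 (ltW c0) (sa_ge0 dx); have := sqr_ge0 (n (A x)); lra.
Qed.

(** The range is closed by the lower bound [shift_lower]. A vector orthogonal to it lies in the
    domain by [sa_maximal] and satisfies A z = - c z, so nonnegativity forces z = 0. *)
Lemma shift_surj (c : R) y : 0 < c -> exists2 x, dom A x & A x + c%:C *: x = y.
Proof.
move=> c0.
pose M := [set z | exists2 x, dom A x & A x + c%:C *: x = z].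
have Msub : real_subspace M.
  split.
  - by exists 0; [exact: dom0 | rewrite op0// scaler0 addr0].
  - move=> _ _ [x dx <-] [w dw <-]; exists (x + w); first exact: domD.
    by rewrite opD// scalerDr addrACA.
  - move=> r _ [x dx <-]; exists (r%:C *: x); first exact: domZ.
    by rewrite opZ// scalerDr !scalerA mulrC.
have Mcl : seq_closed M.
  move=> z hz.
  have /choice[f hf] (k : nat) : exists x, dom A x /\ n (z - (A x + c%:C *: x)) < k.+1%:R^-1.
    have [_ [x dx <-] hx] := hz k.+1%:R^-1 (invS_gt0 k).
    by exists x.
  have bnd m k : c * n (f m - f k) <= m.+1%:R^-1 + k.+1%:R^-1.
    have [dm hm] := hf m; have [dk hk] := hf k.
    apply: (le_trans (shift_lower c0 (domB Alin dm dk))).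
    rewrite opB// scalerBr addrACA -opprD.
    apply: (le_trans (ler_rnormDB z _ _)).
    by rewrite rnormBC lerD// ltW.
  have [x hx] : exists x, cvg_rnorm f x.
    apply: rnorm_complete => e e0.
    have e2 : 0 < c * e / 2 by rewrite divr_gt0// mulr_gt0.
    have [N hN] := inv_natS_lt e2; exists N => m k Nm Nk.
    move: (bnd m k) (hN _ Nm) (hN _ Nk).
    move: (m.+1%:R^-1) (k.+1%:R^-1) => u v h1 h2 h3.
    by rewrite -(ltr_pM2l c0); lra.
  have [|dx Ax] := @sa_closed x (z - c%:C *: x).
    move=> e e0.
    have c1 : 0 < c + 1 by lra.
    have e2 : 0 < e / 2 / (c + 1) by do 2 apply: divr_gt0 => //.
    have [N1 h1] := hx _ e2.
    have [N2 h2] := inv_natS_lt (ltac:(lra) : 0 < e / 2).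
    pose k := maxn N1 N2.
    have hk1 := h1 k (leq_maxl _ _); have hk2 := h2 k (leq_maxr _ _).
    have [dk hk] := hf k; exists (f k).
    move: hk2 hk; move: (k.+1%:R^-1) => u hk2 hk.
    have ee : e / 2 / (c + 1) * (c + 1) = e / 2 by field; rewrite gt_eqF.
    have := rnorm_ge0 (f k - x) => p0.
    split => //; first by nra.
    have -> : A (f k) - (z - c%:C *: x) = - (z - (A (f k) + c%:C *: f k)) - c%:C *: (f k - x).
      by apply: (inner_ext Hdot) => w; rewrite !(innerDl, innerNl, innerZl); ring.
    apply: (le_lt_trans (ler_rnormB _ _)).
    rewrite rnormN rnormZ (ger0_norm (ltW c0)); nra.
  by exists x => //; rewrite Ax subrK.
have [p [x dx px] hp] := projection Hdot y Msub Mcl.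
suff e0 : y - p = 0 by exists x => //; rewrite px; apply/esym/eqP; rewrite -subr_eq0 e0.
have [|dz Az] := @sa_maximal (y - p) (- (c%:C *: (y - p))).
  move=> w dw; rewrite innerNr innerZr.
  have := hp _ (ex_intro2 _ _ w dw erefl).
  by rewrite innerDr innerZr !(innerC _ (y - p)); lra.
have := sa_ge0 dz; rewrite Az innerNl innerZl (inner_rnorm Hdot) => h.
apply: rnorm_eq0; apply/eqP; rewrite -sqrf_eq0 eq_le sqr_ge0 andbT.
by rewrite -(ler_pM2l c0) mulr0; lra.
Qed.

End SelfAdjoint.

(** * The inverse of A + Id: compactness and its largest eigenvalue on invariant subspaces *)

Section Resolvent.
Context {R : realType} {H : completeNormedModType R[i]}.
Variables (dot : {dot H for @conjc R}).
Hypothesis (Hdot : hilbert dot).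
Local Notation ip := (inner dot).
Local Notation n := (@rnorm R H).
Variable A : operator H.
Hypotheses (Asa : selfadjoint dot A) (Age0 : nonnegative dot A).
Let Alin : linear_operator A. Proof. exact: sa_linear Asa. Qed.

Variable K : H -> H.
Hypothesis KP : forall y, dom A (K y) /\ A (K y) + K y = y.

Lemma shift1_lower x : dom A x -> n x <= n (A x + x).
Proof. by move=> dx; have := shift_lower Hdot Age0 ltr01 dx; rewrite mul1r scale1r. Qed.

Lemma resolventK x : dom A x -> K (A x + x) = x.
Proof.
move=> dx; have [dK hK] := KP (A x + x).
apply/eqP; rewrite -subr_eq0; apply/eqP/rnorm_eq0/eqP; rewrite eq_le rnorm_ge0 andbT.
apply: (le_trans (shift1_lower (domB Alin dK dx))).
by rewrite (opB Alin)// addrACA -opprD hK subrr rnorm0.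
Qed.

Lemma resolventD x y : K (x + y) = K x + K y.
Proof.
have [dx hx] := KP x; have [dy hy] := KP y.
by rewrite -{1}hx -{1}hy addrACA -(opD Alin)// resolventK//; apply: domD.
Qed.

Lemma resolventZ a x : K (a *: x) = a *: K x.
Proof.
have [dx hx] := KP x.
by rewrite -{1}hx scalerDr -(opZ Alin)// resolventK//; apply: domZ.
Qed.

Lemma resolventB x y : K (x - y) = K x - K y.
Proof. by rewrite -scaleN1r resolventD resolventZ scaleN1r. Qed.

Lemma resolvent_sym x y : ip (K x) y = ip x (K y).
Proof.
have [dx hx] := KP x; have [dy hy] := KP y.
by rewrite -{1}hy -{2}hx innerDl innerDr (sa_sym Asa).
Qed.

Lemma resolvent_ge y : n (K y) ^+ 2 <= ip (K y) y.
Proof.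
have [dy hy] := KP y; rewrite -{3}hy innerDr (inner_rnorm Hdot) lerDr.
by rewrite innerC (sa_ge0 Age0).
Qed.

Lemma resolvent_le y : n (K y) <= n y.
Proof. by have [dy {2}<-] := KP y; apply: shift1_lower. Qed.

Lemma resolvent_inj y : K y = 0 -> y = 0.
Proof. by have [_ {2}<-] := KP y => ->; rewrite (op0 Alin) addr0. Qed.

Hypothesis Acpt : compact_resolvent A.

(** Compactness is assumed at some unspecified [lambda]. The resolvent identity, K y = K0 (y - (1 +
    lambda) K y), carries it to the point -1. The conclusion is a cluster point, which avoids
    extracting subsequences. *)
Lemma resolvent_compact (y : nat -> H) (b : R) : (forall k, n (y k) <= b) ->
  exists x, forall e : R, 0 < e -> forall N, exists2 k, (N <= k)%N & n (K (y k) - x) < e.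
Proof.
move=> yb; have [lam [K0 [_ [_ K0r] K0c]]] := Acpt.
pose z k := y k - (1 + lam) *: K (y k).
have Kz k : K (y k) = K0 (z k).
  have [dk hk] := KP (y k); rewrite -[LHS]K0r//; congr (K0 _).
  by rewrite /z -[X in _ = X - _]hk scalerDl scale1r opprD addrA addrK.
have b0 : 0 <= b by apply: le_trans (yb 0%N); apply: rnorm_ge0.
pose c := complex.Re `|1 + lam|.
have c0 : 0 <= c by rewrite -ler0c /c RRe_real// ger0_real.
have bE : bounded_set (range z).
  exists (b + c * b)%:C; split; first by apply: ger0_real; rewrite ler0c addr_ge0// mulr_ge0.
  move=> M hM _ [k _ <-] /=.
  apply: (le_trans _ (ltW hM)); rewrite normE lecR.
  apply: (le_trans (ler_rnormB _ _)); rewrite rnormZC lerD// ler_wpM2l//.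
  exact: le_trans (resolvent_le _) _.
have := K0c _ bE; rewrite precompactE => /(_ (K (y k) @[k --> \oo]) _).
case.
  exists 0%N => // k _ /=; apply: topology_structure.subset_closure; exists (z k); first by exists k.
  by rewrite Kz.
move=> x [_ hx]; exists x => e e0 N.
have [||_ [[k Nk <-] hk]] := hx [set K (y k) | k in [set k | (N <= k)%N]] (ball x e%:C).
- by exists N => // k Nk; exists k.
- by apply: nbhsx_ballx; rewrite ltcR.
- by exists k => //; rewrite rnormBC; apply/rnorm_ball.
Qed.

(** The eigenvalue m is the supremum of the quadratic form of K on the unit ball of M, positive
    because K is injective and [resolvent_ge] holds. A maximising sequence is an approximate
    eigenvector, and compactness yields an exact one. *)
Lemma top_eigenvector (M : set H) (x0 : H) : real_subspace M -> seq_closed M ->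
  (forall x, M x -> M (K x)) -> M x0 -> x0 != 0 ->
  exists m : R, [/\ 0 < m,
    exists2 f, M f /\ f != 0 & K f = m%:C *: f &
    forall y, M y -> ip (K y) y <= m * n y ^+ 2].
Proof.
move=> Msub Mcl MK Mx0 x00; have [M0 MD MZ] := Msub.
pose E := [set ip (K y) y | y in [set y | M y /\ n y <= 1]].
have Kub y : ip (K y) y <= n y ^+ 2.
  apply: (le_trans (inner_le Hdot _ _)); rewrite expr2 ler_wpM2r ?rnorm_ge0//.
  exact: resolvent_le.
have Eub : has_ubound E.
  exists 1 => _ [y [_ hy] <-]; apply: (le_trans (Kub y)).
  by rewrite expr_le1 ?rnorm_ge0.
have hE : has_sup E by split=> //; exists (ip (K 0) 0), 0 => //; split=> //; rewrite rnorm0.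
pose m := sup E.
have mle1 y : M y -> n y <= 1 -> ip (K y) y <= m.
  by move=> My ny; apply: ub_le_sup => //; exists y.
have mle y : M y -> ip (K y) y <= m * n y ^+ 2.
  move=> My; have [->|y0] := eqVneq y 0.
    by rewrite inner0r rnorm0 expr0n mulr0.
  have ny := rnorm_gt0 y0.
  have : ip (K ((n y)^-1%:C *: y)) ((n y)^-1%:C *: y) <= m.
    apply: mle1; first exact: MZ.
    by rewrite rnormZ ger0_norm ?invr_ge0 ?rnorm_ge0// mulVf// gt_eqF.
  rewrite resolventZ innerZl innerZr => h.
  rewrite -(ler_pM2l (x := (n y)^-1 ^+ 2)) ?exprn_gt0 ?invr_gt0//.
  by rewrite mulrCA -exprMn mulVf ?gt_eqF// expr1n mulr1 expr2 -mulrA.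
have m0 : 0 < m.
  have Kx0 : 0 < n (K x0).
    by apply: rnorm_gt0; apply: contra x00 => /eqP/resolvent_inj/eqP.
  have h1 := mle _ Mx0; have h2 := resolvent_ge x0.
  have h3 : 0 < n (K x0) ^+ 2 by apply: exprn_gt0.
  by rewrite -(pmulr_lgt0 (x := n x0 ^+ 2)) ?exprn_gt0 ?rnorm_gt0//; lra.
(* Cauchy-Schwarz for the form [ip (K x) y], combined with the bound by m *)
have KK y : M y -> n (K y) ^+ 2 <= m * ip (K y) y.
  move=> My; set a := n (K y) ^+ 2; set b := ip (K y) y.
  have hq (r : R) : 0 <= b - 2 * r * a + r ^+ 2 * (m * a).
    have h1 := mle _ (MK _ My); rewrite -/a in h1.
    have := mulr_ge0 (sqr_ge0 r) (ltac:(by rewrite subr_ge0) : 0 <= m * a - ip (K (K y)) (K y)).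
    have := le_trans (sqr_ge0 _) (resolvent_ge (y - r%:C *: K y)).
    rewrite resolventB resolventZ !(innerDl, innerDr, innerNl, innerNr, innerZl, innerZr).
    rewrite (resolvent_sym (K y) y) -/b (inner_rnorm Hdot) -/a.
    lra.
  have := hq m^-1.
  have -> : m^-1 ^+ 2 * (m * a) = m^-1 * a by field; rewrite gt_eqF.
  move=> h; rewrite -(ler_pM2l (x := m^-1)) ?invr_gt0// mulKf ?gt_eqF//; lra.
exists m; split => //.
have /choice[y hy] (k : nat) : exists y, [/\ M y, n y <= 1 & m - k.+1%:R^-1 < ip (K y) y].
  have [_ [y [My ny] <-] hy] := sup_adherent (eps := k.+1%:R^-1) (invS_gt0 k) hE.
  by exists y.
have [x hx] := @resolvent_compact y 1 (fun k => let: And3 _ h _ := hy k in h).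
(* Expanding the square and using [KK] leaves at most m (m - ip (K y) y), small along the maximising
   sequence. *)
have diff k : n (K (y k) - m%:C *: y k) ^+ 2 <= m * k.+1%:R^-1.
  have [My ny hk] := hy k; have := KK _ My.
  rewrite (rnormB_sqr Hdot) rnormZ innerZr (ger0_norm (ltW m0)) exprMn.
  have : n (y k) ^+ 2 <= 1 by rewrite expr_le1 ?rnorm_ge0.
  move: hk; move: (k.+1%:R^-1) (ip _ _) (n (K _) ^+ 2) (n _ ^+ 2) => u b c d; nra.
pose f := m^-1%:C *: x.
have apx (e : R) : 0 < e -> exists k, [/\ n (y k - f) < e, n (K (y k) - x) < e & m - e < ip (K (y k)) (y k)].
  move=> e0; pose d := Num.min e (m * e / 2).
  have d0 : 0 < d by rewrite lt_min e0 divr_gt0// mulr_gt0.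
  have d1 : 0 < Num.min e (d ^+ 2 / m) by rewrite lt_min e0 divr_gt0// exprn_gt0.
  have [N hN] := inv_natS_lt d1; have [k Nk hk] := hx _ d0 N.
  exists k; have [My ny hk'] := hy k; have := hN _ Nk; rewrite lt_min => /andP[h1 h2].
  split; last by apply: lt_trans hk'; rewrite ltrD2l ltrN2.
  - have -> : y k - f = m^-1%:C *: ((K (y k) - x) - (K (y k) - m%:C *: y k)).
      apply: (inner_ext Hdot) => z; rewrite /f !(innerDl, innerNl, innerZl).
      by field; rewrite gt_eqF.
    rewrite rnormZ ger0_norm ?invr_ge0 ?ltW// mulrC ltr_pdivrMr//.
    apply: (le_lt_trans (ler_rnormB _ _)).
    have hd : n (K (y k) - m%:C *: y k) < d.
      rewrite -(ltr_pXn2r (n := 2)) ?nnegrE ?rnorm_ge0 ?ltW//.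
      apply: (le_lt_trans (diff k)); by rewrite mulrC -ltr_pdivlMr.
    have : d <= m * e / 2 by rewrite ge_min lexx orbT.
    lra.
  - by apply: (lt_le_trans hk); rewrite ge_min lexx.
have Mf : M f.
  apply: Mcl => e /apx[k [h1 _ _]]; exists (y k); last by rewrite rnormBC.
  by case: (hy k).
exists f.
  (* If f were 0, some y k would have norm below both 1 and m / 2, hence quadratic form below m / 2,
     although it exceeds m - e >= m / 2. *)
  split => //; apply/negP => /eqP f0.
  pose e := Num.min 1 (m / 2).
  have e0 : 0 < e by rewrite lt_min ltr01 divr_gt0.
  have [k [+ _]] := apx _ e0; rewrite f0 subr0 => h1 h2.
  have := Kub (y k); have e1 : e <= 1 by rewrite ge_min lexx.
  have e2 : e <= m / 2 by rewrite ge_min lexx orbT.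
  have : n (y k) ^+ 2 <= n (y k) by rewrite expr2 ler_piMl ?rnorm_ge0//; lra.
  lra.
have -> : m%:C *: f = x by rewrite /f scalerA -rmorphM /= mulfV ?gt_eqF// scale1r.
apply/eqP; rewrite -subr_eq0; apply/eqP/rnorm_eq0/eqP.
rewrite eq_le rnorm_ge0 andbT; apply/ler_addgt0Pl => e e0; rewrite addr0.
have [k [h1 h2 _]] := apx _ (divr_gt0 e0 (ltr0n R 2)).
apply: (le_trans (ler_rnormDB (K (y k)) _ _)).
rewrite -resolventB.
have := resolvent_le (f - y k); rewrite (rnormBC f); lra.
Qed.

End Resolvent.

(** * The square roots of A and A + Id, compared on dom A as a common core *)

Section Sqrt.
Context {R : realType} {H : completeNormedModType R[i]}.
Variables (dot : {dot H for @conjc R}).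
Hypothesis (Hdot : hilbert dot).
Local Notation ip := (inner dot).
Local Notation n := (@rnorm R H).

Lemma sqrt_dom (A S : operator H) x : is_sqrt dot A S -> dom A x -> dom S x.
Proof. by case=> _ _ /(_ x)[[h _] _] /h[]. Qed.

Lemma sqrt_dom2 (A S : operator H) x : is_sqrt dot A S -> dom A x -> dom S (S x).
Proof. by case=> _ _ /(_ x)[[h _] _] /h[]. Qed.

Lemma sqrt_inner (A S : operator H) x y : is_sqrt dot A S ->
  dom A x -> dom S y -> ip (S x) (S y) = ip (A x) y.
Proof.
move=> hS dx dy; have [Ssa _ /(_ x)[_ ->//]] := hS.
by rewrite -(sa_sym Ssa)//; apply: sqrt_dom2 hS dx.
Qed.

Lemma sqrt_rnorm (A S : operator H) x : is_sqrt dot A S ->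
  dom A x -> n (S x) ^+ 2 = ip (A x) x.
Proof. by move=> hS dx; rewrite -(inner_rnorm Hdot) (sqrt_inner hS)//; apply: sqrt_dom hS dx. Qed.

Variables A S S1 : operator H.
Hypotheses (Asa : selfadjoint dot A) (Age0 : nonnegative dot A).
Hypotheses (SA : is_sqrt dot A S) (S1A : is_sqrt dot (add_id A) S1).
Let Alin : linear_operator A. Proof. exact: sa_linear Asa. Qed.
Let Slin : linear_operator S. Proof. by case: SA => /sa_linear. Qed.

Lemma shift_small (eps : R) x y : 0 < eps -> dom A x -> x + eps%:C *: A x = y -> n x <= n y.
Proof.
move=> e0 dx <-.
have ei : 0 < eps^-1 by rewrite invr_gt0.
have := shift_lower Hdot Age0 ei dx.
have -> : A x + (eps^-1)%:C *: x = (eps^-1)%:C *: (x + eps%:C *: A x).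
  by apply: (inner_ext Hdot) => z; rewrite !(innerDl, innerZl); field; rewrite gt_eqF.
by rewrite rnormZ (ger0_norm (ltW ei)) ler_pM2l.
Qed.

(** The maps (1 + eps A)^-1 are contractions by [shift_small], so it is enough to approximate y by
    some y' in the dense domain, where the error is at most eps |A y'|. *)
Lemma shift_approx y (e : R) : 0 < e -> exists2 eps0 : R, 0 < eps0 &
  forall (eps : R) x, 0 < eps -> eps <= eps0 -> dom A x -> x + eps%:C *: A x = y -> n (x - y) < e.
Proof.
move=> e0; have e3 : 0 < e / 3 by lra.
have [y' dy' hy'] := sa_dense Asa y e3.
have c0 : 0 < n (A y') + 1 by have := rnorm_ge0 (A y'); lra.
exists (e / 3 / (n (A y') + 1)); first exact: divr_gt0.
move=> eps x p0 ple dx hx.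
have := @shift_small eps (x - y') (y - y' - eps%:C *: A y') p0 (domB Alin dx dy').
rewrite (opB Alin)// => /(_ _)/wrap[].
  rewrite -hx; apply: (inner_ext Hdot) => z.
  by rewrite !(innerDl, innerNl, innerZl); ring.
move=> h1; have := ler_rnormB (y - y') (eps%:C *: A y').
rewrite rnormZ (ger0_norm (ltW p0)) => h2.
have h3 : eps * n (A y') <= e / 3.
  apply: (le_trans (ler_wpM2r (rnorm_ge0 _) ple)).
  by rewrite mulrAC ler_pdivrMr// ler_pM2l// lerDl ler01.
have := ler_rnormDB y' x y; rewrite (rnormBC y') => h4; lra.
Qed.

(* The approximations are (1 + eps A)^-1 y, which commutes with S. *)
Lemma sqrt_core y (e : R) : dom S y -> 0 < e ->
  exists x, [/\ dom A x, n (x - y) < e & n (S x - S y) < e].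
Proof.
move=> dy e0.
have [p1 p10 h1] := shift_approx y e0; have [p2 p20 h2] := shift_approx (S y) e0.
pose p := Num.min p1 p2.
have p0 : 0 < p by rewrite lt_min p10.
have [x dx hx] := shift_surj Hdot Asa Age0 (p^-1%:C *: y) (ltac:(by rewrite invr_gt0) : 0 < p^-1).
have {}hx : x + p%:C *: A x = y.
  transitivity (p%:C *: (p^-1%:C *: y)).
    rewrite -hx; apply: (inner_ext Hdot) => z; rewrite !(innerDl, innerZl).
    by field; rewrite gt_eqF.
  by rewrite scalerA -rmorphM /= mulfV ?gt_eqF// scale1r.
have [Ssa _ sq] := SA; have [dSx AE] := sq x.
have dx1 := sqrt_dom SA dx; have dx2 := sqrt_dom2 SA dx.
have Ax : A x = S (S x) by apply: AE.
have dAx : dom S (A x).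
  have -> : A x = p^-1%:C *: (y - x).
    rewrite -hx addrAC subrr add0r scalerA -rmorphM /= mulVf ?gt_eqF// scale1r//.
  by apply: (domZ Slin); apply: (domB Slin).
have [[_ dASx] ASx] := sq (S x).
have {}dASx : dom A (S x) by apply: dASx; rewrite -Ax.
exists x; split => //.
- by apply: (h1 p) => //; rewrite ge_min lexx.
- apply: (h2 p) => //; first by rewrite ge_min lexx orbT.
  rewrite ASx// -Ax -(opZ Slin)// -(opD Slin)// ?hx//; exact: domZ.
Qed.

(** [S1] is known only through its square, which on dom A gives |S1 x|^2 = |S x|^2 + |x|^2. Hence
    approximations in the graph norm of S are Cauchy for [S1], and [S1] is closed. *)
Lemma sqrt1_core y : dom S y -> dom S1 y /\ forall e : R, 0 < e ->
  exists x, [/\ dom A x, n (x - y) < e, n (S x - S y) < e & n (S1 x - S1 y) < e].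
Proof.
move=> dy; have [S1sa _ _] := S1A; have S1lin := sa_linear S1sa.
have n1 x : dom A x -> n (S1 x) <= n (S x) + n x.
  move=> dx; rewrite -(ler_pXn2r (n := 2)) ?nnegrE ?addr_ge0 ?rnorm_ge0//.
  rewrite (sqrt_rnorm S1A)//= innerDl -(sqrt_rnorm SA)// (inner_rnorm Hdot).
  have := mulr_ge0 (rnorm_ge0 (S x)) (rnorm_ge0 x); rewrite sqrrD; lra.
have /choice[f hf] (k : nat) := sqrt_core dy (@invS_gt0 R k).
have [z hz] : exists z, cvg_rnorm (fun k => S1 (f k)) z.
  apply: rnorm_complete => e e0.
  have [N hN] := inv_natS_lt (ltac:(lra) : 0 < e / 4); exists N => m k Nm Nk.
  have [dm m1 m2] := hf m; have [dk k1 k2] := hf k.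
  rewrite -(opB S1lin); [|by apply: (sqrt_dom S1A)..].
  apply: (le_lt_trans (n1 _ (domB Alin dm dk))).
  rewrite (opB Slin); [|by apply: (sqrt_dom SA)..].
  have := ler_rnormDB y (f m) (f k); have := ler_rnormDB (S y) (S (f m)) (S (f k)).
  rewrite (rnormBC y) (rnormBC (S y)).
  move: (lt_trans m1 (hN _ Nm)) (lt_trans m2 (hN _ Nm)).
  move: (lt_trans k1 (hN _ Nk)) (lt_trans k2 (hN _ Nk)); lra.
have ap e : 0 < e -> exists x, [/\ dom A x, n (x - y) < e, n (S x - S y) < e & n (S1 x - z) < e].
  move=> e0; have [N1 h1] := hz _ e0; have [N2 h2] := inv_natS_lt e0.
  exists (f (maxn N1 N2)); have [dk k1 k2] := hf (maxn N1 N2); split => //.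
  - by apply: lt_trans k1 (h2 _ (leq_maxr _ _)).
  - by apply: lt_trans k2 (h2 _ (leq_maxr _ _)).
  - exact: h1 _ (leq_maxl _ _).
have [|d1 S1y] := sa_closed Hdot S1sa (x := y) (z := z).
  move=> e /ap[x [dx h1 h2 h3]]; exists x; split => //.
  exact: (sqrt_dom S1A).
by rewrite S1y; split.
Qed.

(** This lets convergence in [energy_norm], which is stated with [S1], be split into convergence of
    y and of S y. *)
Lemma sqrt1_rnorm y : dom S y -> n (S y) <= n (S1 y) /\ n y <= n (S1 y).
Proof.
move=> dy; have [_ hy] := sqrt1_core dy.
have n1 x : dom A x -> n (S x) <= n (S1 x) /\ n x <= n (S1 x).
  move=> dx.
  have h : n (S x) ^+ 2 + n x ^+ 2 = n (S1 x) ^+ 2.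
    by rewrite (sqrt_rnorm S1A)//= innerDl -(sqrt_rnorm SA)// (inner_rnorm Hdot).
  by split; rewrite -(ler_pXn2r (n := 2)) ?nnegrE ?rnorm_ge0// -h ?lerDl ?lerDr sqr_ge0.
suff h (e : R) : 0 < e -> n (S y) <= n (S1 y) + e /\ n y <= n (S1 y) + e.
  by split; apply/ler_addgt0Pr => e /h[].
move=> e0; have [x [dx h1 h2 h3]] := hy _ (ltac:(lra) : 0 < e / 2).
have [h4 h5] := n1 _ dx.
have := ler_rnorm_dist y x; have := ler_rnorm_dist (S y) (S x).
have := ler_rnorm_dist (S1 x) (S1 y).
rewrite (rnormBC y) (rnormBC (S y)); split; lra.
Qed.

End Sqrt.

(** * Density of eigenvector sums and the spectral gap above the kernel *)

Section Spectral.
Context {R : realType} {H : completeNormedModType R[i]}.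
Variables (dot : {dot H for @conjc R}).
Hypothesis (Hdot : hilbert dot).
Local Notation ip := (inner dot).
Local Notation n := (@rnorm R H).
Variables A S : operator H.
Hypotheses (Asa : selfadjoint dot A) (Age0 : nonnegative dot A).
Hypotheses (Acpt : compact_resolvent A) (SA : is_sqrt dot A S).
Let Alin : linear_operator A. Proof. exact: sa_linear Asa. Qed.
Let Slin : linear_operator S. Proof. by case: SA => /sa_linear. Qed.

Definition eigenpair (B : operator H) (p : R * H) := dom B p.2 /\ B p.2 = p.1%:C *: p.2.

(** A plain list of pairs, with neither orthogonality nor distinct eigenvalues: the flow acts term
    by term, and its norm conservation is derived from an equation rather than from Parseval. *)
Definition eigensum (B : operator H) (x : H) :=
  exists2 s : seq (R * H), forall p, p \in s -> eigenpair B p & x = \sum_(p <- s) p.2.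

Lemma shift1_inverse : exists K : H -> H, forall y, dom A (K y) /\ A (K y) + K y = y.
Proof.
have /choice[K hK] (y : H) : exists x, dom A x /\ A x + x = y.
  have [x dx hx] := shift_surj Hdot Asa Age0 y ltr01.
  by exists x; split => //; rewrite -[X in _ + X]scale1r.
by exists K.
Qed.

Lemma eigensumD x y : eigensum A x -> eigensum A y -> eigensum A (x + y).
Proof.
move=> [s hs ->] [t ht ->]; exists (s ++ t); last by rewrite big_cat.
by move=> p; rewrite mem_cat => /orP[/hs|/ht].
Qed.

Lemma eigensumZ (r : R) x : eigensum A x -> eigensum A (r%:C *: x).
Proof.
move=> [s hs ->]; exists [seq (p.1, r%:C *: p.2) | p <- s].
  move=> _ /mapP[p /hs[dp Ap] ->]; split; first exact: domZ.
  by rewrite /= (opZ Alin)// Ap !scalerA mulrC.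
by rewrite big_map scaler_sumr.
Qed.

(** Otherwise the orthogonal complement of the eigenvector sums is a nonzero closed subspace
    invariant under K. [top_eigenvector] finds an eigenvector in it, which would be orthogonal to
    itself. *)
Lemma eigensum_dense x (e : R) : 0 < e -> exists2 y, eigensum A y & n (x - y) < e.
Proof.
move=> e0; have [K KP] := shift1_inverse.
pose M0 := [set x | forall e : R, 0 < e -> exists2 y, eigensum A y & n (x - y) < e].
suff : M0 x by exact.
have sub : real_subspace M0.
  split.
  - move=> d d0; exists 0; last by rewrite subr0 rnorm0.
    by exists [::] => //; rewrite big_nil.
  - move=> y z My Mz d d0; have d2 : 0 < d / 2 by lra.
    have [y' ey hy] := My _ d2; have [z' ez hz] := Mz _ d2.
    exists (y' + z'); first exact: eigensumD.
    by rewrite opprD addrACA; have := ler_rnormD (y - y') (z - z'); lra.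
  - move=> r y My d d0; have r1 : 0 < `|r| + 1 by have := normr_ge0 r; lra.
    have [y' ey hy] := My _ (divr_gt0 d0 r1).
    exists (r%:C *: y'); first exact: eigensumZ.
    rewrite -scalerBr rnormZ; move: hy; rewrite ltr_pdivlMr//.
    have := rnorm_ge0 (y - y'); nra.
have cl : seq_closed M0.
  move=> y hy d d0; have d2 : 0 < d / 2 by lra.
  have [z Mz hz] := hy _ d2; have [w ew hw] := Mz _ d2; exists w => //.
  by have := ler_rnormDB z y w; lra.
have [p Mp hp] := projection Hdot x sub cl.
suff xp : x - p = 0 by move/eqP: xp; rewrite subr_eq0 => /eqP ->.
apply: contrapT => /eqP z0.
pose M := [set z | forall f, eigensum A f -> ip z f = 0].
have Msub : real_subspace M.
  split.
  - by move=> f _; rewrite inner0l.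
  - by move=> y z My Mz f ef; rewrite innerDl My// Mz// addr0.
  - by move=> r y My f ef; rewrite innerZl My// mulr0.
have eig1 q : eigenpair A q -> eigensum A q.2.
  by move=> hq; exists [:: q]; [move=> q'; rewrite inE => /eqP -> | rewrite big_seq1].
have Mcl : seq_closed M.
  move=> z hz f ef; apply/eqP; rewrite -normr_le0; apply/ler_addgt0Pl => d d0; rewrite addr0.
  have f1 : 0 < n f + 1 by have := rnorm_ge0 f; lra.
  have [y My hy] := hz _ (divr_gt0 d0 f1).
  have -> : ip z f = ip (z - y) f by rewrite innerDl innerNl My// subr0.
  apply: (le_trans (inner_abs Hdot _ _)); move: hy; rewrite ltr_pdivlMr//.
  have := rnorm_ge0 (z - y); have := rnorm_ge0 f; nra.
have MK z : M z -> M (K z).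
  move=> Mz f [s hs ->]; rewrite (resolvent_sym Asa KP) Mz//.
  exists [seq (q.1, K q.2) | q <- s].
    move=> _ /mapP[q /hs[dq Aq] ->]; split; first by case: (KP q.2).
    have [dK hK] := KP q.2.
    have h1 : K (A q.2 + q.2) = q.2 by rewrite (resolventK Hdot Asa Age0 KP).
    rewrite /= Aq (resolventD Hdot Asa Age0 KP) (resolventZ Hdot Asa Age0 KP) in h1.
    by apply: (addIr (K q.2)); rewrite hK h1.
  elim: s {hs} => [|q s IH] /=; first by rewrite !big_nil -[RHS](resolventK Hdot Asa Age0 KP (dom0 Alin)) (op0 Alin) addr0.
  by rewrite !big_cons (resolventD Hdot Asa Age0 KP) IH.
have Mz : M (x - p).
  move=> f ef; apply: hp => d d0; exists f => //.
  by rewrite subrr rnorm0.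
have [m [m0 [f [Mf f0] Kf] _]] := top_eigenvector Hdot Asa Age0 KP Acpt Msub Mcl MK Mz z0.
have fK : f = m^-1%:C *: K f by rewrite Kf scalerA -rmorphM /= mulVf ?gt_eqF// scale1r.
have : eigensum A f.
  apply: (@eig1 (m^-1 - 1, f)); have [dK hK] := KP f.
  have df : dom A f by rewrite fK; apply: domZ.
  split => //=; rewrite rmorphB /= scalerBl scale1r.
  apply: (addIr f); rewrite subrK {1 2}fK (opZ Alin)//.
  by rewrite -[X in _ + X]fK {2}fK -scalerDr hK.
move=> /Mf; rewrite (inner_rnorm Hdot) => /eqP; rewrite sqrf_eq0 => /eqP/rnorm_eq0/eqP.
by rewrite (negbTE f0).
Qed.

(** Density in the graph norm: approximate A x + x instead of x, then apply K, which is a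
    contraction and preserves eigenvector sums. *)
Lemma eigensum_core x (e : R) : dom A x -> 0 < e ->
  exists y, [/\ eigensum A y, n (x - y) < e & n (A x - A y) < e].
Proof.
move=> dx e0; have [K KP] := shift1_inverse.
have [y [s hs ys] hy] := eigensum_dense (A x + x) (ltac:(lra) : 0 < e / 2).
have [dK hK] := KP y; exists (K y).
have KB : x - K y = K (A x + x - y).
  by rewrite (resolventB Hdot Asa Age0 KP) (resolventK Hdot Asa Age0 KP).
have h1 : n (x - K y) < e / 2.
  by rewrite KB; apply: le_lt_trans (resolvent_le Hdot Age0 KP _) hy.
split; last first.
- have -> : A x - A (K y) = (A x + x - y) - (x - K y).
    by rewrite -[X in _ + x - X]hK; apply: (inner_ext Hdot) => z; rewrite !(innerDl, innerNl); ring.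
  apply: le_lt_trans (ler_rnormB _ _) _; lra.
- lra.
exists [seq (q.1, K q.2) | q <- s].
  move=> _ /mapP[q /hs[dq Aq] ->]; split; first by case: (KP q.2).
  have [dKq hKq] := KP q.2.
  have h2 : K (A q.2 + q.2) = q.2 by rewrite (resolventK Hdot Asa Age0 KP).
  rewrite /= Aq (resolventD Hdot Asa Age0 KP) (resolventZ Hdot Asa Age0 KP) in h2.
  by apply: (addIr (K q.2)); rewrite hKq h2.
rewrite ys; elim: s {hs ys} => [|q s IH] /=.
  by rewrite !big_nil -[RHS](resolventK Hdot Asa Age0 KP (dom0 Alin)) (op0 Alin) addr0.
by rewrite !big_cons (resolventD Hdot Asa Age0 KP) IH.
Qed.

Definition in_kernel (B : operator H) (z : H) := dom B z /\ B z = 0.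

Definition kernel_projector (B : operator H) (P : H -> H) :=
  forall x, in_kernel B (P x) /\ forall z, in_kernel B z -> ip (x - P x) z = 0.

Lemma kernel_subspace : real_subspace (in_kernel A).
Proof.
split.
- by split; [exact: dom0 | exact: op0].
- by move=> x y [dx Ax] [dy Ay]; split; [exact: domD | rewrite (opD Alin)// Ax Ay addr0].
- by move=> r x [dx Ax]; split; [exact: domZ | rewrite (opZ Alin)// Ax scaler0].
Qed.

Lemma kernel_projector_exists : exists P, kernel_projector A P.
Proof.
have cl : seq_closed (in_kernel A).
  move=> x hx; apply: (sa_closed Hdot Asa) => e /hx[y [dy Ay] hy].
  by exists y; rewrite rnormBC Ay subrr rnorm0; split => //; apply: le_lt_trans hy; apply: rnorm_ge0.
have /choice[P hP] (x : H) : exists p, in_kernel A p /\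
    forall z, in_kernel A z -> ip (x - p) z = 0.
  by have [p Mp hp] := projection Hdot x kernel_subspace cl; exists p.
by exists P.
Qed.

Lemma sqrt_kernel z : in_kernel A z -> S z = 0.
Proof.
move=> [dz Az]; apply/rnorm_eq0/eqP.
by rewrite -sqrf_eq0 (sqrt_rnorm Hdot SA dz) Az inner0l.
Qed.

(** On the complement of the kernel the top eigenvalue m of K is below 1, since m = 1 would give a
    kernel vector orthogonal to the kernel. With m = 1 / (1 + l), the constant m / (1 - m) is 1 / l
    for the first nonzero eigenvalue l of A. *)
Lemma poincare_dom : exists2 c : R, 0 <= c & forall x, dom A x ->
  (forall z, in_kernel A z -> ip x z = 0) -> n x <= c * n (S x).
Proof.
have [K KP] := shift1_inverse.
pose M := [set x | forall z, in_kernel A z -> ip x z = 0].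
have [[x0 Mx0 x00]|M0] := pselect (exists2 x, M x & x != 0); last first.
  exists 0 => // x dx Mx; rewrite mul0r.
  have [->|x0] := eqVneq x 0; first by rewrite rnorm0.
  by case: M0; exists x.
have Msub : real_subspace M.
  split.
  - by move=> z _; rewrite inner0l.
  - by move=> x y Mx My z kz; rewrite innerDl Mx// My// addr0.
  - by move=> r x Mx z kz; rewrite innerZl Mx// mulr0.
have Mcl : seq_closed M.
  move=> x hx z kz; apply/eqP; rewrite -normr_le0; apply/ler_addgt0Pl => d d0; rewrite addr0.
  have f1 : 0 < n z + 1 by have := rnorm_ge0 z; lra.
  have [y My hy] := hx _ (divr_gt0 d0 f1).
  have -> : ip x z = ip (x - y) z by rewrite innerDl innerNl My// subr0.
  apply: (le_trans (inner_abs Hdot _ _)); move: hy; rewrite ltr_pdivlMr//.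
  have := rnorm_ge0 (x - y); have := rnorm_ge0 z; nra.
have MK x : M x -> M (K x).
  move=> Mx z [dz Az]; rewrite (resolvent_sym Asa KP).
  by have := resolventK Hdot Asa Age0 KP dz; rewrite Az add0r => ->; apply: Mx.
have [m [m0 [f [Mf f0] Kf] mle]] := top_eigenvector Hdot Asa Age0 KP Acpt Msub Mcl MK Mx0 x00.
have nf := rnorm_gt0 f0.
have m1 : m < 1.
  rewrite lt_neqAle; apply/andP; split; last first.
    have := resolvent_le Hdot Age0 KP f.
    by rewrite Kf rnormZ (ger0_norm (ltW m0)) -{2}[n f]mul1r ler_pM2r.
  apply/negP => /eqP m1; have [dK hK] := KP f.
  move: hK dK; rewrite Kf m1 scale1r => /eqP; rewrite -subr_eq0 addrK => /eqP Af df.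
  by have := Mf _ (conj df Af); rewrite (inner_rnorm Hdot) => /eqP; rewrite sqrf_eq0 gt_eqF.
have c0 : 0 < m / (1 - m) by rewrite divr_gt0// subr_gt0.
exists (Num.sqrt (m / (1 - m))); first exact: sqrtr_ge0.
move=> x dx Mx.
rewrite -(ler_pXn2r (n := 2)) ?nnegrE ?rnorm_ge0//; last by rewrite mulr_ge0 ?sqrtr_ge0 ?rnorm_ge0.
rewrite exprMn sqr_sqrtr ?(ltW c0)// (sqrt_rnorm Hdot SA)// mulrAC ler_pdivlMr ?subr_gt0//.
(* with [y = A x + x], Cauchy-Schwarz for [ip (K y) y] gives |K y|^2 <= m ip (K y) y *)
pose y := A x + x.
have Ky : K y = x by apply: (resolventK Hdot Asa Age0 KP).
have xy : ip x y = ip (A x) x + n x ^+ 2.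
  by rewrite /y innerDr (inner_rnorm Hdot) innerC.
clearbody y.
have key : n x ^+ 2 <= m * ip x y.
  set a := n x ^+ 2; set b := ip x y.
  have h1 := mle _ Mx; rewrite -/a in h1.
  have := le_trans (sqr_ge0 _) (resolvent_ge Hdot Age0 KP (y - m^-1%:C *: x)).
  rewrite (resolventB Hdot Asa Age0 KP) (resolventZ Hdot Asa Age0 KP) Ky.
  rewrite !(innerDl, innerDr, innerNl, innerNr, innerZl, innerZr).
  rewrite -/b (resolvent_sym Asa KP x y) Ky (inner_rnorm Hdot) -/a => h2.
  have mi : 0 < m^-1 by rewrite invr_gt0.
  have h3 : m^-1 * (m^-1 * ip (K x) x) <= m^-1 * a.
    rewrite ler_pM2l// -(ler_pM2l m0) mulrA mulfV ?gt_eqF// mul1r//.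
  rewrite -(ler_pM2l mi) (mulKf (lt0r_neq0 m0)); lra.
rewrite xy in key; lra.
Qed.

(** Approximants y from [sqrt_core] need not be orthogonal to the kernel. Replacing y by y - P y
    costs nothing, because x is orthogonal to P y and S vanishes on the kernel. *)
Lemma poincare : exists2 c : R, 0 <= c & forall x, dom S x ->
  (forall z, in_kernel A z -> ip x z = 0) -> n x <= c * n (S x).
Proof.
have [c c0 hc] := poincare_dom; exists c => // x dx Mx.
have [P hP] := kernel_projector_exists.
apply/ler_addgt0Pl => e e0.
have [y [dy h1 h2]] := sqrt_core Hdot Asa Age0 SA dx (divr_gt0 e0 (ltac:(lra) : 0 < 1 + c)).
have [[dP AP] oP] := hP y.
have h3 : n (y - P y) <= c * n (S y).
  have := hc _ (domB Alin dy dP) oP.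
  by rewrite (opB Slin) ?(sqrt_kernel (conj dP AP)) ?subr0//; apply: sqrt_dom SA _.
have nx : n x ^+ 2 <= n x * (n (x - y) + n (y - P y)).
  have -> : n x ^+ 2 = ip x (x - y) + ip x (y - P y).
    rewrite -(inner_rnorm Hdot) !(innerDr, innerNr) (Mx _ (conj dP AP)); ring.
  by rewrite mulrDr lerD// inner_le.
have {}nx : n x <= n (x - y) + n (y - P y).
  have [->|x0] := eqVneq x 0; first by rewrite rnorm0 addr_ge0 ?rnorm_ge0.
  by rewrite -(ler_pM2l (rnorm_gt0 x0)) -expr2.
have h4 := ler_rnorm_dist (S y) (S x).
have h5 : c * n (S y) <= c * (n (S x) + n (S y - S x)) by rewrite ler_wpM2l.
have h6 : c * n (S y - S x) <= c * (e / (1 + c)) by rewrite ler_wpM2l// ltW.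
have h7 : e / (1 + c) + c * (e / (1 + c)) = e by field; rewrite gt_eqF//; lra.
rewrite rnormBC in h1; lra.
Qed.

End Spectral.

(** * Calculus on the half line *)

Section HalfLine.
Context {R : realType}.
Implicit Types (t s e : R).

(** These two filters are those of [continuous_in] and [has_derivative_in]: two-sided at positive
    times, one-sided at 0, so the calculus below includes the initial time. *)
Definition half_nbhs t : set_system R := within `[0, +oo[ (nbhs t).
Definition half_dnbhs t : set_system R := within `[0, +oo[ t^'.

Global Instance half_nbhs_filter t : Filter (half_nbhs t).
Proof. exact: within_filter. Qed.

Global Instance half_dnbhs_filter t : Filter (half_dnbhs t).
Proof. exact: within_filter. Qed.

Lemma half_nbhsP t (P : R -> Prop) :
  half_nbhs t P <-> exists2 d : R, 0 < d & forall s, 0 <= s -> `|s - t| < d -> P s.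
Proof.
split.
  rewrite /half_nbhs /within => /nbhs_ballP[d /= d0 hd]; exists d => // s s0 st.
  by apply: hd; rewrite /ball /= ?in_itv/= ?s0// distrC.
move=> [d d0 hd]; apply/nbhs_ballP; exists d => // s /= st.
by rewrite in_itv/= andbT => s0; apply: hd; rewrite // distrC.
Qed.

Lemma half_dnbhsP t (P : R -> Prop) :
  half_dnbhs t P <->
  exists2 d : R, 0 < d & forall s, 0 <= s -> s != t -> `|s - t| < d -> P s.
Proof.
split.
  rewrite /half_dnbhs /within => /nbhs_ballP[d /= d0 hd]; exists d => // s s0 st sd.
  by apply: hd; rewrite /ball /= ?in_itv/= ?s0// distrC.
move=> [d d0 hd]; apply/nbhs_ballP; exists d => // s /= sd st.
by rewrite in_itv/= andbT => s0; apply: hd; rewrite // distrC.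
Qed.

Lemma half_dnbhs_sub t : half_dnbhs t --> half_nbhs t.
Proof. by move=> P /half_nbhsP[d d0 h]; apply/half_dnbhsP; exists d => // s s0 _; apply: h. Qed.

Lemma cvg_half_dnbhs (T : topologicalType) (f : R -> T) (l : set_system T) t :
  f s @[s --> half_nbhs t] --> l -> f s @[s --> half_dnbhs t] --> l.
Proof. by move=> h; apply: cvg_trans h; apply: cvg_app; apply: half_dnbhs_sub. Qed.

Lemma cvg_half_nbhs (f : R -> R) (l : R) t :
  f s @[s --> half_dnbhs t] --> l -> f t = l -> f s @[s --> half_nbhs t] --> l.
Proof.
move=> /cvgrPdist_lt h ft; apply/cvgrPdist_lt => e e0.
have /half_dnbhsP[d d0 hd] := h _ e0; apply/half_nbhsP; exists d => // s s0 sd.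
by have [->|st] := eqVneq s t; [rewrite ft subrr normr0 | exact: hd].
Qed.

Lemma eq_cvg_half_dnbhs (f g : R -> R) (l : R) t :
  (forall s, 0 <= s -> s != t -> f s = g s) ->
  f s @[s --> half_dnbhs t] --> l -> g s @[s --> half_dnbhs t] --> l.
Proof.
move=> fg /cvgrPdist_lt h; apply/cvgrPdist_lt => e e0.
have /half_dnbhsP[d d0 hd] := h _ e0; apply/half_dnbhsP; exists d => // s s0 st sd.
by rewrite -fg//; apply: hd.
Qed.

Lemma cvg0_le (F : set_system R) (FF : Filter F) (a b : R -> R) :
  (forall s, 0 <= a s <= b s) -> b s @[s --> F] --> (0 : R) -> a s @[s --> F] --> (0 : R).
Proof.
move=> ab; apply: (@squeeze_cvgr _ _ _ _ (fun=> 0)); last exact: cvg_cst.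
exact: nearW.
Qed.

Definition half_cont (f : R -> R) :=
  forall t, 0 <= t -> f s @[s --> half_nbhs t] --> f t.

Definition half_deriv (f f' : R -> R) :=
  forall t, 0 <= t -> (f s - f t) / (s - t) @[s --> half_dnbhs t] --> f' t.

Lemma half_deriv_cont f f' : half_deriv f f' -> half_cont f.
Proof.
move=> h t t0; apply: cvg_half_nbhs => //.
have hid : (fun s : R => s - t) s @[s --> half_dnbhs t] --> (0 : R).
  apply/cvgrPdist_lt => e e0; apply/half_dnbhsP; exists e => // s _ _.
  by rewrite sub0r normrN.
have : (f s - f t) / (s - t) * (s - t) + f t @[s --> half_dnbhs t] --> f' t * 0 + f t.
  by apply: cvgD; [exact: cvgM (h _ t0) hid | exact: cvg_cst].
rewrite mulr0 add0r; apply: eq_cvg_half_dnbhs => s _ st.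
by rewrite divfK ?subrK// subr_eq0.
Qed.

Lemma half_deriv_ext f f' g' : half_deriv f f' -> (forall t, 0 <= t -> f' t = g' t) ->
  half_deriv f g'.
Proof. by move=> h fg t t0; rewrite -fg//; apply: h. Qed.

Lemma half_derivD f f' g g' : half_deriv f f' -> half_deriv g g' ->
  half_deriv (fun s => f s + g s) (fun s => f' s + g' s).
Proof.
move=> hf hg t t0.
rewrite (_ : (fun s => _) = fun s => (f s - f t) / (s - t) + (g s - g t) / (s - t)).
  exact: cvgD (hf _ t0) (hg _ t0).
by apply/funext => s; rewrite -mulrDl; congr (_ / _); ring.
Qed.

Lemma half_derivM f f' g g' : half_deriv f f' -> half_deriv g g' ->
  half_deriv (fun s => f s * g s) (fun s => f' s * g s + f s * g' s).
Proof.
move=> hf hg t t0.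
have gc := cvg_half_dnbhs (half_deriv_cont hg t0).
rewrite (_ : (fun s => _) = fun s => (f s - f t) / (s - t) * g s + f t * ((g s - g t) / (s - t))).
  apply: cvgD; first exact: cvgM (hf _ t0) gc.
  exact: cvgM (cvg_cst _) (hg _ t0).
by apply/funext => s; ring.
Qed.

Lemma half_deriv_cst (c : R) : half_deriv (fun=> c) (fun=> 0).
Proof.
move=> t t0; rewrite (_ : (fun s => _) = fun=> 0); first exact: cvg_cst.
by apply/funext => s; rewrite subrr mul0r.
Qed.

Lemma half_derivZ (c : R) f f' : half_deriv f f' ->
  half_deriv (fun s => c * f s) (fun s => c * f' s).
Proof.
move=> hf; apply: half_deriv_ext (half_derivM (half_deriv_cst c) hf) _ => t _.
by rewrite mul0r add0r.
Qed.

Lemma half_derivB f f' g g' : half_deriv f f' -> half_deriv g g' ->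
  half_deriv (fun s => f s - g s) (fun s => f' s - g' s).
Proof.
move=> hf hg t t0.
have := half_derivD hf (@half_derivZ (-1) _ _ hg) t0.
by under eq_fun do rewrite !mulN1r; rewrite !mulN1r.
Qed.

Lemma half_deriv_is_derive f f' t : half_deriv f f' -> 0 < t -> is_derive t 1 f (f' t).
Proof.
move=> h t0; apply/is_derive1_caratheodory.
pose g z := if z == t then f' t else (f z - f t) / (z - t).
exists g; split.
- move=> z; rewrite /g; case: eqVneq => [->|zt]; first by rewrite !subrr mulr0.
  by rewrite divfK// subr_eq0.
- apply/cvgrPdist_lt => e e0.
  have /cvgrPdist_lt/(_ _ e0)/half_dnbhsP[d d0 hd] := h _ (ltW t0).
  apply/nbhs_ballP; exists (Num.min d t) => /=; first by rewrite lt_min d0.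
  move=> s; rewrite /ball /= lt_min => /andP[h1 h2].
  rewrite /g eqxx; case: eqVneq => [_|st]; first by rewrite subrr normr0.
  apply: hd => //; last by rewrite distrC.
  by move: h2; rewrite ltr_norml; lra.
- by rewrite /g eqxx.
Qed.

Lemma is_derive_half_deriv f f' : (forall t, is_derive t 1 f (f' t)) -> half_deriv f f'.
Proof.
move=> h t t0; have /is_derive1_caratheodory[g [fg gc <-]] := h t.
have : g s @[s --> half_dnbhs t] --> g t.
  by apply: cvg_half_dnbhs; apply: cvg_within_filter; exact: gc.
apply: eq_cvg_half_dnbhs => s _ st; by rewrite fg mulfK// subr_eq0.
Qed.

Lemma half_MVT f f' a b : half_deriv f f' -> 0 <= a -> a < b ->
  exists2 c, a < c < b & f b - f a = f' c * (b - a).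
Proof.
move=> h a0 ab; have [||c] := @MVT R f f' a b ab.
- by move=> x; rewrite in_itv/= => /andP[ax _]; apply: half_deriv_is_derive => //; apply: le_lt_trans ax.
- have hc := half_deriv_cont h.
  apply/continuous_within_itvP => //.
  have cc x : 0 <= x -> forall e, 0 < e -> exists2 d, 0 < d & forall s, 0 <= s -> `|s - x| < d -> `|f x - f s| < e.
    by move=> x0 e e0; apply/half_nbhsP; apply: (cvgrPdist_lt _ _).1 (hc _ x0) _ e0.
  split.
  - move=> x; rewrite in_itv/= => /andP[ax xb]; apply/cvgrPdist_lt => e e0.
    have x0 : 0 < x by apply: le_lt_trans ax.
    have [d d0 hd] := cc _ (ltW x0) _ e0.
    apply/nbhs_ballP; exists (Num.min d x) => /=; first by rewrite lt_min d0.
    move=> s; rewrite /ball /= lt_min => /andP[h1 h2]; apply: hd; last by rewrite distrC.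
    by move: h2; rewrite ltr_norml; lra.
  - apply/cvgrPdist_lt => e e0; have [d d0 hd] := cc _ a0 _ e0.
    apply/nbhs_ballP; exists d => //= s; rewrite /ball /= => h1 h2; apply: hd; last by rewrite distrC.
    exact: le_trans a0 (ltW h2).
  - apply/cvgrPdist_lt => e e0.
    have b0 : 0 < b by apply: le_lt_trans ab.
    have [d d0 hd] := cc _ (ltW b0) _ e0.
    apply/nbhs_ballP; exists (Num.min d b) => /=; first by rewrite lt_min d0.
    move=> s; rewrite /ball /= lt_min => /andP[h1 h2] _; apply: hd; last by rewrite distrC.
    by move: h2; rewrite ltr_norml; lra.
- by rewrite in_itv/= => cab e; exists c.
Qed.

Lemma half_deriv_le f f' a b (M : R) : half_deriv f f' -> 0 <= a -> a <= b ->
  (forall s, a < s < b -> f' s <= M) -> f b - f a <= M * (b - a).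
Proof.
move=> h a0; rewrite le_eqVlt => /orP[/eqP <- _|ab hM]; first by rewrite !subrr mulr0.
have [c cab ->] := half_MVT h a0 ab.
by rewrite ler_wpM2r ?subr_ge0 ?(ltW ab)// hM.
Qed.

(** Heine-Cantor, stated for a pseudo-distance so that one proof serves both real functions (Riemann
    sums) and vector-valued ones (second differences). *)
Lemma half_uniform (rho : R -> R -> R) (L e : R) :
  (forall s r t, rho s r <= rho t s + rho t r) ->
  (forall t, 0 <= t -> rho t s @[s --> half_nbhs t] --> (0 : R)) -> 0 < e ->
  exists2 d : R, 0 < d &
    forall s r, 0 <= s <= L -> 0 <= r <= L -> `|s - r| < d -> rho s r < e.
Proof.
move=> tri cont e0; apply: contrapT => hn.
have /choice[u hu] (k : nat) : exists sr : R * R,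
    [/\ 0 <= sr.1 <= L, 0 <= sr.2 <= L, `|sr.1 - sr.2| < k.+1%:R^-1 & e <= rho sr.1 sr.2].
  apply: contrapT => hk; apply: hn; exists k.+1%:R^-1; first by rewrite invr_gt0 ltr0n.
  move=> s r hs hr sr; rewrite ltNge; apply/negP => he.
  by apply: hk; exists (s, r).
have := @segment_compact R 0 L ((u k).1 @[k --> \oo]) _.
case; first by exists 0%N => // k _ /=; rewrite in_itv/=; case: (hu k).
move=> t [/= ht]; rewrite in_itv/= in ht; move=> hcl.
have /andP[t0 _] := ht.
have /cvgrPdist_lt/(_ _ (ltac:(lra) : 0 < e / 2))/half_nbhsP[d d0 hd] := cont _ t0.
have d2 : 0 < d / 2 by lra.
have [N _ hN] := near_infty_natSinv_lt (PosNum d2).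
have [||_ [[k Nk <-] hk]] := hcl [set (u k).1 | k in [set k | (N <= k)%N]] (ball t (d / 2)).
- by exists N => // k Nk; exists k.
- exact: nbhsx_ballx.
have [/andP[s0 _] /andP[r0 _] sr he] := hu k.
have sr2 := lt_trans sr (hN _ Nk).
move: hk; rewrite /ball/= => tk.
have := hd _ s0; have := hd _ r0; rewrite !sub0r !normrN => h1 h2.
have {}h2 : `|rho t (u k).1| < e / 2 by apply: h2; rewrite distrC; lra.
have {}h1 : `|rho t (u k).2| < e / 2.
  apply: h1; rewrite distrC; have := ler_distD (u k).1 t (u k).2; move: sr2 => /=; lra.
have := tri (u k).1 (u k).2 t.
have := ler_norm (rho t (u k).1); have := ler_norm (rho t (u k).2); lra.
Qed.

End HalfLine.

Section VectorHalfLine.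
Context {R : realType} {V : normedModType R[i]}.
Local Notation n := (@rnorm R V).
Implicit Types (f g : R -> V) (t s : R).

Definition vcont f := continuous_in n f.
Definition vderiv f f' := has_derivative_in n f f'.

Lemma vcont_le (W : normedModType R[i]) (g : R -> W) f (b : R) :
  (forall s t, 0 <= s -> 0 <= t -> n (f s - f t) <= b * rnorm (g s - g t)) ->
  continuous_in (@rnorm R W) g -> vcont f.
Proof.
move=> fg gc t t0.
have : b * rnorm (g s - g t) @[s --> half_nbhs t] --> (b * 0 : R).
  by apply: cvgM; [exact: cvg_cst | exact: gc].
rewrite mulr0 => /cvgrPdist_lt h; apply/cvgrPdist_lt => e e0.
have /half_nbhsP[d d0 hd] := h _ e0; apply/half_nbhsP; exists d => // s s0 sd.
have := hd _ s0 sd; rewrite !sub0r !normrN; apply: le_lt_trans.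
rewrite ger0_norm ?rnorm_ge0//; apply: le_trans (fg _ _ s0 t0) (ler_norm _).
Qed.

Lemma vcontD f g : vcont f -> vcont g -> vcont (fun s => f s + g s).
Proof.
move=> hf hg t t0.
apply: (@cvg0_le _ _ _ _ (fun s => n (f s - f t) + n (g s - g t))).
  by move=> s; rewrite rnorm_ge0 /= opprD addrACA ler_rnormD.
by rewrite -[X in _ --> X](addr0 (0 : R)); apply: cvgD; [exact: hf | exact: hg].
Qed.

Lemma vcont_shift f (h : R) : 0 <= h -> vcont f -> vcont (fun s => f (s + h)).
Proof.
move=> h0 hf t t0.
have th : 0 <= t + h by apply: addr_ge0.
apply/cvgrPdist_lt => e e0.
have /cvgrPdist_lt/(_ _ e0)/half_nbhsP[d d0 hd] := hf _ th.
apply/half_nbhsP; exists d => // s s0 sd; apply: hd; first exact: addr_ge0.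
by rewrite opprD addrACA subrr addr0.
Qed.

Lemma vderiv_cont f f' : vderiv f f' -> vcont f.
Proof.
move=> h t t0; apply: cvg_half_nbhs; last by rewrite subrr rnorm0.
have hid : `|s - t| @[s --> half_dnbhs t] --> (0 : R).
  apply/cvgrPdist_lt => e e0; apply/half_dnbhsP; exists e => // s _ _.
  by rewrite sub0r normrN normr_id.
apply: (@cvg0_le _ _ _ _ (fun s => `|s - t| * (n (((s - t)^-1)%:C *: (f s - f t) - f' t) + n (f' t)))).
  move=> s; rewrite rnorm_ge0 /=; have [->|st] := eqVneq s t.
    by rewrite !subrr rnorm0 normr0 mul0r.
  have st0 : s - t != 0 by rewrite subr_eq0.
  have {1}-> : f s - f t = (s - t)%:C *: (((s - t)^-1)%:C *: (f s - f t)).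
    by rewrite scalerA -rmorphM /= mulfV// scale1r.
  rewrite rnormZ ler_wpM2l// [leRHS]addrC; exact: ler_rnorm_dist.
rewrite -[X in _ --> X](mul0r (0 + n (f' t))); apply: cvgM => //.
by apply: cvgD; [exact: h | exact: cvg_cst].
Qed.

Lemma vderiv_ext f f' g' : vderiv f f' -> (forall t, 0 <= t -> f' t = g' t) -> vderiv f g'.
Proof. by move=> h fg t t0; rewrite -fg//; apply: h. Qed.

Lemma vderivD f f' g g' : vderiv f f' -> vderiv g g' ->
  vderiv (fun s => f s + g s) (fun s => f' s + g' s).
Proof.
move=> hf hg t t0.
apply: (@cvg0_le _ _ _ _ (fun s => n (((s - t)^-1)%:C *: (f s - f t) - f' t) +
   n (((s - t)^-1)%:C *: (g s - g t) - g' t))).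
  move=> s; rewrite rnorm_ge0 /=.
  rewrite (_ : f s + g s - _ = (f s - f t) + (g s - g t)); last by rewrite opprD addrACA.
  by rewrite scalerDr opprD addrACA ler_rnormD.
by rewrite -[X in _ --> X](addr0 (0 : R)); apply: cvgD; [exact: hf | exact: hg].
Qed.

Lemma vderiv_cst (x : V) : vderiv (fun=> x) (fun=> 0).
Proof.
move=> t t0; rewrite (_ : (fun s => _) = fun=> 0); first exact: cvg_cst.
by apply/funext => s; rewrite subrr scaler0 subr0 rnorm0.
Qed.

Lemma vderiv_shift f f' (h : R) : 0 <= h -> vderiv f f' ->
  vderiv (fun s => f (s + h)) (fun s => f' (s + h)).
Proof.
move=> h0 hf t t0.
have th : 0 <= t + h by apply: addr_ge0.
apply/cvgrPdist_lt => e e0.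
have /cvgrPdist_lt/(_ _ e0)/half_dnbhsP[d d0 hd] := hf _ th.
apply/half_dnbhsP; exists d => // s s0 st sd.
have E : s + h - (t + h) = s - t by rewrite opprD addrACA subrr addr0.
have := hd (s + h) (addr_ge0 s0 h0); rewrite E => hd'.
by apply: hd' => //; apply: contra st => /eqP/addIr/eqP.
Qed.

Lemma vderiv_smul (f f' : R -> R) (x : V) : half_deriv f f' ->
  vderiv (fun s => (f s)%:C *: x) (fun s => (f' s)%:C *: x).
Proof.
move=> hf t t0.
have : `|(f s - f t) / (s - t) - f' t| * n x @[s --> half_dnbhs t] --> (`|f' t - f' t| * n x : R).
  apply: cvgM; last exact: cvg_cst.
  by apply: cvg_norm; apply: cvgB; [exact: hf | exact: cvg_cst].
rewrite subrr normr0 mul0r.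
apply: eq_cvg_half_dnbhs => s _ _.
by rewrite -scalerBl -rmorphB scalerA -rmorphM -scalerBl -rmorphB rnormZ /= (mulrC _^-1).
Qed.

End VectorHalfLine.

Section LinearHalfLine.
Context {R : realType} {V W : normedModType R[i]}.
Variables (L : V -> W) (b : R).
Hypotheses (LB : forall x y, L (x - y) = L x - L y).
Hypotheses (LZ : forall (r : R) x, L (r%:C *: x) = r%:C *: L x).
Hypotheses (Lb : forall x, rnorm (L x) <= b * rnorm x).

Lemma vcont_lin (f : R -> V) : vcont f -> vcont (fun s => L (f s)).
Proof. by apply: (@vcont_le _ _ _ _ _ b) => s t _ _; rewrite -LB. Qed.

Lemma vderiv_lin (f f' : R -> V) : vderiv f f' ->
  vderiv (fun s => L (f s)) (fun s => L (f' s)).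
Proof.
move=> hf t t0.
apply: (@cvg0_le _ _ _ _ (fun s => b * rnorm (((s - t)^-1)%:C *: (f s - f t) - f' t))).
  by move=> s; rewrite rnorm_ge0 /= -LB -LZ -LB Lb.
by rewrite -[X in _ --> X](mulr0 b); apply: cvgM; [exact: cvg_cst | exact: hf].
Qed.

End LinearHalfLine.

Section ScaleHalfLine.
Context {R : realType} {V : normedModType R[i]}.
Implicit Types (f g : R -> V).

Lemma vderivZ (a : R[i]) f f' : vderiv f f' ->
  vderiv (fun s => a *: f s) (fun s => a *: f' s).
Proof.
apply: (@vderiv_lin _ _ _ (fun x : V => a *: x) (complex.Re `|a|)).
- by move=> x y; rewrite scalerBr.
- by move=> r x; rewrite !scalerA mulrC.
- by move=> x; rewrite rnormZC.
Qed.

Lemma vderivN f f' : vderiv f f' -> vderiv (fun s => - f s) (fun s => - f' s).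
Proof.
move=> /(vderivZ (-1)).
have E (u : R -> V) : (fun s => -1 *: u s) = (fun s => - u s).
  by apply/funext => s; rewrite scaleN1r.
by rewrite !E.
Qed.

Lemma vderivB f f' g g' : vderiv f f' -> vderiv g g' ->
  vderiv (fun s => f s - g s) (fun s => f' s - g' s).
Proof. by move=> hf /vderivN; apply: vderivD. Qed.

Lemma vcontZ (a : R[i]) f : vcont f -> vcont (fun s => a *: f s).
Proof.
apply: (@vcont_lin _ _ _ (fun x : V => a *: x) (complex.Re `|a|)).
- by move=> x y; rewrite scalerBr.
- by move=> x; rewrite rnormZC.
Qed.

Lemma vcontN f : vcont f -> vcont (fun s => - f s).
Proof. by move=> /(vcontZ (-1)); under eq_fun do rewrite scaleN1r. Qed.

Lemma vcontB f g : vcont f -> vcont g -> vcont (fun s => f s - g s).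
Proof. by move=> hf /vcontN; apply: vcontD. Qed.

Lemma vderiv_sum (I : Type) (r : seq I) (F F' : I -> R -> V) :
  (forall i, vderiv (F i) (F' i)) ->
  vderiv (fun s => \sum_(i <- r) F i s) (fun s => \sum_(i <- r) F' i s).
Proof.
move=> h.
have E0 (u : I -> R -> V) : (fun s => \sum_(i <- [::]) u i s) = fun=> 0.
  by apply/funext => s; rewrite big_nil.
have E1 i r' (u : I -> R -> V) :
    (fun s => \sum_(j <- i :: r') u j s) = fun s => u i s + \sum_(j <- r') u j s.
  by apply/funext => s; rewrite big_cons.
elim: r => [|i r IH]; first by rewrite !E0; apply: vderiv_cst.
by rewrite !E1; apply: vderivD.
Qed.

End ScaleHalfLine.

Section InnerHalfLine.
Context {R : realType} {H : completeNormedModType R[i]}.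
Variables (dot : {dot H for @conjc R}).
Hypothesis (Hdot : hilbert dot).
Local Notation ip := (inner dot).
Local Notation n := (@rnorm R H).
Implicit Types (f g : R -> H) (t s : R).

Let norm_cvg (F : set_system R) (FF : Filter F) f t :
  n (f s - f t) @[s --> F] --> (0 : R) -> n (f t) + n (f s - f t) @[s --> F] --> n (f t).
Proof. by move=> h; rewrite -[X in _ --> X]addr0; apply: cvgD => //; exact: cvg_cst. Qed.

Let cvg_sub0 (F : set_system R) (FF : Filter F) (u v : R -> R) (l : R) :
  (forall s, `|u s - l| <= v s) -> v s @[s --> F] --> (0 : R) -> u s @[s --> F] --> l.
Proof.
move=> uv /cvgrPdist_lt h; apply/cvgrPdist_lt => e e0.
apply: filterS (h _ e0) => s; rewrite sub0r normrN distrC => hs.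
by apply: le_lt_trans (uv s) _; apply: le_lt_trans (ler_norm _) hs.
Qed.

Lemma half_cont_inner f g : vcont f -> vcont g -> half_cont (fun s => ip (f s) (g s)).
Proof.
move=> hf hg t t0.
apply: (@cvg_sub0 _ _ _ (fun s => n (f s - f t) * (n (g t) + n (g s - g t)) + n (f t) * n (g s - g t))).
  move=> s; have -> : ip (f s) (g s) - ip (f t) (g t) = ip (f s - f t) (g s) + ip (f t) (g s - g t).
    by rewrite !(innerDl, innerDr, innerNl, innerNr); ring.
  apply: (le_trans (ler_normD _ _)); apply: lerD; last exact: inner_abs.
  apply: (le_trans (inner_abs Hdot _ _)); rewrite ler_wpM2l ?rnorm_ge0//.
  exact: ler_rnorm_dist.
rewrite (_ : 0 = 0 * n (g t) + n (f t) * 0 :> R); last by rewrite mul0r mulr0 addr0.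
apply: cvgD; apply: cvgM; [exact: hf | | exact: cvg_cst | exact: hg].
by apply: norm_cvg; exact: hg.
Qed.

Lemma half_deriv_inner f f' g g' : vderiv f f' -> vderiv g g' ->
  half_deriv (fun s => ip (f s) (g s)) (fun s => ip (f' s) (g s) + ip (f s) (g' s)).
Proof.
move=> hf hg t t0.
have gc : n (g s - g t) @[s --> half_dnbhs t] --> (0 : R).
  by apply: cvg_half_dnbhs; apply: (vderiv_cont hg).
pose q (u : R -> H) s := ((s - t)^-1)%:C *: (u s - u t).
apply: (@cvg_sub0 _ _ _ (fun s => n (q f s - f' t) * (n (g t) + n (g s - g t)) +
   n (f' t) * n (g s - g t) + n (f t) * n (q g s - g' t))).
  move=> s.
  have -> : (ip (f s) (g s) - ip (f t) (g t)) / (s - t) - (ip (f' t) (g t) + ip (f t) (g' t))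
    = ip (q f s - f' t) (g s) + ip (f' t) (g s - g t) + ip (f t) (q g s - g' t).
    by rewrite /q !(innerDl, innerDr, innerNl, innerNr, innerZl, innerZr); ring.
  apply: (le_trans (ler_normD _ _)); apply: lerD; last exact: inner_abs.
  apply: (le_trans (ler_normD _ _)); apply: lerD; last exact: inner_abs.
  apply: (le_trans (inner_abs Hdot _ _)); rewrite ler_wpM2l ?rnorm_ge0//.
  exact: ler_rnorm_dist.
rewrite (_ : 0 = 0 * n (g t) + n (f' t) * 0 + n (f t) * 0 :> R); last by rewrite mul0r !mulr0 !addr0.
apply: cvgD; last by apply: cvgM; [exact: cvg_cst | exact: hg].
apply: cvgD; apply: cvgM; [exact: hf | | exact: cvg_cst | exact: gc].
exact: norm_cvg.
Qed.

(** The scalar mean value bound applied to the product of f with the fixed vector f b - f a,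
    followed by division by its norm. *)
Lemma vderiv_lipschitz f f' (M a b : R) : vderiv f f' -> 0 <= a -> a <= b ->
  (forall s, a < s < b -> n (f' s) <= M) -> n (f b - f a) <= M * (b - a).
Proof.
move=> hf a0 ab hM.
pose x := f b - f a.
have hx := half_deriv_inner hf (vderiv_cst x).
have := half_deriv_le hx a0 ab (M := M * n x).
rewrite -innerNl -innerDl -/x (inner_rnorm Hdot) => h.
have {h} : n x ^+ 2 <= M * n x * (b - a).
  apply: h => s hs; rewrite inner0r addr0; apply: (le_trans (inner_le Hdot _ _)).
  by rewrite ler_wpM2r ?rnorm_ge0// hM.
have [x0|xn0] := eqVneq (n x) 0; last first.
  have xp : 0 < n x by rewrite lt_neqAle rnorm_ge0 andbT eq_sym.
  by rewrite expr2 mulrAC ler_pM2r.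
(* Only 0 <= M (b - a) is left; for a < b, M is nonnegative because it bounds a norm at the
   midpoint. *)
rewrite x0 => _; move: ab; rewrite le_eqVlt => /orP[/eqP ab|ab].
  by rewrite ab subrr mulr0.
rewrite mulr_ge0 ?subr_ge0 ?(ltW ab)//.
have := hM ((a + b) / 2) (ltac:(lra)); apply: le_trans; exact: rnorm_ge0.
Qed.

End InnerHalfLine.

Lemma linear_rnorm_bounded (R : realType) (V W : normedModType R[i]) (L : {linear V -> W}) :
  continuous L -> exists2 b : R, 0 <= b & forall x, rnorm (L x) <= b * rnorm x.
Proof.
move=> Lc.
have := Lc 0; rewrite /prop_for /continuous_at linear0 => /cvgr0Pnorm_lt/(_ 1 ltr01)/nbhs_ballP[d /= d0 hd].
have [r r0 dr] := gt0_complex d0; rewrite {}dr in hd.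
have key x : rnorm x < r -> rnorm (L x) < 1.
  move=> xr; have : `|L x| < 1 by apply: hd; apply/rnorm_ball => //; rewrite sub0r rnormN.
  by rewrite normE -[X in _ < X]/(1%:C) ltcR.
exists (2 / r); first by rewrite divr_ge0// ltW.
move=> x; have [->|x0] := eqVneq x 0; first by rewrite linear0 !rnorm0 mulr0.
have nx := rnorm_gt0 x0.
have c0 : 0 < r / 2 / rnorm x by rewrite !divr_gt0.
have := key ((r / 2 / rnorm x)%:C *: x).
rewrite linearZ rnormZ (ger0_norm (ltW c0)) divfK ?gt_eqF// => /(_ (ltac:(lra) : r / 2 < r)).
rewrite /= rnormZ (ger0_norm (ltW c0)) => h.
rewrite -(ler_pM2l c0).
have -> : r / 2 / rnorm x * (2 / r * rnorm x) = 1 by field; rewrite !gt_eqF.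
exact: ltW.
Qed.

(** * The Schrodinger flow on one eigenvector *)

Section Rotation.
Context {R : realType}.

Lemma half_deriv_id : half_deriv (fun t => t : R) (fun=> 1).
Proof. by apply: is_derive_half_deriv => t; apply: is_derive_id. Qed.

Lemma half_deriv_scaled (f f' : R -> R) (a : R) : (forall x : R, is_derive x (1 : R) f (f' x)) ->
  half_deriv (fun t => f (a * t)) (fun t => a * f' (a * t)).
Proof.
move=> hf; apply: is_derive_half_deriv => t.
have ha : is_derive t 1 (fun t => a * t) a.
  have := is_deriveZ a (is_derive_id t 1); rewrite -[X in is_derive _ _ _ X]/(a * 1) mulr1.
  exact.
by rewrite mulrC; apply: (is_derive1_comp (hf (a * t)) ha).
Qed.

Lemma half_deriv_cos (a : R) :
  half_deriv (fun t => cos (a * t)) (fun t => a * - sin (a * t)).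
Proof. by apply: half_deriv_scaled => x; apply: is_derive_cos. Qed.

Lemma half_deriv_sin (a : R) : half_deriv (fun t => sin (a * t)) (fun t => a * cos (a * t)).
Proof. by apply: half_deriv_scaled => x; apply: is_derive_sin. Qed.

Definition cis (a : R) : R[i] := cos a +i* sin a.

Lemma cisD a b : cis (a + b) = cis a * cis b.
Proof.
rewrite /cis cosD sinD; apply/eqP; rewrite eq_complex /=.
by apply/andP; split; apply/eqP; ring.
Qed.

Lemma cis0 : cis 0 = 1.
Proof. by rewrite /cis cos0 sin0. Qed.

Lemma rnorm_cis (V : normedModType R[i]) a (x : V) : rnorm (cis a *: x) = rnorm x.
Proof. by rewrite rnormZC normc_def/= cos2Dsin2 sqrtr1 mul1r. Qed.

Lemma cis_split (V : normedModType R[i]) a (x : V) :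
  cis a *: x = (cos a)%:C *: x + (sin a)%:C *: ('i *: x).
Proof.
rewrite scalerA -scalerDl; congr (_ *: _); rewrite /cis; apply/eqP; rewrite eq_complex /=.
by apply/andP; split; apply/eqP; ring.
Qed.

Lemma vderiv_cis (V : normedModType R[i]) (l : R) (x : V) :
  vderiv (fun t => cis (- (l * t)) *: x) (fun t => (- 'i * l%:C) *: (cis (- (l * t)) *: x)).
Proof.
have h1 := @half_deriv_cos l; have h2 := @half_derivZ R (-1) _ _ (@half_deriv_sin l).
have := vderivD (vderiv_smul x h1) (vderiv_smul ('i *: x) h2).
rewrite (_ : (fun s => _) = fun t => cis (- (l * t)) *: x); last first.
  by apply/funext => t; rewrite cis_split cosN sinN mulN1r.
move=> /vderiv_ext; apply => t _.
rewrite !scalerA -scalerDl; congr (_ *: _); rewrite /cis cosN sinN; apply/eqP; rewrite eq_complex /=.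
by apply/andP; split; apply/eqP; ring.
Qed.

(** The integral of exp(-i l s) x over [0, t], which [mild_solution] requires as an explicit
    primitive. The closed formula divides by l, so l = 0 is treated apart. *)
Definition cis_primitive (V : normedModType R[i]) (l : R) (x : V) (t : R) : V :=
  if l == 0 then t%:C *: x else
  (l^-1 * sin (l * t))%:C *: x + (l^-1 * (cos (l * t) - 1))%:C *: ('i *: x).

Lemma vderiv_cis_primitive (V : normedModType R[i]) (l : R) (x : V) :
  vderiv (cis_primitive l x) (fun t => cis (- (l * t)) *: x).
Proof.
rewrite /cis_primitive; have [->|l0] := eqVneq l 0.
  apply: vderiv_ext (vderiv_smul x half_deriv_id) _ => t _.
  by rewrite mul0r oppr0 cis0.
have h1 := @half_derivZ R l^-1 _ _ (@half_deriv_sin l).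
have h2 := @half_derivZ R l^-1 _ _ (half_derivB (@half_deriv_cos l) (half_deriv_cst 1)).
apply: vderiv_ext (vderivD (vderiv_smul x h1) (vderiv_smul ('i *: x) h2)) _ => t _.
by rewrite cis_split cosN sinN subr0 !mulKf.
Qed.

Lemma cis_primitive0 (V : normedModType R[i]) (l : R) (x : V) : cis_primitive l x 0 = 0.
Proof.
rewrite /cis_primitive; case: eqVneq => _; first by rewrite scale0r.
by rewrite mulr0 sin0 cos0 subrr !mulr0 !scale0r addr0.
Qed.

Lemma cis_primitiveE (V : normedModType R[i]) (l : R) (x : V) t :
  cis (- (l * t)) *: x = x + (- 'i * l%:C) *: cis_primitive l x t.
Proof.
rewrite /cis_primitive; case: eqVneq => [->|l0].
  by rewrite mul0r oppr0 cis0 scale1r mulr0 scale0r addr0.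
rewrite -{2}[x]scale1r scalerDr !scalerA -!scalerDl; congr (_ *: _).
rewrite /cis cosN sinN; apply/eqP; rewrite eq_complex /=.
by apply/andP; split; apply/eqP; field.
Qed.

End Rotation.

(** * The resolvent estimate *)

Section Hautus.
Context {R : realType} {H Y : completeNormedModType R[i]}.
Variables (dot : {dot H for @conjc R}).
Hypothesis (Hdot : hilbert dot).
Local Notation ip := (inner dot).
Local Notation n := (@rnorm R H).
Variables A : operator H.
Hypotheses (Asa : selfadjoint dot A) (Age0 : nonnegative dot A).
Hypotheses (Acpt : compact_resolvent A).
Let Alin : linear_operator A. Proof. exact: sa_linear Asa. Qed.
Implicit Types (s : seq (R * H)) (mu t : R).

(* [exp (- i t (A - mu))] applied to the eigenvector sum represented by [s] *)
Definition eigenflow mu s t : H := \sum_(p <- s) cis (- ((p.1 - mu) * t)) *: p.2.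

Lemma eigenflow0 mu s : eigenflow mu s 0 = \sum_(p <- s) p.2.
Proof. by apply: eq_bigr => p _; rewrite mulr0 oppr0 cis0 scale1r. Qed.

Lemma eigenflow_shift mu s t : eigenflow 0 s t = cis (- (mu * t)) *: eigenflow mu s t.
Proof.
rewrite /eigenflow scaler_sumr; apply: eq_bigr => p _.
rewrite scalerA -cisD; congr (cis _ *: _); ring.
Qed.

(** Represents (A - mu) x when s represents x, so that the derivative of an [eigenflow] is again an
    [eigenflow], up to the factor - i. *)
Definition shift_weights mu s := [seq (p.1, (p.1 - mu)%:C *: p.2) | p <- s].

Lemma vderiv_eigenflow mu s :
  vderiv (eigenflow mu s) (fun t => - 'i *: eigenflow mu (shift_weights mu s) t).
Proof.
have h : vderiv (eigenflow mu s) (fun t => \sum_(p <- s)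
    (- 'i * (p.1 - mu)%:C) *: (cis (- ((p.1 - mu) * t)) *: p.2)).
  by apply: vderiv_sum => p; apply: vderiv_cis.
apply: vderiv_ext h _ => t _; rewrite /eigenflow big_map scaler_sumr.
by apply: eq_bigr => p _ /=; rewrite !scalerA; congr (_ *: _); ring.
Qed.

Definition eigenpairs s := forall p, p \in s -> eigenpair A p.

Lemma shift_weights_eigenpairs mu s : eigenpairs s -> eigenpairs (shift_weights mu s).
Proof.
move=> hs _ /mapP[p /hs[dp Ap] ->]; split; first exact: domZ.
by rewrite /= (opZ Alin)// Ap !scalerA mulrC.
Qed.

Lemma eigenflow_dom mu s t : eigenpairs s ->
  dom A (eigenflow mu s t) /\
  A (eigenflow mu s t) - mu%:C *: eigenflow mu s t = eigenflow mu (shift_weights mu s) t.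
Proof.
rewrite /eigenflow; elim: s => [|p s IH] hs.
  by rewrite !big_nil (op0 Alin) scaler0 subr0; split=> //; apply: dom0.
have [dp Ap] : eigenpair A p by apply: hs; rewrite inE eqxx.
have [|ds As] := IH; first by move=> q qs; apply: hs; rewrite inE qs orbT.
rewrite /= !big_cons; split; first by apply: domD => //; apply: domZ.
rewrite (opD Alin) ?(opZ Alin)//; last exact: domZ.
rewrite -As Ap scalerDr opprD addrACA; congr (_ + _).
rewrite !scalerA -scalerBl; congr (_ *: _); rewrite rmorphB /=; ring.
Qed.

Lemma inner_i_sym x : dom A x -> ip ('i *: A x) x = 0.
Proof.
move=> dx; have := sa_sym Asa (domZ Alin 'i dx) dx.
by rewrite (opZ Alin)// (innerC _ _ (A x)) innerir inneril => h; lra.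
Qed.

Lemma inner_i x : ip ('i *: x) x = 0.
Proof.
have := innerC dot ('i *: x) x; rewrite inneril innerir => h; lra.
Qed.

(** The derivative of the squared norm is twice the real part of (- i (A - mu) x, x), which vanishes
    by symmetry of A. *)
Lemma rnorm_eigenflow mu s t : eigenpairs s -> 0 <= t ->
  n (eigenflow mu s t) = n (eigenflow mu s 0).
Proof.
move=> hs t0.
have hd := vderiv_eigenflow mu s.
have z r : ip (- 'i *: eigenflow mu (shift_weights mu s) r) (eigenflow mu s r) = 0.
  have [dr <-] := eigenflow_dom mu r hs.
  rewrite scaleNr innerNl scalerBr innerDl innerNl inner_i_sym// scalerA mulrC -scalerA.
  by rewrite innerZl inner_i; ring.
have {}hd := half_deriv_inner Hdot hd hd.
apply/eqP; rewrite -(eqrXn2 (n := 2)) ?rnorm_ge0// -!(inner_rnorm Hdot) eq_le.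
apply/andP; split; rewrite -subr_le0.
  have := half_deriv_le hd (lexx 0) t0 (M := 0); rewrite mul0r; apply => r _.
  by rewrite (innerC _ (eigenflow _ _ _)) z addr0.
have := half_deriv_le (@half_derivZ R (-1) _ _ hd) (lexx 0) t0 (M := 0).
rewrite mul0r !mulN1r opprK addrC; apply => r _.
by rewrite (innerC _ (eigenflow _ _ _)) z addr0 mulr0.
Qed.

Lemma eigenflow_schrodinger s : eigenpairs s -> schrodinger_solution A (eigenflow 0 s).
Proof.
move=> hs; split => //; first exact: vderiv_cont (vderiv_eigenflow 0 s).
exists (fun t => \sum_(p <- s) cis_primitive p.1 p.2 t); split.
- by rewrite big1// => p _; rewrite cis_primitive0.
- have : vderiv (fun t => \sum_(p <- s) cis_primitive p.1 p.2 t)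
      (fun t => \sum_(p <- s) cis (- (p.1 * t)) *: p.2).
    by apply: vderiv_sum => p; apply: vderiv_cis_primitive.
  by move=> /vderiv_ext; apply => t _; apply: eq_bigr => p _; rewrite subr0.
- move=> t t0; rewrite /eigenflow /=.
  elim: s hs => [|p s IH] hs.
    by rewrite !big_nil (op0 Alin) scaler0 addr0; split => //; apply: dom0.
  have [dp Ap] : eigenpair A p by apply: hs; rewrite inE eqxx.
  have [|ds es] := IH; first by move=> q qs; apply: hs; rewrite inE qs orbT.
  have dpr : dom A (cis_primitive p.1 p.2 t) /\
      A (cis_primitive p.1 p.2 t) = p.1%:C *: cis_primitive p.1 p.2 t.
    rewrite /cis_primitive; case: eqVneq => [p0|_].
      by split; [exact: domZ | rewrite (opZ Alin)// Ap p0 !scalerA mulrC].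
    have d1 : dom A ('i *: p.2) by apply: domZ.
    split; first by apply: domD => //; apply: domZ.
    rewrite (opD Alin); [|exact: domZ|exact: domZ].
    rewrite !(opZ Alin)// Ap scalerDr !scalerA.
    by congr (_ *: _ + _ *: _); ring.
  rewrite !big_cons; split; first by apply: domD => //; case: dpr.
  have [d1 e1] := dpr; rewrite es (opD Alin)// e1 !subr0 mulr0 oppr0 cis0 scale1r.
  by rewrite cis_primitiveE scalerDr scalerA addrACA.
Qed.

Variables (Bs : {linear H -> Y}) (T : R).
Hypotheses (Bc : continuous Bs) (T0 : 0 < T) (obs : observable A Bs T).

(** The Lebesgue integral of [observable] is met only here: a supremum bound of the output on [0, T]
    is all that the resolvent estimate needs. *)
Lemma rnorm_sqr_integral_le (w : R -> Y) (M : R) : vcont w ->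
  (forall t, 0 <= t <= T -> rnorm (w t) <= M) ->
  (\int[lebesgue_measure]_(t in `[0%R, T]) ((rnorm (w t)) ^+ 2)%:E <= (M ^+ 2 * T)%:E)%E.
Proof.
move=> wc wM.
have M0 : 0 <= M by apply: le_trans (wM 0 _); [exact: rnorm_ge0 | rewrite lexx ltW].
apply: (@le_trans _ _ (\int[lebesgue_measure]_(t in `[0%R, T]) (M ^+ 2)%:E)%E); last first.
  rewrite integral_cst//= lebesgue_measure_itv/= lte_fin T0 -EFinM.
  by rewrite subr0.
apply: ge0_le_integral => //=.
- by move=> t _; rewrite lee_fin sqr_ge0.
- apply/measurable_EFinP.
  apply: subspace_continuous_measurable_fun => //.
  apply/subspace_continuousP => t; rewrite /= in_itv/= => /andP[t0 tT].
  have nc : rnorm (w s) @[s --> half_nbhs t] --> rnorm (w t).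
    apply/cvgrPdist_lt => e e0; have /cvgrPdist_lt/(_ _ e0)/half_nbhsP[d d0 hd] := wc _ t0.
    apply/half_nbhsP; exists d => // s s0 sd; have := hd _ s0 sd.
    rewrite sub0r normrN ger0_norm ?rnorm_ge0//; apply: le_lt_trans.
    have := ler_rnorm_dist (w s) (w t); have := ler_rnorm_dist (w t) (w s).
    by rewrite (rnormBC (w t)) ler_norml => h1 h2; lra.
  have {}nc : rnorm (w s) ^+ 2 @[s --> half_nbhs t] --> rnorm (w t) ^+ 2.
    by rewrite expr2; under eq_fun do rewrite expr2; apply: cvgM.
  apply: cvg_trans nc; apply: cvg_app => P /half_nbhsP[d d0 hd].
  apply/nbhs_ballP; exists d => // s; rewrite /ball/= => sd; rewrite in_itv/= => /andP[s0 _].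
  by apply: hd => //; rewrite distrC.
- by move=> t; rewrite in_itv/= => ht; rewrite lee_fin ler_pXn2r ?nnegrE ?rnorm_ge0// wM.
Qed.

(** After removal of the phase exp(-i mu t), the flow has a derivative of constant norm |(A - mu)
    x|, so on [0, T] the output is at most M = |Bs x| + b T |(A - mu) x|. Observability then gives
    |x|^2 <= K T M^2. General x follow by density in the graph norm. *)
Lemma hautus : exists2 C : R, 0 <= C & forall mu x, dom A x ->
  n x <= C * (n (A x - mu%:C *: x) + rnorm (Bs x)).
Proof.
have [K K0 hK] := obs; have [b b0 hb] := linear_rnorm_bounded Bc.
pose C := Num.sqrt (K * T) * (1 + b * T).
have C0 : 0 <= C by rewrite mulr_ge0 ?sqrtr_ge0// addr_ge0// mulr_ge0// ltW.
exists C => // mu.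
have base s x : eigenpairs s -> x = \sum_(p <- s) p.2 ->
    n x <= C * (n (A x - mu%:C *: x) + rnorm (Bs x)).
  move=> hs xs; have sol := eigenflow_schrodinger hs.
  have e0 : x = eigenflow mu s 0 by rewrite eigenflow0.
  have [dx Ax] := eigenflow_dom mu 0 hs.
  rewrite -e0 in dx Ax.
  pose M := rnorm (Bs x) + b * (n (A x - mu%:C *: x) * T).
  have M0 : 0 <= M.
    by rewrite addr_ge0 ?rnorm_ge0// !mulr_ge0 ?rnorm_ge0// ltW.
  have bnd t : 0 <= t <= T -> rnorm (Bs (eigenflow 0 s t)) <= M.
    move=> /andP[t0 tT]; rewrite (eigenflow_shift mu) linearZ rnorm_cis.
    apply: (le_trans (ler_rnorm_dist _ (Bs x))); rewrite lerD2l -linearB.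
    apply: (le_trans (hb _)); rewrite ler_wpM2l// e0.
    have lip := vderiv_lipschitz Hdot (vderiv_eigenflow mu s) (lexx 0) t0.
    apply: (@le_trans _ _ (n (A x - mu%:C *: x) * (t - 0))).
      apply: lip => r /andP[r0 _].
      rewrite scaleNr rnormN rnormi rnorm_eigenflow ?(ltW r0)// -?Ax//.
      exact: shift_weights_eigenpairs.
    by rewrite -e0 subr0 ler_wpM2l ?rnorm_ge0.
  have wc : vcont (fun t => Bs (eigenflow 0 s t)).
    apply: (vcont_lin (linearB Bs) hb).
    exact: vderiv_cont (vderiv_eigenflow 0 s).
  have K0' : (0 <= K%:E)%E by rewrite lee_fin ltW.
  have := le_trans (hK _ sol) (lee_wpmul2l K0' (rnorm_sqr_integral_le wc bnd)).
  rewrite -EFinM lee_fin.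
  rewrite eigenflow0 -xs => h.
  have KT : 0 <= K * T by rewrite mulr_ge0// ltW.
  have h2 : n x <= Num.sqrt (K * T) * M.
    rewrite -(ler_pXn2r (n := 2)) ?nnegrE ?rnorm_ge0 ?mulr_ge0 ?sqrtr_ge0//.
    by rewrite exprMn sqr_sqrtr//; lra.
  apply: (le_trans h2); rewrite /C -mulrA ler_wpM2l ?sqrtr_ge0// /M.
  have := rnorm_ge0 (A x - mu%:C *: x); have := rnorm_ge0 (Bs x).
  have bT : 0 <= b * T by rewrite mulr_ge0// ltW.
  move: (rnorm (Bs x)) (n _) => u v u0 v0; nra.
move=> x dx; apply/ler_addgt0Pr => e e0.
(* D counts every error of the approximation: one in x itself, and C times those in A x, mu x and Bs
   x. *)
pose D := 1 + C * (1 + `|mu| + b).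
have D0 : 0 < D.
  by rewrite /D; have := mulr_ge0 C0 (addr_ge0 (addr_ge0 ler01 (normr_ge0 mu)) b0); lra.
have [y [[s hs ys] h1 h2]] := eigensum_core Hdot Asa Age0 Acpt dx (divr_gt0 e0 D0).
have h := base _ _ hs ys.
have h3 : n (A y - mu%:C *: y) <= n (A x - mu%:C *: x) + (1 + `|mu|) * (e / D).
  have := ler_rnorm_dist (A y - mu%:C *: y) (A x - mu%:C *: x).
  have -> : A y - mu%:C *: y - (A x - mu%:C *: x) = (A y - A x) - mu%:C *: (y - x).
    by apply: (inner_ext Hdot) => z; rewrite !(innerDl, innerNl, innerZl); ring.
  have := ler_rnormB (A y - A x) (mu%:C *: (y - x)).
  rewrite rnormZ !(rnormBC y) (rnormBC (A y)).
  have := ler_wpM2l (normr_ge0 mu) (ltW h1); lra.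
have h4 : rnorm (Bs y) <= rnorm (Bs x) + b * (e / D).
  have := ler_rnorm_dist (Bs y) (Bs x); rewrite -linearB => h4.
  have := hb (y - x); rewrite rnormBC in h1; have := ler_wpM2l b0 (ltW h1); lra.
have h5 := ler_rnorm_dist x y.
have h6 : n y <= C * (n (A x - mu%:C *: x) + (1 + `|mu|) * (e / D) + (rnorm (Bs x) + b * (e / D))).
  by apply: (le_trans h); rewrite ler_wpM2l// lerD.
have h7 : e / D * D = e by field; rewrite gt_eqF.
rewrite {2}/D in h7; move: (e / D) h1 h3 h4 h6 h7 => q; lra.
Qed.

End Hautus.

(** * A finite Plancherel identity from symmetric matrices *)

Section HermitianMatrix.
Context {R : realType}.

Lemma conjCE (z : R[i]) : Num.conj z = conjc z.
Proof.
have [->|z0] := eqVneq z 0; first by rewrite rmorph0 conjc0.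
apply: (mulfI z0); rewrite -normCK -add_Re2_Im2.
case: z {z0} => a b; apply/eqP; rewrite eq_complex /=.
by apply/andP; split; apply/eqP; ring.
Qed.

(** The complexification is hermitian, so the spectral theorem for normal matrices applies; the rows
    of P are the eigenvectors. The eigenvalues must be real because they serve as [mu] in the
    resolvent estimate. *)
Lemma symmetric_diagonalization N (D : 'M[R]_N) : D^T = D ->
  exists (P : 'M[R[i]]_N) (d : 'I_N -> R),
    (forall i j, \sum_k P k i * conjc (P k j) = (i == j)%:R) /\
    (forall k j, \sum_i P k i * (D i j)%:C = (d k)%:C * P k j).
Proof.
move=> Dsym.
pose M := map_mx (real_complex R) D.
have Mherm : M \is hermsymmx.
  apply: realsym_hermsym.
    apply/is_hermitianmxP; rewrite expr0 scale1r map_mx_id//.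
    by rewrite /M map_trmx Dsym.
  apply/mxOverP => i j; rewrite mxE; apply/complex_realP; by exists (D i j).
have /orthomx_spectralP Meq := hermitian_normalmx Mherm.
set P := spectralmx M in Meq; set sp := spectral_diag M in Meq.
have Pu : P \is unitarymx by apply: spectral_unitarymx.
have PV := invmx_unitary Pu.
have Punit : P \in unitmx by apply: unitarymx_unit.
have dreal i : (complex.Re (sp 0 i))%:C = sp 0 i.
  by apply: RRe_real; apply: (mxOverP (hermitian_spectral_diag_real Mherm)).
exists P, (fun k => complex.Re (sp 0 k)); split => [i j|k j].
  have := mulVmx Punit; rewrite PV => /matrixP/(_ j i); rewrite !mxE eq_sym => <-.
  by apply: eq_bigr => k _; rewrite !mxE conjCE mulrC.
have : P *m M = diag_mx sp *m P by rewrite {1}Meq -mulmxA mulKVmx.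
move=> /matrixP/(_ k j); rewrite mul_diag_mx !mxE dreal => <-.
by apply: eq_bigr => i _; rewrite !mxE.
Qed.

(** Expanding the squares and summing over k first leaves only the diagonal terms, the columns of P
    being orthonormal. It is used in both H and Y. *)
Lemma unitary_parseval (V : completeNormedModType R[i]) (dot : {dot V for @conjc R}) N
    (P : 'M[R[i]]_N) (w : 'I_N -> V) : hilbert dot ->
  (forall i j, \sum_k P k i * conjc (P k j) = (i == j)%:R) ->
  \sum_k rnorm (\sum_j P k j *: w j) ^+ 2 = \sum_j rnorm (w j) ^+ 2.
Proof.
move=> Hdot PP; apply: complexI; rewrite !rmorph_sum /=.
have nE x : (rnorm x ^+ 2)%:C = dot x x by rewrite -Hdot normE rmorphXn.
transitivity (\sum_k \sum_i \sum_j P k i * conjc (P k j) * dot (w i) (w j)).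
  apply: eq_bigr => k _; rewrite nE linear_sumlz; apply: eq_bigr => i _.
  rewrite linear_sumr; apply: eq_bigr => j _.
  by rewrite linearZl_LR linearZr_LR /= mulrA.
rewrite exchange_big; apply: eq_bigr => i _ /=.
rewrite exchange_big (bigD1 i)//= -mulr_suml PP eqxx mul1r nE big1 ?addr0// => j ji.
by rewrite -mulr_suml PP eq_sym (negbTE ji) mul0r.
Qed.

End HermitianMatrix.

Section MatrixInequality.
Context {R : realType} {H Y : completeNormedModType R[i]}.
Variables (dotH : {dot H for @conjc R}) (dotY : {dot Y for @conjc R}).
Hypotheses (HdotH : hilbert dotH) (HdotY : hilbert dotY).
Variables (A : operator H) (Bs : {linear H -> Y}) (C : R).
Hypotheses (Alin : linear_operator A) (C0 : 0 <= C).
Hypothesis hautusC : forall (mu : R) x, dom A x ->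
  rnorm x <= C * (rnorm (A x - mu%:C *: x) + rnorm (Bs x)).

(* Diagonalise [D] and apply the resolvent inequality in each eigenspace. *)
Lemma hautus_matrix N (D : 'M[R]_N) (w : 'I_N -> H) : D^T = D ->
  (forall j, dom A (w j)) ->
  \sum_j rnorm (w j) ^+ 2 <= 2 * C ^+ 2 *
    \sum_j (rnorm (A (w j) - \sum_l (D j l)%:C *: w l) ^+ 2 + rnorm (Bs (w j)) ^+ 2).
Proof.
move=> /symmetric_diagonalization[P [d [PP Pd]]] dw.
rewrite -(unitary_parseval w HdotH PP) big_split /=.
rewrite -(unitary_parseval (fun j => A (w j) - \sum_l (D j l)%:C *: w l) HdotH PP).
rewrite -(unitary_parseval (fun j => Bs (w j)) HdotY PP) -big_split /= mulr_sumr.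
apply: ler_sum => k _.
pose x := \sum_j P k j *: w j.
have dx : dom A x by apply: (dom_sum Alin) => j _; apply: (domZ Alin).
have := hautusC (d k) dx.
(* Row k of P is a left eigenvector of D, so [d k] acts on x as D acts on the family w. *)
have -> : A x - (d k)%:C *: x = \sum_j P k j *: (A (w j) - \sum_l (D j l)%:C *: w l).
  under eq_bigr do rewrite scalerBr.
  rewrite sumrB (op_sum Alin); last by move=> j _; apply: (domZ Alin).
  under eq_bigr do rewrite (opZ Alin)//.
  congr (_ - _); under [RHS]eq_bigr do rewrite scaler_sumr.
  rewrite exchange_big scaler_sumr; apply: eq_bigr => l _ /=.
  rewrite scalerA -Pd scaler_suml; apply: eq_bigr => j _.
  by rewrite scalerA.
have -> : Bs x = \sum_j P k j *: Bs (w j).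
  by rewrite linear_sum; apply: eq_bigr => j _; rewrite linearZ.
rewrite -/x; set f := \sum_j P k j *: (A (w j) - _); set g := \sum_j P k j *: Bs (w j).
move: (rnorm_ge0 x) (rnorm_ge0 f) (rnorm_ge0 g).
move: (rnorm x) (rnorm f) (rnorm g) => a v u a0 v0 u0 h.
have : a ^+ 2 <= (C * (v + u)) ^+ 2 by rewrite ler_pXn2r ?nnegrE ?mulr_ge0 ?addr_ge0.
move=> /le_trans; apply; rewrite exprMn.
have : 0 <= C ^+ 2 * (v - u) ^+ 2 by rewrite mulr_ge0 ?sqr_ge0.
move: (C ^+ 2) => c; lra.
Qed.

End MatrixInequality.

(** * The damped wave system *)

Section DifferenceQuotient.
Context {R : realType} {V : normedModType R[i]}.
Local Notation n := (@rnorm R V).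
Implicit Types (f g : R -> V) (t s h : R).

Lemma half_nbhs_ge0 t : half_nbhs t (fun s => 0 <= s).
Proof. by apply/half_nbhsP; exists 1. Qed.

Lemma half_dnbhs_ge0 t : half_dnbhs t (fun s => 0 <= s).
Proof. by apply/half_dnbhsP; exists 1. Qed.

Lemma cvg0_le_ge0 (F : set_system R) (FF : Filter F) (a b : R -> R) :
  F (fun s => 0 <= s) -> (forall s, 0 <= s -> 0 <= a s <= b s) ->
  b s @[s --> F] --> (0 : R) -> a s @[s --> F] --> (0 : R).
Proof.
move=> F0 ab; apply: (@squeeze_cvgr _ _ _ _ (fun=> 0)); last exact: cvg_cst.
by apply: filterS F0 => s s0; apply: ab.
Qed.

Lemma vderiv_congr f g f' : (forall t, 0 <= t -> f t = g t) -> vderiv f f' -> vderiv g f'.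
Proof.
move=> fg h t t0.
apply: (@cvg0_le_ge0 _ _ _ _ (half_dnbhs_ge0 t) _ (h t t0)) => s s0.
by rewrite rnorm_ge0 /= !fg.
Qed.

(** A forward quotient, so that t + h remains in the half line. Applied to a primitive, it is the
    average over [t, t + h]. *)
Definition dq h f t : V := h^-1%:C *: (f (t + h) - f t).

Lemma vderiv_dq h f f' : 0 <= h -> vderiv f f' -> vderiv (dq h f) (dq h f').
Proof.
by move=> h0 hf; apply: vderivZ; apply: vderivB => //; apply: vderiv_shift.
Qed.

Lemma dq_cvg f f' t : vderiv f f' -> 0 <= t ->
  n (dq h f t - f' t) @[h --> 0^'+] --> (0 : R).
Proof.
move=> hf t0; have /cvgrPdist_lt hd := hf _ t0.
apply/cvgrPdist_lt => e e0; have /half_dnbhsP[d d0 {}hd] := hd _ e0.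
apply/nbhs_ballP; exists d => //= h; rewrite /ball/= sub0r normrN => hh h0.
have := hd (t + h); rewrite /dq (addrC t) addrK; apply => //.
  by rewrite addr_ge0// ltW.
by rewrite -subr_eq0 addrK gt_eqF.
Qed.

Lemma rnorm_cvg (F : set_system R) (FF : Filter F) f (x : V) :
  n (f s - x) @[s --> F] --> (0 : R) -> n (f s) @[s --> F] --> n x.
Proof.
move=> /cvgrPdist_lt h; apply/cvgrPdist_lt => e e0.
apply: filterS (h _ e0) => s; rewrite sub0r normrN ger0_norm ?rnorm_ge0// => hs.
apply: le_lt_trans hs; have := ler_rnorm_dist (f s) x; have := ler_rnorm_dist x (f s).
by rewrite (rnormBC x) ler_norml => h1 h2; lra.
Qed.

Lemma dq_rnorm_cvg f f' t : vderiv f f' -> 0 <= t ->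
  n (dq h f t) @[h --> 0^'+] --> n (f' t).
Proof. by move=> hf t0; apply: rnorm_cvg; apply: dq_cvg. Qed.

End DifferenceQuotient.

Section WaveSystem.
Context {R : realType} {H Y : completeNormedModType R[i]}.
Variables (dotH : {dot H for @conjc R}) (dotY : {dot Y for @conjc R}).
Hypotheses (HdotH : hilbert dotH) (HdotY : hilbert dotY).
Variables (A S S1 : operator H) (B : {linear Y -> H}) (Bs : {linear H -> Y}).
Hypotheses (Asa : selfadjoint dotH A) (Age0 : nonnegative dotH A).
Hypotheses (SA : is_sqrt dotH A S) (S1A : is_sqrt dotH (add_id A) S1).
Hypothesis Badj : forall (y : Y) (x : H), dotH (B y) x = dotY y (Bs x).
Local Notation ip := (inner dotH).
Local Notation n := (@rnorm R H).
Let Alin : linear_operator A. Proof. exact: sa_linear Asa. Qed.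
Let Slin : linear_operator S. Proof. by case: SA => /sa_linear. Qed.

Lemma inner_damping x y : ip (B (Bs x)) y = inner dotY (Bs x) (Bs y).
Proof. by rewrite /inner Badj. Qed.

(* (y, z) is a classical solution of U' = \mathcal{A} U + (f, g); the derivative of S y is
   recorded separately because S is unbounded. *)
Definition forced_pair (f g : H) (y z : R -> H) :=
  [/\ forall t, 0 <= t -> dom A (y t) /\ dom S (z t),
      vderiv y (fun t => z t + f),
      vderiv (fun t => S (y t)) (fun t => S (z t) + S f) &
      vderiv z (fun t => - A (y t) - B (Bs (z t)) + g)].

Definition strong_pair (y z : R -> H) :=
  [/\ forall t, 0 <= t -> dom A (y t) /\ dom S (z t),
      vderiv y z,
      vderiv (fun t => S (y t)) (fun t => S (z t)) &
      vderiv z (fun t => - A (y t) - B (Bs (z t)))].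

(** Twice the energy. *)
Definition energy2 (y z : R -> H) t := n (S (y t)) ^+ 2 + n (z t) ^+ 2.

Lemma strong_dom_S y z t : strong_pair y z -> 0 <= t -> dom S (y t).
Proof. by move=> [h _ _ _] /h[dA _]; apply: (sqrt_dom SA). Qed.

Lemma strong_pairD y z h : 0 <= h -> strong_pair y z ->
  strong_pair (fun t => y (t + h) - y t) (fun t => z (t + h) - z t).
Proof.
move=> h0 hs; have [hdom dy dSy dz] := hs.
have d2 t : 0 <= t -> [/\ dom A (y t), dom S (y t), dom S (z t) & [/\ dom A (y (t + h)), dom S (y (t + h)) & dom S (z (t + h))]].
  move=> t0; have th := addr_ge0 t0 h0.
  have [d1 d2] := hdom _ t0; have [d3 d4] := hdom _ th.
  have d5 := strong_dom_S hs t0; have d6 := strong_dom_S hs th.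
  by [].
split.
- by move=> t /d2[a1 a2 a3 [a4 a5 a6]]; split; apply: domB.
- by apply: vderivB => //; apply: vderiv_shift.
- apply: (vderiv_congr (f := fun t => S (y (t + h)) - S (y t))).
    by move=> t /d2[a1 a2 a3 [a4 a5 a6]]; rewrite (opB Slin).
  apply: vderiv_ext (vderivB (vderiv_shift h0 dSy) dSy) _ => t /d2[a1 a2 a3 [a4 a5 a6]].
  by rewrite (opB Slin).
- apply: vderiv_ext (vderivB (vderiv_shift h0 dz) dz) _ => t /d2[a1 a2 a3 [a4 a5 a6]].
  rewrite (opB Alin)// !linearB /=.
  by apply: (inner_ext HdotH) => w; rewrite !(innerDl, innerNl); ring.
Qed.

Lemma strong_pairZ y z (r : R) : strong_pair y z ->
  strong_pair (fun t => r%:C *: y t) (fun t => r%:C *: z t).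
Proof.
move=> hs; have [hdom dy dSy dz] := hs; split.
- by move=> t /hdom[a1 a2]; split; apply: domZ.
- exact: vderivZ.
- apply: (vderiv_congr (f := fun t => r%:C *: S (y t))).
    by move=> t t0; rewrite (opZ Slin)//; apply: strong_dom_S hs t0.
  by apply: vderiv_ext (vderivZ r%:C dSy) _ => t /hdom[a1 a2]; rewrite (opZ Slin).
- apply: vderiv_ext (vderivZ r%:C dz) _ => t /hdom[a1 a2].
  by rewrite (opZ Alin)// !linearZ /= scalerDr.
Qed.

Lemma strong_pair_dq y z h : 0 <= h -> strong_pair y z -> strong_pair (dq h y) (dq h z).
Proof. by move=> h0 hs; apply: (strong_pairZ h^-1 (strong_pairD h0 hs)). Qed.

(** The products of S y with S z and of A y with z cancel through [sqrt_inner]; only the damping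
    survives. *)
Lemma energy2_deriv y z : strong_pair y z ->
  half_deriv (energy2 y z) (fun t => - 2 * rnorm (Bs (z t)) ^+ 2).
Proof.
move=> hs; have [hdom dy dSy dz] := hs.
have := half_derivD (half_deriv_inner HdotH dSy dSy) (half_deriv_inner HdotH dz dz).
rewrite (_ : (fun s => _) = energy2 y z); last first.
  by apply/funext => t; rewrite /energy2 !(inner_rnorm HdotH).
move=> /half_deriv_ext; apply => t t0; have [dA dS] := hdom _ t0.
rewrite (innerC _ (S (z t))) (sqrt_inner SA dA dS) (innerC _ (z t)).
rewrite !(innerDl, innerNl) inner_damping (inner_rnorm HdotY); ring.
Qed.

Lemma energy2_noninc y z s t : strong_pair y z -> 0 <= s -> s <= t ->
  energy2 y z t <= energy2 y z s.
Proof.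
move=> /energy2_deriv hd s0 st; rewrite -subr_le0.
have := half_deriv_le hd s0 st (M := 0); rewrite mul0r; apply => r _.
by rewrite mulNr oppr_le0 mulr_ge0// sqr_ge0.
Qed.

(* The energy q satisfies q' <= q / (2 tau) + 2 tau |(f, g)|^2; multiplying it by 2 tau - s
   absorbs the first term. *)
Lemma forced_growth f g y z (tau : R) : forced_pair f g y z -> dom S f -> 0 < tau ->
  energy2 y z tau <= 2 * energy2 y z 0 + 4 * tau ^+ 2 * (n (S f) ^+ 2 + n g ^+ 2).
Proof.
move=> [hdom dy dSy dz] df tau0.
set a2 := n (S f) ^+ 2 + n g ^+ 2.
have := half_derivD (half_deriv_inner HdotH dSy dSy) (half_deriv_inner HdotH dz dz).
rewrite (_ : (fun s => _) = energy2 y z); last first.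
  by apply/funext => t; rewrite /energy2 !(inner_rnorm HdotH).
set q' := (fun t => _ + _) => dq'.
have q'le t : 0 <= t -> 2 * tau * q' t <= energy2 y z t + 4 * tau ^+ 2 * a2.
  move=> t0; have [dA dS] := hdom _ t0; rewrite /q'.
  rewrite (innerC _ (S (z t) + _)) (innerC _ (z t)) !innerDr !innerDl !innerNl.
  rewrite (sqrt_inner SA dA dS) inner_damping (inner_rnorm HdotY) /energy2.
  have := sqr_ge0 (rnorm (S (y t) - (2 * tau)%:C *: S f)).
  have := sqr_ge0 (rnorm (z t - (2 * tau)%:C *: g)).
  rewrite !(rnormB_sqr HdotH) !rnormZ !innerZr !exprMn !real_normK ?num_real//.
  have := mulr_ge0 (ltW tau0) (sqr_ge0 (rnorm (Bs (z t)))).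
  rewrite (innerC _ g) /a2; lra.
have hlin : half_deriv (fun t => 2 * tau - t) (fun=> -1).
  apply: half_deriv_ext (half_derivB (half_deriv_cst (2 * tau)) (is_derive_half_deriv (fun t => is_derive_id t 1))) _ => t _.
  by rewrite sub0r.
have := half_deriv_le (half_derivM hlin dq') (lexx 0) (ltW tau0) (M := 4 * tau ^+ 2 * a2).
rewrite !subr0 => h.
have {}h : (2 * tau - tau) * energy2 y z tau - 2 * tau * energy2 y z 0 <= 4 * tau ^+ 2 * a2 * tau.
  apply: h => s /andP[s0 st].
  have q0 : 0 <= energy2 y z s by rewrite addr_ge0// sqr_ge0.
  have a20 : 0 <= a2 by rewrite addr_ge0// sqr_ge0.
  have := q'le _ (ltW s0); rewrite mulN1r.
  (* The weight 2 tau - s lies between tau and 2 tau: for q' >= 0 it is replaced by 2 tau, and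
     otherwise the product is nonpositive. *)
  have [q'0|q'0] := leP 0 (q' s).
    have : (2 * tau - s) * q' s <= 2 * tau * q' s by rewrite ler_wpM2r//; lra.
    lra.
  have : (2 * tau - s) * q' s <= 0 by rewrite mulr_ge0_le0// ?ltW//; lra.
  have : 0 <= 4 * tau ^+ 2 * a2 by rewrite !mulr_ge0// ?exprn_ge0// ltW.
  lra.
rewrite -(ler_pM2l tau0); lra.
Qed.

End WaveSystem.

(** * Regularisation of mild solutions and their Lipschitz bound *)

Section WaveSolution.
Context {R : realType} {H Y : completeNormedModType R[i]}.
Variables (dotH : {dot H for @conjc R}) (dotY : {dot Y for @conjc R}).
Hypotheses (HdotH : hilbert dotH) (HdotY : hilbert dotY).
Variables (A S S1 : operator H) (B : {linear Y -> H}) (Bs : {linear H -> Y}).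
Hypotheses (Asa : selfadjoint dotH A) (Age0 : nonnegative dotH A).
Hypotheses (SA : is_sqrt dotH A S) (S1A : is_sqrt dotH (add_id A) S1).
Hypothesis Badj : forall (y : Y) (x : H), dotH (B y) x = dotY y (Bs x).
Local Notation ip := (inner dotH).
Local Notation n := (@rnorm R H).
Let Alin : linear_operator A. Proof. exact: sa_linear Asa. Qed.
Let Slin : linear_operator S. Proof. by case: SA => /sa_linear. Qed.
Local Notation strong := (strong_pair A S B Bs).

Lemma energy_norm_ge (X : H * H) : dom S X.1 ->
  [/\ n X.1 <= energy_norm S1 X, n (S X.1) <= energy_norm S1 X & n X.2 <= energy_norm S1 X].
Proof.
move=> dX; have [h1 h2] := sqrt1_rnorm HdotH Asa Age0 SA S1A dX.
have h3 : n (S1 X.1) <= energy_norm S1 X.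
  by rewrite /energy_norm -{1}[n _](ger0_norm (rnorm_ge0 _)) -sqrtr_sqr ler_wsqrtr// lerDl sqr_ge0.
have h4 : n X.2 <= energy_norm S1 X.
  by rewrite /energy_norm -{1}[n _](ger0_norm (rnorm_ge0 _)) -sqrtr_sqr ler_wsqrtr// lerDr sqr_ge0.
by split => //; apply: le_trans h3.
Qed.

(** Here (y, z) is the integral of U, the object that takes values in the domain of the generator.
    The energy norm dominates the norms of its components and of S y, so one limit yields three
    derivatives. *)
Lemma wave_primitive (U : R -> H * H) : wave_solution A S S1 B Bs U ->
  exists y z : R -> H,
  [/\ forall t, 0 <= t -> [/\ dom A (y t), dom S (z t) & dom S (U t).1],
      vderiv y (fun t => (U t).1),
      vderiv (fun t => S (y t)) (fun t => S (U t).1),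
      vderiv z (fun t => (U t).2) &
      forall t, 0 <= t -> (U t).1 = (U 0).1 + z t /\
        (U t).2 = (U 0).2 + (- A (y t) - B (Bs (z t)))].
Proof.
move=> [US _ [v [_ dv vG]]].
exists (fun t => (v t).1), (fun t => (v t).2).
have dvS t : 0 <= t -> dom S (v t).1.
  by move=> t0; have [[d1 _] _] := vG _ t0; apply: (sqrt_dom SA).
have key s t : 0 <= s -> 0 <= t -> dom S (((s - t)^-1)%:C *: (v s - v t) - U t).1.
  move=> s0 t0; apply: domB => //; last exact: US.
  by apply: domZ => //; apply: domB => //; apply: dvS.
split.
- by move=> t t0; have [[d1 d2] _] := vG _ t0; split => //; apply: US.
- move=> t t0; apply: (@cvg0_le_ge0 _ _ _ _ _ (half_dnbhs_ge0 t) _ (dv t t0)) => s s0.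
  by rewrite rnorm_ge0 /=; have [] := energy_norm_ge (key s t s0 t0).
- move=> t t0; apply: (@cvg0_le_ge0 _ _ _ _ _ (half_dnbhs_ge0 t) _ (dv t t0)) => s s0.
  rewrite rnorm_ge0 /=; have [_ + _] := energy_norm_ge (key s t s0 t0).
  have d1 := dvS _ s0; have d2 := dvS _ t0.
  rewrite /= (opB Slin); [|by apply: domZ => //; apply: domB|exact: US].
  by rewrite (opZ Slin) ?(opB Slin)//; apply: domB.
- move=> t t0; apply: (@cvg0_le_ge0 _ _ _ _ _ (half_dnbhs_ge0 t) _ (dv t t0)) => s s0.
  by rewrite rnorm_ge0 /=; have [] := energy_norm_ge (key s t s0 t0).
- by move=> t t0; have [_ Ut] := vG _ t0; split; rewrite {1}Ut.
Qed.

Variable U : R -> H * H.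
Variables y z : R -> H.
Hypothesis dyz : forall t, 0 <= t -> [/\ dom A (y t), dom S (z t) & dom S (U t).1].
Hypothesis dy : vderiv y (fun t => (U t).1).
Hypothesis dSy : vderiv (fun t => S (y t)) (fun t => S (U t).1).
Hypothesis dz : vderiv z (fun t => (U t).2).
Hypothesis UE : forall t, 0 <= t -> (U t).1 = (U 0).1 + z t /\
        (U t).2 = (U 0).2 + (- A (y t) - B (Bs (z t))).

Lemma dq_U1 h t : 0 <= h -> 0 <= t -> dq h (fun t => (U t).1) t = dq h z t.
Proof.
move=> h0 t0; have [e1 _] := UE t0; have [e2 _] := UE (addr_ge0 t0 h0).
rewrite /dq e1 e2; congr (_ *: _).
by apply: (inner_ext HdotH) => w; rewrite !(innerDl, innerNl); ring.
Qed.

Lemma dq_dom h t : 0 <= h -> 0 <= t -> dom A (dq h y t) /\ dom S (dq h z t).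
Proof.
move=> h0 t0; have [d1 d2 _] := dyz t0; have [d3 d4 _] := dyz (addr_ge0 t0 h0).
by split; apply: domZ => //; apply: domB.
Qed.

Lemma dq_Sy h t : 0 <= h -> 0 <= t -> dq h (fun t => S (y t)) t = S (dq h y t).
Proof.
move=> h0 t0; have [d1 _ _] := dyz t0; have [d3 _ _] := dyz (addr_ge0 t0 h0).
have e1 := sqrt_dom SA d1; have e3 := sqrt_dom SA d3.
by rewrite /dq -(opB Slin)// (opZ Slin)//; apply: domB.
Qed.

(** The primitive solves the system up to the constants U 0, which a difference quotient removes.
    The result is a classical solution that approximates U as h tends to 0. *)
Lemma strong_dq_primitive h : 0 <= h -> strong (dq h y) (dq h z).
Proof.
move=> h0; split.
- by move=> t; apply: dq_dom.
- by apply: vderiv_ext (vderiv_dq h0 dy) _ => t t0; rewrite dq_U1.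
- apply: (vderiv_congr (f := dq h (fun t => S (y t)))); first by move=> t t0; rewrite dq_Sy.
  apply: vderiv_ext (vderiv_dq h0 dSy) _ => t t0.
  have [_ _ d1] := dyz t0; have [_ _ d2] := dyz (addr_ge0 t0 h0).
  rewrite {1}/dq -(opB Slin)// -(opZ Slin); last exact: domB.
  by congr (S _); apply: dq_U1.
- apply: vderiv_ext (vderiv_dq h0 dz) _ => t t0.
  have [d1 _ _] := dyz t0; have [d3 _ _] := dyz (addr_ge0 t0 h0).
  have [_ e1] := UE t0; have [_ e2] := UE (addr_ge0 t0 h0).
  rewrite /dq e1 e2 (opZ Alin) ?(opB Alin)//; last exact: domB.
  rewrite !linearZ /= -scalerDr; congr (_ *: _); rewrite !linearB /=.
  by apply: (inner_ext HdotH) => w; rewrite !(innerDl, innerNl); ring.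
Qed.

Lemma energy2_dq_cvg f f' g g' t : vderiv f f' -> vderiv g g' -> 0 <= t ->
  n (dq k f t) ^+ 2 + n (dq k g t) ^+ 2 @[k --> 0^'+] --> n (f' t) ^+ 2 + n (g' t) ^+ 2.
Proof.
move=> hf hg t0; have sqr_cvg (u : R -> R) (l : R) :
    u k @[k --> 0^'+] --> l -> u k ^+ 2 @[k --> 0^'+] --> l ^+ 2.
  by move=> ul; rewrite expr2; under eq_fun do rewrite expr2; apply: cvgM.
by apply: cvgD; apply: sqr_cvg; apply: dq_rnorm_cvg.
Qed.

Lemma at_right_gt0 : \forall k \near (0 : R)^'+, 0 < k.
Proof. exact: nbhs_right_gt. Qed.

Lemma energy2_dq_primitive t : 0 <= t ->
  energy2 S (dq k y) (dq k z) t @[k --> 0^'+] --> n (S (U t).1) ^+ 2 + n (U t).2 ^+ 2.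
Proof.
move=> t0; apply: cvg_trans (energy2_dq_cvg dSy dz t0).
apply: near_eq_cvg; apply: filterS at_right_gt0 => k k0.
by rewrite /energy2 -dq_Sy// ltW.
Qed.

(** Increments of the regularised solutions are again solutions, so their energy does not increase;
    the regularisation parameter k is then sent to 0. *)
Lemma increment_contraction h t : 0 <= h -> 0 <= t ->
  n (S (U (t + h)).1 - S (U t).1) ^+ 2 + n ((U (t + h)).2 - (U t).2) ^+ 2 <=
  n (S (U h).1 - S (U 0).1) ^+ 2 + n ((U h).2 - (U 0).2) ^+ 2.
Proof.
move=> h0 t0.
pose f s := S (y (s + h)) - S (y s); pose g s := z (s + h) - z s.
have df : vderiv f (fun s => S (U (s + h)).1 - S (U s).1).
  by apply: vderivB => //; apply: (vderiv_shift h0 dSy).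
have dg : vderiv g (fun s => (U (s + h)).2 - (U s).2).
  by apply: vderivB => //; apply: (vderiv_shift h0 dz).
have c1 := energy2_dq_cvg df dg t0; have c2 := energy2_dq_cvg df dg (lexx 0).
rewrite add0r in c2; apply: ler_cvg_to c1 c2 _.
apply: filterS at_right_gt0 => k k0.
have sk := strong_pairD HdotH Asa SA h0 (strong_dq_primitive (ltW k0)).
have E s : 0 <= s -> n (dq k f s) ^+ 2 + n (dq k g s) ^+ 2 =
    energy2 S (fun s => dq k y (s + h) - dq k y s) (fun s => dq k z (s + h) - dq k z s) s.
  move=> s0; rewrite /energy2; have sh := addr_ge0 s0 h0.
  have [d1 _] := dq_dom (ltW k0) s0; have [d2 _] := dq_dom (ltW k0) sh.
  have e1 := sqrt_dom SA d1; have e2 := sqrt_dom SA d2.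
  rewrite (opB Slin)// -!dq_Sy ?(ltW k0)// /dq -!scalerBr /f /g.
  rewrite ![s + k + h]addrAC; congr (n (_ *: _) ^+ 2 + n (_ *: _) ^+ 2);
  by apply: (inner_ext HdotH) => w; rewrite !(innerDl, innerNl); ring.
rewrite !E//; exact: (energy2_noninc HdotH HdotY SA Badj sk (lexx 0) t0).
Qed.

Hypotheses (dU1 : dom A (U 0).1) (dU2 : dom S (U 0).2).
Let G2 := - A (U 0).1 - B (Bs (U 0).2).

(** The square of the energy seminorm of the generator applied to U 0. *)
Definition generator_seminorm2 := n (S (U 0).2) ^+ 2 + n G2 ^+ 2.
Local Notation a2 := generator_seminorm2.

(** U - U 0 solves the system forced by the constant source ((U 0).2, G2) with zero data.
    [forced_growth] is applied to its regularisation, whose initial energy vanishes as k tends to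
    0. *)
Lemma initial_increment tau : 0 < tau ->
  n (S (U tau).1 - S (U 0).1) ^+ 2 + n ((U tau).2 - (U 0).2) ^+ 2 <= 4 * tau ^+ 2 * a2.
Proof.
move=> tau0; have St := sqrt_dom SA dU1.
pose f s := S (y s) - s%:C *: S (U 0).1; pose g s := z s - s%:C *: (U 0).2.
have dlin (x : H) : vderiv (fun s => s%:C *: x) (fun=> x).
  by apply: vderiv_ext (vderiv_smul x half_deriv_id) _ => s _; rewrite scale1r.
have df : vderiv f (fun s => S (U s).1 - S (U 0).1) by apply: vderivB.
have dg : vderiv g (fun s => (U s).2 - (U 0).2) by apply: vderivB.
have c1 := energy2_dq_cvg df dg (ltW tau0); have c2 := energy2_dq_cvg df dg (lexx 0).
rewrite !subrr rnorm0 expr0n addr0 in c2.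
have {}c2 : 2 * (n (dq k f 0) ^+ 2 + n (dq k g 0) ^+ 2) + 4 * tau ^+ 2 * a2
    @[k --> 0^'+] --> 2 * 0 + 4 * tau ^+ 2 * a2.
  by apply: cvgD; [apply: cvgM => //; exact: cvg_cst | exact: cvg_cst].
rewrite mulr0 add0r in c2; apply: ler_cvg_to c1 c2 _.
apply: filterS at_right_gt0 => k k0.
have sk := strong_dq_primitive (ltW k0); have [sdom sy sSy sz] := sk.
have dqlin (u : R -> H) x s : dq k (fun s => u s - s%:C *: x) s = dq k u s - x.
  rewrite /dq; apply: (inner_ext HdotH) => w.
  by rewrite !(innerDl, innerNl, innerZl); field; rewrite gt_eqF.
have E s : 0 <= s -> n (dq k f s) ^+ 2 + n (dq k g s) ^+ 2 =
    energy2 S (fun s => dq k y s - (U 0).1) (fun s => dq k z s - (U 0).2) s.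
  move=> s0; have [d1 d2] := sdom _ s0.
  have e1 := sqrt_dom SA d1.
  by rewrite /energy2 /f /g !dqlin (opB Slin)// dq_Sy// ltW.
rewrite !E ?(ltW tau0)//.
apply: (forced_growth HdotH HdotY SA Badj (f := (U 0).2) (g := G2)) => //.
have sub0 (u : R -> H) x u' : vderiv u u' -> vderiv (fun s => u s - x) u'.
  by move=> hu; apply: vderiv_ext (vderivB hu (vderiv_cst x)) _ => s _; rewrite subr0.
split.
- by move=> s /sdom[d1 d2]; split; apply: domB.
- by apply: sub0; apply: vderiv_ext sy _ => s _; rewrite subrK.
- apply: (vderiv_congr (f := fun s => S (dq k y s) - S (U 0).1)).
    by move=> s /sdom[d1 d2]; have e1 := sqrt_dom SA d1; rewrite (opB Slin).
  apply: sub0; apply: vderiv_ext sSy _ => s /sdom[d1 d2].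
  by rewrite (opB Slin)// subrK.
- apply: sub0; apply: vderiv_ext sz _ => s /sdom[d1 d2].
  rewrite (opB Alin)// !linearB /= /G2.
  by apply: (inner_ext HdotH) => w; rewrite !(innerDl, innerNl); ring.
Qed.

(** The substitute for a bound of U' by the generator applied to U 0; the factor 2 is inherited from
    [forced_growth]. *)
Lemma increment_le h t : 0 < h -> 0 <= t ->
  n (S (U (t + h)).1 - S (U t).1) <= 2 * h * Num.sqrt a2 /\
  n ((U (t + h)).2 - (U t).2) <= 2 * h * Num.sqrt a2.
Proof.
move=> h0 t0.
have a20 : 0 <= a2 by rewrite /a2 addr_ge0// sqr_ge0.
have := le_trans (increment_contraction (ltW h0) t0) (initial_increment h0).
have -> : 4 * h ^+ 2 * a2 = (2 * h * Num.sqrt a2) ^+ 2 by rewrite exprMn sqr_sqrtr//; ring.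
have b0 : 0 <= 2 * h * Num.sqrt a2 by rewrite !mulr_ge0 ?sqrtr_ge0// ltW.
move=> h1; split; rewrite -(ler_pXn2r (n := 2)) ?nnegrE ?rnorm_ge0//; apply: le_trans h1.
- by rewrite lerDl sqr_ge0.
- by rewrite lerDr sqr_ge0.
Qed.

End WaveSolution.

(** * The observability inequality in time *)

Section GridSums.
Context {R : realType}.

Implicit Types (L c : R) (N : nat) (f g F : R -> R).

(** The mesh is L / (N + 1) and only the N interior nodes are summed, so that the index set is that
    of the Dirichlet matrix. *)
Definition gsum (L : R) (N : nat) (f : R -> R) : R :=
  L / N.+1%:R * \sum_(j < N) f (j.+1%:R * (L / N.+1%:R)).

Lemma grid_le (L : R) (N j : nat) : 0 <= L -> (j <= N)%N ->
  0 <= j.+1%:R * (L / N.+1%:R) <= L.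
Proof.
move=> L0 jN; rewrite mulr_ge0 ?divr_ge0//= mulrA ler_pdivrMr ?ltr0n//.
by rewrite mulrC ler_wpM2l// ler_nat.
Qed.

Lemma gsum_le L N f g : 0 <= L -> (forall s, 0 <= s <= L -> f s <= g s) ->
  gsum L N f <= gsum L N g.
Proof.
move=> L0 fg; rewrite /gsum ler_wpM2l ?divr_ge0//; apply: ler_sum => j _.
by apply: fg; apply: grid_le => //; apply: ltnW.
Qed.

Lemma gsumD L N f g : gsum L N (fun s => f s + g s) = gsum L N f + gsum L N g.
Proof. by rewrite /gsum big_split mulrDr. Qed.

Lemma gsumZ L N c f : gsum L N (fun s => c * f s) = c * gsum L N f.
Proof. by rewrite /gsum -mulr_sumr mulrCA. Qed.

Lemma gsum_cst_le L N c : 0 <= L -> 0 <= c -> gsum L N (fun=> c) <= L * c.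
Proof.
move=> L0 c0; rewrite /gsum sumr_const card_ord -[c *+ N]mulr_natr.
have -> : L / N.+1%:R * (c * N%:R) = (L * c) * (N%:R / N.+1%:R) by ring.
by rewrite ler_piMr ?mulr_ge0// ler_pdivrMr ?ltr0n// mul1r ler_nat.
Qed.

Lemma gsum_cvg L F F' : 0 < L -> half_deriv F F' -> half_cont F' ->
  gsum L N F' @[N --> \oo] --> F L - F 0.
Proof.
move=> L0 dF cF; apply/cvgrPdist_le => e e0.
have eL : 0 < e / 2 / L by rewrite !divr_gt0.
have [|t t0|d d0 hd] := @half_uniform R (fun s r => `|F' s - F' r|) L (e / 2 / L) _ _ eL.
- by move=> s r t; rewrite (distrC (F' t) (F' s)); apply: ler_distD.
- have : `|F' t - F' s| @[s --> half_nbhs t] --> `|F' t - F' t|.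
    by apply: cvg_norm; apply: cvgB; [exact: cvg_cst | exact: cF].
  by rewrite subrr normr0.
(* The mesh must meet two demands: uniform continuity of F' within a cell, and a small contribution
   of the node 0, which [gsum] omits from the left-endpoint sum. *)
pose q := Num.min (d / L) (e / 2 / L / (`|F' 0| + 1)).
have F01 : 0 < `|F' 0| + 1 by rewrite ltr_wpDl.
have q0 : 0 < q by rewrite lt_min !divr_gt0.
have [N0 hN0] := inv_natS_lt q0; exists N0 => // N NN0.
have := hN0 N NN0; set u := N.+1%:R^-1; rewrite lt_min => /andP[uq1 uq2].
have N10 : (N.+1%:R : R) != 0 by rewrite pnatr_eq0.
have u0 : 0 < u by rewrite invr_gt0 ltr0n.
pose dl := L / N.+1%:R.
have dl0 : 0 < dl by rewrite mulr_gt0.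
have dld : dl < d by rewrite /dl -/u mulrC -ltr_pdivlMr.
have dlF : dl * `|F' 0| <= e / 2.
  have h : u * (L * (`|F' 0| + 1)) < e / 2.
    by move: uq2; rewrite ltr_pdivlMr// ltr_pdivlMr// -mulrA (mulrC _ L).
  have := mulr_ge0 (ltW u0) (ltW L0); rewrite /dl -/u; lra.
have NL : N.+1%:R * dl = L by rewrite /dl mulrCA mulfV// mulr1.
have tele : F L - F 0 = \sum_(j < N.+1) (F (j.+1%:R * dl) - F (j%:R * dl)).
  have := telescope_sumr (fun j => F (j%:R * dl)) (leq0n N.+1).
  by rewrite NL mul0r big_mkord => <-.
have -> : gsum L N F' = \sum_(j < N.+1) dl * F' (j%:R * dl) - dl * F' 0.
  by rewrite /gsum -/dl big_ord_recl mul0r mulr_sumr [RHS]addrAC subrr add0r.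
rewrite opprB addrCA tele -sumrB.
apply: (le_trans (ler_normD _ _)); rewrite normrM (ger0_norm (ltW dl0)).
have -> : e = e / 2 + e / 2 by lra.
rewrite lerD//; apply: (le_trans (ler_norm_sum _ _ _)).
apply: (@le_trans _ _ (\sum_(j < N.+1) dl * (e / 2 / L))); last first.
  rewrite sumr_const card_ord -[_ *+ N.+1]mulr_natl mulrA NL mulrCA mulfV ?mulr1//.
  by rewrite gt_eqF.
apply: ler_sum => j _.
have jj : j%:R * dl < j.+1%:R * dl by rewrite ltr_pM2r// ltr_nat.
have j0 : 0 <= j%:R * dl by rewrite mulr_ge0// ltW.
have [c /andP[c1 c2] ->] := half_MVT dF j0 jj.
have E : j.+1%:R * dl - j%:R * dl = dl by rewrite -mulrBl -natrB// subSnn mul1r.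
have jL : j.+1%:R * dl <= L by rewrite -NL ler_pM2r// ler_nat.
rewrite E mulrC -mulrBr normrM (ger0_norm (ltW dl0)) ler_wpM2l ?(ltW dl0)//.
apply: ltW; apply: hd.
- by apply/andP; split; lra.
- by apply/andP; split; lra.
- by rewrite ltr_norml; apply/andP; split; lra.
Qed.

End GridSums.

Section SecondDifference.
Context {R : realType} {H Y : completeNormedModType R[i]}.
Variables (dotH : {dot H for @conjc R}) (dotY : {dot Y for @conjc R}).
Hypotheses (HdotH : hilbert dotH) (HdotY : hilbert dotY).
Local Notation n := (@rnorm R H).

Lemma second_difference (L e : R) (W W1 W2 : R -> H) :
  vderiv W W1 -> vderiv W1 W2 -> vcont W2 -> 0 < e ->
  exists2 d : R, 0 < d & forall dl s, 0 < dl -> dl < d -> 0 <= s - dl -> s + dl <= L ->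
    n (dl^-1%:C *: (dl^-1%:C *: (W (s + dl) + W (s - dl) - 2%:C *: W s)) - W2 s) <= e.
Proof.
move=> dW dW1 cW2 e0.
have e2 : 0 < e / 2 by lra.
have [|t t0|d d0 hd] := @half_uniform R (fun s r => n (W2 s - W2 r)) L (e / 2) _ _ e2.
- by move=> s r t; rewrite (rnormBC (W2 t) (W2 s)); apply: ler_rnormDB.
- have := cW2 _ t0; under eq_fun do rewrite rnormBC; exact.
exists d => // dl s dl0 dld s0 sL.
pose sg r := W1 r - (r%:C *: W2 s).
have dsg : vderiv sg (fun r => W2 r - W2 s).
  apply: vderivB => //; apply: vderiv_ext (vderiv_smul _ half_deriv_id) _ => r _.
  by rewrite scale1r.
(* W minus its second order Taylor polynomial at s, up to a constant. Its derivative [sg r - sg s]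
   is at most (e / 2) dl near s, so each of the two increments is at most (e / 2) dl^2. *)
pose rho r := W r - r%:C *: (W1 s - s%:C *: W2 s) - (2^-1 * (r * r))%:C *: W2 s.
have drho : vderiv rho (fun r => sg r - sg s).
  have h1 := vderiv_smul (W1 s - s%:C *: W2 s) half_deriv_id.
  have h2 := vderiv_smul (W2 s) (@half_derivZ R 2^-1 _ _ (half_derivM half_deriv_id half_deriv_id)).
  apply: vderiv_ext (vderivB (vderivB dW h1) h2) _ => r _.
  by apply: (inner_ext HdotH) => w; rewrite /sg !(innerDl, innerNl, innerZl); field.
have sgle r : s - dl <= r -> r <= s + dl -> n (sg r - sg s) <= e / 2 * dl.
  move=> r1 r2; have [rs|sr] := leP r s.
    have lip := vderiv_lipschitz HdotH dsg (a := r) (b := s) (M := e / 2).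
    rewrite rnormBC; apply: le_trans (lip _ rs _) _; first lra.
    - move=> q /andP[q1 q2]; apply: ltW; apply: hd; try (by apply/andP; split; lra).
      by rewrite ltr_norml; apply/andP; split; lra.
    - rewrite ler_wpM2l//; lra.
  have lip := vderiv_lipschitz HdotH dsg (a := s) (b := r) (M := e / 2).
  apply: le_trans (lip _ (ltW sr) _) _; first lra.
  - move=> q /andP[q1 q2]; apply: ltW; apply: hd; try (by apply/andP; split; lra).
    by rewrite ltr_norml; apply/andP; split; lra.
  - rewrite ler_wpM2l//; lra.
have r1 : n (rho (s + dl) - rho s) <= e / 2 * dl * dl.
  have := vderiv_lipschitz HdotH drho (a := s) (b := s + dl) (M := e / 2 * dl).
  rewrite (_ : s + dl - s = dl); last by ring.
  apply; [lra|lra|].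
  by move=> q /andP[q1 q2]; apply: sgle; lra.
have r2 : n (rho s - rho (s - dl)) <= e / 2 * dl * dl.
  have := vderiv_lipschitz HdotH drho (a := s - dl) (b := s) (M := e / 2 * dl).
  rewrite (_ : s - (s - dl) = dl); last by ring.
  apply; [lra|lra|].
  by move=> q /andP[q1 q2]; apply: sgle; lra.
have -> : dl^-1%:C *: (dl^-1%:C *: (W (s + dl) + W (s - dl) - 2%:C *: W s)) - W2 s =
    (dl^-1 * dl^-1)%:C *: ((rho (s + dl) - rho s) - (rho s - rho (s - dl))).
  apply: (inner_ext HdotH) => w; rewrite /rho !(innerDl, innerNl, innerZl).
  by field; rewrite gt_eqF.
have di : 0 < dl^-1 * dl^-1 by rewrite mulr_gt0 ?invr_gt0.
rewrite rnormZ (ger0_norm (ltW di)).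
have := ler_rnormB (rho (s + dl) - rho s) (rho s - rho (s - dl)) => h.
rewrite -(ler_pM2l (mulr_gt0 dl0 dl0)) mulrA.
have -> : dl * dl * (dl^-1 * dl^-1) = 1 by field; rewrite gt_eqF.
lra.
Qed.

Variables (A : operator H) (Bs : {linear H -> Y}) (C : R).
Hypotheses (Alin : linear_operator A) (C0 : 0 <= C).
Hypothesis hautusC : forall (mu : R) x, dom A x ->
  rnorm x <= C * (rnorm (A x - mu%:C *: x) + rnorm (Bs x)).

(* W vanishes at 0 and L, so on the interior grid points W'' is approximated by the symmetric
   Dirichlet second difference matrix, to which [hautus_matrix] applies. *)
Lemma dirichlet_inequality (L e : R) (W W1 W2 : R -> H) : 0 < L -> 0 < e ->
  vderiv W W1 -> vderiv W1 W2 -> vcont W2 ->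
  (forall t, 0 <= t -> dom A (W t)) -> W 0 = 0 -> W L = 0 ->
  exists N0, forall N, (N0 <= N)%N ->
    gsum L N (fun s => n (W s) ^+ 2) <=
    2 * C ^+ 2 * gsum L N (fun s => 2 * n (A (W s) + W2 s) ^+ 2 + rnorm (Bs (W s)) ^+ 2) + e.
Proof.
move=> L0 e0 dW dW1 cW2 domW W0 WL.
have c40 : 0 < 4 * C ^+ 2 * L + 1.
  by have := mulr_ge0 (sqr_ge0 C) (ltW L0); lra.
(* The consistency error enters as 2 C^2 times L times 2 eta^2, which this choice keeps below e. *)
pose eta := Num.sqrt (e / (4 * C ^+ 2 * L + 1)).
have eta0 : 0 < eta by rewrite sqrtr_gt0 divr_gt0.
have eta2 : eta ^+ 2 * (4 * C ^+ 2 * L + 1) = e.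
  by rewrite sqr_sqrtr ?divfK// ?gt_eqF// divr_ge0// ltW.
have [d d0 hd] := second_difference L dW dW1 cW2 eta0.
have [N0 hN0] := inv_natS_lt (divr_gt0 d0 L0); exists N0 => N NN0.
have := hN0 N NN0; rewrite ltr_pdivlMr// => hdl.
pose dl := L / N.+1%:R.
have N10 : (N.+1%:R : R) != 0 by rewrite pnatr_eq0.
have dl0 : 0 < dl by rewrite divr_gt0.
have dld : dl < d by rewrite /dl mulrC.
have NL : N.+1%:R * dl = L by rewrite /dl mulrCA mulfV// mulr1.
pose w (j : 'I_N) := W (j.+1%:R * dl).
(* Index j stands for the node (j + 1) dl. In the first and last rows one neighbour matches no l,
   which is the Dirichlet condition. *)
pose D : 'M[R]_N := \matrix_(j, l) (dl^-1 * (dl^-1 *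
  (2 * (l.+1 == j.+1)%:R - (l.+1 == j.+2)%:R - (l.+1 == j)%:R))).
have Dsym : D^T = D.
  apply/matrixP => j l; rewrite !mxE !eqSS (eq_sym (j : nat) l) (eq_sym (j : nat) l.+1).
  by rewrite (eq_sym j.+1 l); congr (_ * (_ * _)); ring.
have dw j : dom A (w j) by apply: domW; rewrite mulr_ge0// ltW.
(* At m = 0 and m = N + 1 the sum is empty of matches, and W vanishes there. *)
have pick m : (m <= N.+1)%N ->
    \sum_(l < N) ((l.+1 == m)%:R : R)%:C *: w l = W (m%:R * dl).
  case: m => [|m] mN.
    by rewrite mul0r W0 big1// => l _; rewrite scale0r.
  move: mN; rewrite ltnS leq_eqVlt => /orP[/eqP ->|mN].
    rewrite NL WL big1// => l _; rewrite eqSS (ltn_eqF (ltn_ord l)); exact: scale0r.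
  rewrite (bigD1 (Ordinal mN))//= eqxx scale1r big1 ?addr0// => l lm.
  rewrite eqSS; suff /negbTE -> : (l : nat) != m by exact: scale0r.
  by apply: contra lm => /eqP lm; apply/eqP/val_inj.
have Dw j : \sum_l (D j l)%:C *: w l = - (dl^-1%:C *: (dl^-1%:C *:
    (W (j.+1%:R * dl + dl) + W (j.+1%:R * dl - dl) - 2%:C *: W (j.+1%:R * dl)))).
  transitivity (dl^-1%:C *: (dl^-1%:C *: (2%:C *: (\sum_(l < N) ((l.+1 == j.+1)%:R : R)%:C *: w l) -
      (\sum_(l < N) ((l.+1 == j.+2)%:R : R)%:C *: w l) - (\sum_(l < N) ((l.+1 == j)%:R : R)%:C *: w l)))).
    rewrite scaler_sumr -!sumrB !scaler_sumr; apply: eq_bigr => l _.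
    apply: (inner_ext HdotH) => x; rewrite !mxE !(innerDl, innerNl, innerZl); ring.
  have jN := ltn_ord j.
  rewrite (pick j.+1 (ltnW jN)) (pick j.+2 jN) (pick j (leqW (ltnW jN))).
  have -> : j.+2%:R * dl = j.+1%:R * dl + dl by rewrite -natr1 mulrDl mul1r.
  have -> : j%:R * dl = j.+1%:R * dl - dl by rewrite -natr1 mulrDl mul1r addrK.
  by apply: (inner_ext HdotH) => x; rewrite !(innerDl, innerNl, innerZl); ring.
have := hautus_matrix HdotH HdotY Alin C0 hautusC Dsym dw => h.
have {}h := ler_wpM2l (ltW dl0) h.
rewrite /gsum -/dl; apply: (le_trans h).
rewrite mulrCA -[X in _ <= _ + X]eta2.
have bnd : dl * \sum_j (rnorm (A (w j) - \sum_l (D j l)%:C *: w l) ^+ 2 + rnorm (Bs (w j)) ^+ 2)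
  <= dl * \sum_(j < N) (2 * n (A (W (j.+1%:R * dl)) + W2 (j.+1%:R * dl)) ^+ 2 +
       rnorm (Bs (W (j.+1%:R * dl))) ^+ 2) + L * (2 * eta ^+ 2).
  apply: (@le_trans _ _ (dl * \sum_(j < N) ((2 * n (A (W (j.+1%:R * dl)) + W2 (j.+1%:R * dl)) ^+ 2 +
       rnorm (Bs (W (j.+1%:R * dl))) ^+ 2) + 2 * eta ^+ 2))); last first.
    rewrite big_split mulrDr lerD2l.
    by apply: (@gsum_cst_le R L N (2 * eta ^+ 2) (ltW L0)); rewrite mulr_ge0// sqr_ge0.
  rewrite ler_wpM2l ?(ltW dl0)//; apply: ler_sum => j _.
  rewrite addrAC lerD2r Dw opprK.
  set z := _ *: _.
  have -> : A (w j) + z = (A (w j) + W2 (j.+1%:R * dl)) + (z - W2 (j.+1%:R * dl)).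
    by apply: (inner_ext HdotH) => x; rewrite !(innerDl, innerNl); ring.
  apply: (le_trans (rnormD_sqr_le HdotH _ _)); rewrite lerD2l ler_wpM2l//.
  rewrite ler_pXn2r ?nnegrE ?rnorm_ge0 ?(ltW eta0)//; apply: hd => //.
  - by rewrite -natr1 mulrDl mul1r addrK mulr_ge0// ltW.
  - rewrite -[X in _ + X]mul1r -mulrDl natr1 -NL ler_pM2r// ler_nat ltnS.
    exact: ltn_ord.
have := ler_wpM2l (mulr_ge0 (ler0n R 2) (sqr_ge0 C)) bnd.
have := sqr_ge0 eta; move: (dl * _) (dl * _) (eta ^+ 2) (C ^+ 2) => X1 X2 e1 c1; lra.
Qed.

End SecondDifference.

Section ScalarTimesVector.
Context {R : realType} {V : normedModType R[i]}.
Local Notation n := (@rnorm R V).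
Implicit Types (f : R -> R) (g : R -> V).

Lemma half_cont_rnorm_sqr g : vcont g -> half_cont (fun s => n (g s) ^+ 2).
Proof.
move=> hg t t0; rewrite expr2; under eq_fun do rewrite expr2.
by apply: cvgM; apply: rnorm_cvg; apply: hg.
Qed.

Lemma vcont_scale f g : half_cont f -> vcont g -> vcont (fun s => (f s)%:C *: g s).
Proof.
move=> hf hg t t0.
apply: (@cvg0_le _ _ _ _ (fun s => `|f s| * n (g s - g t) + `|f s - f t| * n (g t))).
  move=> s; rewrite rnorm_ge0 /= -!rnormZ.
  rewrite (_ : _ - _ = (f s)%:C *: (g s - g t) + (f s - f t)%:C *: g t) ?ler_rnormD//.
  by rewrite scalerBr rmorphB /= scalerBl addrA subrK.
rewrite [X in _ --> X](_ : 0 = `|f t| * 0 + `|f t - f t| * n (g t) :> R); last first.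
  by rewrite subrr normr0 mulr0 mul0r addr0.
apply: cvgD; apply: cvgM; [by apply: cvg_norm; exact: hf|exact: hg| |exact: cvg_cst].
by apply: cvg_norm; apply: cvgB; [exact: hf | exact: cvg_cst].
Qed.

End ScalarTimesVector.

Section Equipartition.
Context {R : realType} {H Y : completeNormedModType R[i]}.
Variables (dotH : {dot H for @conjc R}) (dotY : {dot Y for @conjc R}).
Hypotheses (HdotH : hilbert dotH) (HdotY : hilbert dotY).
Local Notation ip := (inner dotH).
Local Notation n := (@rnorm R H).

Lemma vderiv_scale (f f' : R -> R) (g g' : R -> H) : half_deriv f f' -> vderiv g g' ->
  vderiv (fun s => (f s)%:C *: g s) (fun s => (f' s)%:C *: g s + (f s)%:C *: g' s).
Proof.
move=> hf hg t t0.
have fc := cvg_half_dnbhs (half_deriv_cont hf t0).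
pose q s := ((s - t)^-1)%:C *: (g s - g t).
apply: (@cvg0_le _ _ _ _ (fun s => `|(f s - f t) / (s - t) - f' t| * n (g t) +
   `|f s - f t| * n (g' t) + `|f s| * n (q s - g' t))).
  move=> s; rewrite rnorm_ge0 /= -!rnormZ.
  rewrite (_ : _ - _ = ((f s - f t) / (s - t) - f' t)%:C *: g t +
    (f s - f t)%:C *: g' t + (f s)%:C *: (q s - g' t)); last first.
    by apply: (inner_ext HdotH) => w; rewrite /q !(innerDl, innerNl, innerZl); ring.
  by apply: (le_trans (ler_rnormD _ _)); rewrite lerD2r ler_rnormD.
rewrite [X in _ --> X](_ : 0 = `|f' t - f' t| * n (g t) + `|f t - f t| * n (g' t) + `|f t| * 0 :> R); last first.
  by rewrite !subrr normr0 mulr0 !mul0r !addr0.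
apply: cvgD; last by apply: cvgM; [apply: cvg_norm; exact: fc | exact: hg].
apply: cvgD; apply: cvgM; try exact: cvg_cst; apply: cvg_norm.
- by apply: cvgB; [exact: hf | exact: cvg_cst].
- by apply: cvgB; [exact: fc | exact: cvg_cst].
Qed.

Variables (A S : operator H) (B : {linear Y -> H}) (Bs : {linear H -> Y}).
Hypotheses (Asa : selfadjoint dotH A) (SA : is_sqrt dotH A S).
Hypothesis Badj : forall (y : Y) (x : H), dotH (B y) x = dotY y (Bs x).
Let Alin : linear_operator A. Proof. exact: sa_linear Asa. Qed.
Let Slin : linear_operator S. Proof. by case: SA => /sa_linear. Qed.

Section KernelProjector.
Variable P : H -> H.
Hypothesis hP : kernel_projector dotH A P.

Lemma kernel_projector_uniq x p : in_kernel A p ->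
  (forall z, in_kernel A z -> ip (x - p) z = 0) -> P x = p.
Proof.
move=> kp hp; have [kP oP] := hP x.
have k := subspaceB (kernel_subspace Asa) kP kp.
apply/eqP; rewrite -subr_eq0; apply/eqP/rnorm_eq0/eqP; rewrite -sqrf_eq0 -(inner_rnorm HdotH).
have := oP _ k; have := hp _ k; rewrite !(innerDl, innerNl) => h1 h2.
apply/eqP; move: h1 h2; rewrite !innerDr !innerNr; lra.
Qed.

Lemma kernel_projectorB x y : P (x - y) = P x - P y.
Proof.
have [kx ox] := hP x; have [ky oy] := hP y.
apply: kernel_projector_uniq; first exact: (subspaceB (kernel_subspace Asa)).
move=> z kz; rewrite (_ : _ - _ = (x - P x) - (y - P y)).
  by rewrite innerDl innerNl ox// oy// subr0.
by apply: (inner_ext HdotH) => w; rewrite !(innerDl, innerNl); ring.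
Qed.

Lemma kernel_projectorZ (r : R) x : P (r%:C *: x) = r%:C *: P x.
Proof.
have [kx ox] := hP x; have [_ _ kZ] := kernel_subspace Asa.
apply: kernel_projector_uniq; first exact: kZ.
by move=> z kz; rewrite -scalerBr innerZl ox// mulr0.
Qed.

Lemma kernel_projector_le x : n (x - P x) <= n x.
Proof.
have [kx ox] := hP x.
rewrite -(ler_pXn2r (n := 2)) ?nnegrE ?rnorm_ge0//.
have -> : n x ^+ 2 = n ((x - P x) + P x) ^+ 2 by rewrite subrK.
by rewrite (rnormD_sqr HdotH (x - P x)) (ox _ kx) mulr0 addr0 lerDl sqr_ge0.
Qed.

End KernelProjector.

Variables (P : H -> H) (C c bB b : R).
Hypotheses (hP : kernel_projector dotH A P).
Hypotheses (C0 : 0 <= C) (c0 : 0 <= c) (bB0 : 0 <= bB) (b0 : 0 <= b).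
Hypothesis hautusC : forall (mu : R) x, dom A x ->
  rnorm x <= C * (rnorm (A x - mu%:C *: x) + rnorm (Bs x)).
Hypothesis poincareC : forall x, dom S x ->
  (forall z, in_kernel A z -> ip x z = 0) -> n x <= c * n (S x).
Hypothesis bBP : forall y, n (B y) <= bB * rnorm y.
Hypothesis bP : forall x, rnorm (Bs x) <= b * n x.
Local Notation strong := (strong_pair A S B Bs).
Local Notation e2 := (energy2 S).

Lemma kernel_complement_le x : dom S x -> n (x - P x) <= c * n (S x).
Proof.
move=> dx; have [kp op] := hP x; have dP := sqrt_dom SA kp.1.
have := poincareC (domB Slin dx dP) op.
by rewrite (opB Slin)// (sqrt_kernel HdotH SA kp) subr0.
Qed.

(* Multiply the equation by the component of [y] orthogonal to the kernel of A. *)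
Lemma equipartition y z : strong y z -> exists g g' : R -> R,
  [/\ half_deriv g g',
      (vcont (fun t => - A (y t) - B (Bs (z t))) -> half_cont g'),
      forall t, 0 <= t -> `|g t| <= c / 2 * e2 y z t &
      forall t, 0 <= t -> n (S (y t)) ^+ 2 <=
        2 * n (z t) ^+ 2 - 2 * g' t + c ^+ 2 * bB ^+ 2 * rnorm (Bs (z t)) ^+ 2].
Proof.
move=> hs; have [hdom dy dSy dz] := hs.
pose Q x := x - P x.
have QB x x' : Q (x - x') = Q x - Q x'.
  rewrite /Q (kernel_projectorB hP).
  by apply: (inner_ext HdotH) => w; rewrite !(innerDl, innerNl); ring.
have QZ (r : R) x : Q (r%:C *: x) = r%:C *: Q x.
  by rewrite /Q (kernel_projectorZ hP) scalerBr.
have Qle x : n (Q x) <= 1 * n x by rewrite mul1r; apply: kernel_projector_le.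
have dQ := vderiv_lin QB QZ Qle dy.
(* Without the projection Q the product would involve |y|, which the energy does not control on the
   kernel of A. *)
exists (fun t => ip (Q (y t)) (z t)).
exists (fun t => ip (Q (z t)) (z t) + ip (Q (y t)) (- A (y t) - B (Bs (z t)))).
have Qy t : 0 <= t -> n (Q (y t)) <= c * n (S (y t)).
  by move=> t0; apply: kernel_complement_le; apply: (strong_dom_S SA hs).
split.
- exact: half_deriv_inner.
- move=> cz2 t t0; apply: cvgD.
    by apply: (half_cont_inner HdotH (vcont_lin QB Qle (vderiv_cont dz)) (vderiv_cont dz)).
  exact: (half_cont_inner HdotH (vderiv_cont dQ) cz2).
- move=> t t0; apply: (le_trans (inner_abs HdotH _ _)); rewrite /energy2.
  apply: (@le_trans _ _ (c * n (S (y t)) * n (z t))).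
    by rewrite ler_wpM2r ?rnorm_ge0 ?Qy.
  have := mulr_ge0 c0 (sqr_ge0 (n (S (y t)) - n (z t))).
  move: (n (S (y t))) (n (z t)) => u v; lra.
- move=> t t0; have [dA dS] := hdom _ t0; have [kp op] := hP (y t).
  have h1 : ip (Q (z t)) (z t) <= n (z t) ^+ 2.
    apply: (le_trans (inner_le HdotH _ _)); rewrite expr2 ler_wpM2r ?rnorm_ge0//.
    exact: kernel_projector_le.
  have h2 : ip (Q (y t)) (A (y t)) = n (S (y t)) ^+ 2.
    rewrite /Q innerDl innerNl -(sa_sym Asa kp.1 dA) kp.2 inner0l subr0.
    by rewrite innerC (sqrt_rnorm HdotH SA dA).
  have h3 : - ip (Q (y t)) (B (Bs (z t))) <= c * n (S (y t)) * (bB * rnorm (Bs (z t))).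
    rewrite -innerNr; apply: (le_trans (inner_le HdotH _ _)); rewrite rnormN.
    by apply: ler_pM; rewrite ?rnorm_ge0 ?Qy.
  rewrite !(innerDr, innerNr) h2.
  (* Young's inequality absorbs half of |S y|^2; multiplying by 2 then produces the factors in front
     of |z|^2 and g'. *)
  have := sqr_ge0 (n (S (y t)) - c * (bB * rnorm (Bs (z t)))).
  move: h1 h3; move: (ip (Q (z t)) (z t)) (ip (Q (y t)) (B (Bs (z t)))) => v1 v2.
  move: (n (S (y t))) (n (z t)) (rnorm (Bs (z t))) => v3 v4 v5; lra.
Qed.

End Equipartition.

Section Cutoff.
Context {R : realType}.

Lemma half_contM (f g : R -> R) : half_cont f -> half_cont g -> half_cont (fun s => f s * g s).
Proof. by move=> hf hg t t0; apply: cvgM; [exact: hf | exact: hg]. Qed.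

Lemma half_contD (f g : R -> R) : half_cont f -> half_cont g -> half_cont (fun s => f s + g s).
Proof. by move=> hf hg t t0; apply: cvgD; [exact: hf | exact: hg]. Qed.

Lemma half_cont_cst (k : R) : half_cont (fun=> k).
Proof. by move=> t t0; apply: cvg_cst. Qed.

Definition cutoff (L s : R) := L^-1 ^+ 2 * (s * (L - s)).

Definition cutoff1 (L s : R) := L^-1 ^+ 2 * (L - 2 * s).

Lemma cutoff_deriv L : half_deriv (cutoff L) (cutoff1 L).
Proof.
have h := half_derivM half_deriv_id (half_derivB (half_deriv_cst L) half_deriv_id).
apply: half_deriv_ext (@half_derivZ R (L^-1 ^+ 2) _ _ h) _ => t _.
by rewrite /cutoff1; ring.
Qed.

Lemma cutoff1_deriv L : half_deriv (cutoff1 L) (fun=> - 2 * L^-1 ^+ 2).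
Proof.
have h := half_derivB (half_deriv_cst L) (@half_derivZ R 2 _ _ half_deriv_id).
apply: half_deriv_ext (@half_derivZ R (L^-1 ^+ 2) _ _ h) _ => t _.
by ring.
Qed.

(** In the variable s / L the cutoff is x (1 - x), so each derivative gains a factor 1 / L. *)
Lemma cutoff_bounds L s : 0 < L -> 0 <= s <= L ->
  cutoff L s ^+ 2 <= 1 /\ `|cutoff L s * cutoff1 L s| <= L^-1 /\ cutoff1 L s ^+ 2 <= L^-1 ^+ 2.
Proof.
move=> L0 /andP[s0 sL].
have Li : 0 < L^-1 by rewrite invr_gt0.
pose x := s / L.
have x0 : 0 <= x by rewrite divr_ge0// ltW.
have x1 : x <= 1 by rewrite ler_pdivrMr// mul1r.
have -> : cutoff L s = x * (1 - x) by rewrite /cutoff /x; field; rewrite gt_eqF.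
have -> : cutoff1 L s = L^-1 * (1 - 2 * x) by rewrite /cutoff1 /x; field; rewrite gt_eqF.
have a0 : 0 <= x * (1 - x) by rewrite mulr_ge0// subr_ge0.
have a1 : x * (1 - x) <= 1 by nra.
have b1 : `|1 - 2 * x| <= 1 by rewrite ler_norml; apply/andP; split; lra.
split; first by rewrite expr_le1.
split.
  rewrite mulrCA normrM (ger0_norm (ltW Li)) ler_piMr ?(ltW Li)//.
  by rewrite normrM (ger0_norm a0) mulr_ile1.
rewrite exprMn ler_piMr ?sqr_ge0//.
by rewrite -real_normK ?num_real// expr_le1.
Qed.

(** The limit is the integral of the squared cutoff, with 1/3 - 1/2 + 1/5 = 1/30 from its polynomial
    antiderivative. *)
Lemma gsum_cutoff L : 0 < L ->
  gsum L N (fun s => cutoff L s ^+ 2) @[N --> \oo] --> L / 30.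
Proof.
move=> L0.
have s1 := @half_deriv_id R.
have s2 := half_derivM s1 s1; have s3 := half_derivM s2 s1.
have s4 := half_derivM s3 s1; have s5 := half_derivM s4 s1.
have h := @half_derivZ R (L^-1 ^+ 4) _ _ (half_derivD (half_derivB (@half_derivZ R (L ^+ 2 / 3) _ _ s3)
   (@half_derivZ R (L / 2) _ _ s4)) (@half_derivZ R 5^-1 _ _ s5)).
have {}h := half_deriv_ext h (g' := fun s => cutoff L s ^+ 2) _.
have {}h := h (fun t _ => ltac:(by rewrite /cutoff; field; rewrite gt_eqF)).
have cc : half_cont (fun s => cutoff L s ^+ 2).
  have hc := half_deriv_cont (@cutoff_deriv L).
  exact: (half_contM hc hc).
have := gsum_cvg L0 h cc; rewrite !mulr0 subr0 addr0 mulr0 subr0.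
rewrite (_ : L^-1 ^+ 4 * _ = L / 30)//.
by field; rewrite gt_eqF.
Qed.

End Cutoff.

(** * The weighted energy estimate for regularised solutions *)

Section MainEstimate.
Context {R : realType} {H Y : completeNormedModType R[i]}.
Variables (dotH : {dot H for @conjc R}) (dotY : {dot Y for @conjc R}).
Hypotheses (HdotH : hilbert dotH) (HdotY : hilbert dotY).
Local Notation ip := (inner dotH).
Local Notation n := (@rnorm R H).
Variables (A S : operator H) (B : {linear Y -> H}) (Bs : {linear H -> Y}).
Hypotheses (Asa : selfadjoint dotH A) (SA : is_sqrt dotH A S).
Hypothesis Badj : forall (y : Y) (x : H), dotH (B y) x = dotY y (Bs x).
Let Alin : linear_operator A. Proof. exact: sa_linear Asa. Qed.
Let Slin : linear_operator S. Proof. by case: SA => /sa_linear. Qed.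
Variables (P : H -> H) (C c bB b : R).
Hypotheses (hP : kernel_projector dotH A P).
Hypotheses (C0 : 0 <= C) (c0 : 0 <= c) (bB0 : 0 <= bB) (b0 : 0 <= b).
Hypothesis hautusC : forall (mu : R) x, dom A x ->
  rnorm x <= C * (rnorm (A x - mu%:C *: x) + rnorm (Bs x)).
Hypothesis poincareC : forall x, dom S x ->
  (forall z, in_kernel A z -> ip x z = 0) -> n x <= c * n (S x).
Hypothesis bBP : forall y, n (B y) <= bB * rnorm y.
Hypothesis bP : forall x, rnorm (Bs x) <= b * n x.
Local Notation strong := (strong_pair A S B Bs).
Local Notation e2 := (energy2 S).

Lemma gsum_dissipation y z L : 0 < L -> strong y z ->
  gsum L N (fun s => rnorm (Bs (z s)) ^+ 2) @[N --> \oo] --> (e2 y z 0 - e2 y z L) / 2.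
Proof.
move=> L0 hs; have [_ _ _ dz] := hs.
have h := @half_derivZ R (- 2^-1) _ _ (energy2_deriv HdotH HdotY SA Badj hs).
have {}h := half_deriv_ext h (g' := fun s => rnorm (Bs (z s)) ^+ 2)
  (fun t _ => ltac:(by field)).
have cB : half_cont (fun s => rnorm (Bs (z s)) ^+ 2).
  by apply: half_cont_rnorm_sqr; apply: (vcont_lin (linearB Bs) bP); apply: vderiv_cont dz.
have := gsum_cvg L0 h cB.
by rewrite (_ : - 2^-1 * _ - _ = (e2 y z 0 - e2 y z L) / 2)//; field.
Qed.

(** (p, q) is a second solution with p within r of z. In the application r tends to 0, and m is a
    multiple of the seminorm of the generator applied to the data. *)
Variables (y z p q : R -> H) (L m r : R).
Hypotheses (yz : strong y z) (pq : strong p q).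
Hypothesis cz : vcont (fun t => - A (y t) - B (Bs (z t))).
Hypothesis cq : vcont (fun t => - A (p t) - B (Bs (q t))).
Hypotheses (L1 : 1 <= L) (m0 : 0 <= m) (r0 : 0 <= r).
Hypothesis pz : forall t, 0 <= t -> n (p t - z t) <= r.
Hypothesis qm : forall t, 0 <= t -> n (q t) <= m.
Hypothesis epq : e2 p q 0 <= m ^+ 2.
Let L0 : 0 < L. Proof. exact: lt_le_trans L1. Qed.
Let Li0 : 0 < L^-1. Proof. by rewrite invr_gt0. Qed.
Let Li1 : L^-1 <= 1. Proof. by rewrite invf_le1. Qed.
Let e0 := e2 y z 0.

Let W t := (cutoff L t)%:C *: p t.
Let W1 t := (cutoff1 L t)%:C *: p t + (cutoff L t)%:C *: q t.
Let p2 t := - A (p t) - B (Bs (q t)).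
Let W2 t := ((- 2 * L^-1 ^+ 2)%:C *: p t + (cutoff1 L t)%:C *: q t) +
   ((cutoff1 L t)%:C *: q t + (cutoff L t)%:C *: p2 t).

Let dW : vderiv W W1.
Proof. by have [_ dp _ _] := pq; apply: (vderiv_scale HdotH (@cutoff_deriv R L) dp). Qed.

Let dW1 : vderiv W1 W2.
Proof.
have [_ dp _ dq] := pq; apply: vderivD.
  exact: (vderiv_scale HdotH (@cutoff1_deriv R L) dp).
exact: (vderiv_scale HdotH (@cutoff_deriv R L) dq).
Qed.

Let cW2 : vcont W2.
Proof.
have [_ dp _ dq] := pq; have cp := vderiv_cont dp; have cqq := vderiv_cont dq.
have k1 := half_deriv_cont (@cutoff_deriv R L).
have k2 := half_deriv_cont (@cutoff1_deriv R L).
apply: vcontD; apply: vcontD.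
- exact: (vcont_scale (@half_cont_cst R _) cp).
- exact: (vcont_scale k2 cqq).
- exact: (vcont_scale k2 cqq).
- exact: (vcont_scale k1 cq).
Qed.

Let e2_le t : 0 <= t -> e2 y z t <= e0.
Proof. by move=> t0; apply: (energy2_noninc HdotH HdotY SA Badj yz). Qed.

Let z_le t : 0 <= t -> n (z t) ^+ 2 <= e0.
Proof. by move=> t0; apply: le_trans (e2_le t0); rewrite lerDr sqr_ge0. Qed.

Let pz_sqr t : 0 <= t -> n (p t) ^+ 2 <= 2 * n (z t) ^+ 2 + 2 * r ^+ 2.
Proof.
move=> t0; have := rnormD_sqr_le HdotH (z t) (p t - z t); rewrite subrKC => h.
have : n (p t - z t) ^+ 2 <= r ^+ 2 by rewrite ler_pXn2r ?nnegrE ?rnorm_ge0// pz.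
lra.
Qed.

Let zp_sqr t : 0 <= t -> n (z t) ^+ 2 <= 2 * n (p t) ^+ 2 + 2 * r ^+ 2.
Proof.
move=> t0; have := rnormD_sqr_le HdotH (p t) (z t - p t); rewrite subrKC rnormBC => h.
have : n (p t - z t) ^+ 2 <= r ^+ 2 by rewrite ler_pXn2r ?nnegrE ?rnorm_ge0// pz.
lra.
Qed.

Let K0 := 32 * e0 + 32 * r ^+ 2 + 32 * m ^+ 2 + 2 * b ^+ 2 * r ^+ 2 * L.

(** In A W + W'' the equation for p leaves only the damping of q; every other term has a derivative
    of the cutoff, and 1 <= L reduces all its powers to 1 / L. Summed over [0, L], K0 / L costs at
    most K0. *)
Let source_le s : 0 <= s <= L ->
  2 * n (A (W s) + W2 s) ^+ 2 + rnorm (Bs (W s)) ^+ 2 <=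
  K0 * L^-1 + (8 * bB ^+ 2 * rnorm (Bs (q s)) ^+ 2 + 2 * rnorm (Bs (z s)) ^+ 2).
Proof.
move=> sL; have /andP[s0 _] := sL.
have [dA dS] : dom A (p s) /\ dom S (q s) by case: pq => hd _ _ _; apply: hd.
have [k1 [_ k3]] := cutoff_bounds L0 sL.
set x := cutoff L s in k1; set x1 := cutoff1 L s in k3.
have E : A (W s) + W2 s = (- 2 * L^-1 ^+ 2)%:C *: p s + ((2 * x1)%:C *: q s - x%:C *: B (Bs (q s))).
  rewrite /W /W2 /p2 (opZ Alin)// -/x -/x1.
  by apply: (inner_ext HdotH) => w; rewrite !(innerDl, innerNl, innerZl); ring.
have h1 := rnormD_sqr_le HdotH ((- 2 * L^-1 ^+ 2)%:C *: p s) ((2 * x1)%:C *: q s - x%:C *: B (Bs (q s))).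
have h2 := rnormD_sqr_le HdotH ((2 * x1)%:C *: q s) (- (x%:C *: B (Bs (q s)))).
rewrite rnormN !rnormZ !exprMn !real_normK ?num_real// in h1 h2.
rewrite -E in h1.
have Lq : L^-1 ^+ 2 <= L^-1 by rewrite expr2 ler_piMr// ltW.
have Lq4 : (- 2 * L^-1 ^+ 2) ^+ 2 <= 4 * L^-1.
  rewrite exprMn sqrrN -[2 ^+ 2]/(2 * 2) -natrM ler_pM2l//.
  by rewrite expr2; apply: (le_trans _ Lq); rewrite ler_piMr ?sqr_ge0//; exact: le_trans Lq Li1.
have hp : n (p s) ^+ 2 <= 2 * e0 + 2 * r ^+ 2.
  by have := pz_sqr s0; have := z_le s0; lra.
have hq : n (q s) ^+ 2 <= m ^+ 2 by rewrite ler_pXn2r ?nnegrE ?rnorm_ge0// qm.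
have hB : n (B (Bs (q s))) ^+ 2 <= bB ^+ 2 * rnorm (Bs (q s)) ^+ 2.
  by rewrite -exprMn ler_pXn2r ?nnegrE ?mulr_ge0 ?rnorm_ge0// bBP.
have a1 : (- 2 * L^-1 ^+ 2) ^+ 2 * n (p s) ^+ 2 <= 4 * L^-1 * (2 * e0 + 2 * r ^+ 2).
  by apply: ler_pM; rewrite ?sqr_ge0.
have a2 : (2 * x1) ^+ 2 * n (q s) ^+ 2 <= 4 * L^-1 * m ^+ 2.
  apply: ler_pM; rewrite ?sqr_ge0//; rewrite exprMn -[2 ^+ 2]/(2 * 2) -natrM ler_pM2l//.
  exact: le_trans k3 Lq.
have a3 : x ^+ 2 * n (B (Bs (q s))) ^+ 2 <= bB ^+ 2 * rnorm (Bs (q s)) ^+ 2.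
  by apply: le_trans hB; rewrite ler_piMl// sqr_ge0.
have hW : rnorm (Bs (W s)) ^+ 2 <= 2 * rnorm (Bs (z s)) ^+ 2 + 2 * (b ^+ 2 * r ^+ 2).
  rewrite /W linearZ rnormZ exprMn real_normK ?num_real// -/x.
  apply: (@le_trans _ _ (rnorm (Bs (p s)) ^+ 2)); first by rewrite ler_piMl// sqr_ge0.
  have := rnormD_sqr_le HdotY (Bs (z s)) (Bs (p s - z s)).
  rewrite -linearD subrKC => h.
  have : rnorm (Bs (p s - z s)) ^+ 2 <= b ^+ 2 * r ^+ 2.
    rewrite -exprMn ler_pXn2r ?nnegrE ?mulr_ge0 ?rnorm_ge0//.
    by apply: (le_trans (bP _)); rewrite ler_wpM2l// pz.
  lra.
have Lm : L * L^-1 = 1 by rewrite mulfV// gt_eqF.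
have -> : K0 * L^-1 = 4 * (4 * L^-1 * (2 * e0 + 2 * r ^+ 2)) + 8 * (4 * L^-1 * m ^+ 2)
    + 2 * (b ^+ 2 * r ^+ 2).
  by rewrite /K0; field; rewrite gt_eqF.
lra.
Qed.

(** The energy at L is at most that at s. Equipartition trades |S y|^2 for |z|^2, and p replaces z
    up to r. The term in g' is completed to the derivative of chi^2 g; the correction 4 chi chi' g
    is at most 2 c e0 / L. *)
Let energy_le s : 0 <= s <= L -> forall g g' : R, `|g| <= c / 2 * e2 y z s ->
  n (S (y s)) ^+ 2 <= 2 * n (z s) ^+ 2 - 2 * g' + c ^+ 2 * bB ^+ 2 * rnorm (Bs (z s)) ^+ 2 ->
  e2 y z L * cutoff L s ^+ 2 <= 6 * n (W s) ^+ 2 + (6 * r ^+ 2 + 2 * c * e0 * L^-1)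
    + - 2 * ((cutoff1 L s * cutoff L s + cutoff L s * cutoff1 L s) * g + cutoff L s * cutoff L s * g')
    + c ^+ 2 * bB ^+ 2 * rnorm (Bs (z s)) ^+ 2.
Proof.
move=> sL g g' hg hX; have /andP[s0 sL'] := sL.
have [k1 [k2 _]] := cutoff_bounds L0 sL.
have hW : n (W s) ^+ 2 = cutoff L s ^+ 2 * n (p s) ^+ 2.
  by rewrite /W rnormZ exprMn real_normK ?num_real.
rewrite hW {hW}; have x20 := sqr_ge0 (cutoff L s).
have heL : e2 y z L <= e2 y z s by apply: (energy2_noninc HdotH HdotY SA Badj yz).
have h1 := ler_wpM2l x20 hX.
have h2 := ler_wpM2l x20 heL; rewrite {2}/energy2 in h2.
have h3 := ler_wpM2l x20 (zp_sqr s0).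
have h4 : cutoff L s ^+ 2 * r ^+ 2 <= r ^+ 2 by rewrite ler_piMl// sqr_ge0.
have hk : 0 <= c ^+ 2 * bB ^+ 2 * rnorm (Bs (z s)) ^+ 2.
  by apply: mulr_ge0; [apply: mulr_ge0|]; apply: sqr_ge0.
have h5 : cutoff L s ^+ 2 * (c ^+ 2 * bB ^+ 2 * rnorm (Bs (z s)) ^+ 2) <=
  c ^+ 2 * bB ^+ 2 * rnorm (Bs (z s)) ^+ 2 by rewrite ler_piMl.
have h6 : cutoff L s * cutoff1 L s * g <= L^-1 * (c / 2 * e0).
  apply: (le_trans (ler_norm _)); rewrite normrM; apply: ler_pM => //.
  by apply: (le_trans hg); rewrite ler_wpM2l ?e2_le// divr_ge0.
move: h1 h2 h3 h4 h5 h6; move: (cutoff L s) (cutoff1 L s) => x x1.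
move: (n (S (y s)) ^+ 2) (n (z s) ^+ 2) (n (p s) ^+ 2) (c ^+ 2 * bB ^+ 2 * _) => X Z Pp K.
move: (e2 y z L) (r ^+ 2) => eL rr; lra.
Qed.

(* p is a difference quotient of y: it replaces z = y', which need not take values in dom A. *)
Lemma main_estimate :
  L / 30 * e2 y z L <=
    (396 * C ^+ 2 + 2 * c + c ^+ 2 * bB ^+ 2) * e0 +
    12 * C ^+ 2 * (32 + 4 * bB ^+ 2) * m ^+ 2 +
    (12 * C ^+ 2 * (32 + 2 * b ^+ 2 * L) + 6 * L) * r ^+ 2.
Proof.
have [g [g' [dg cg gle Xle]]] := equipartition HdotH Asa SA hP c0 poincareC bBP yz.
have {}cg := cg cz.
pose G t := cutoff L t * cutoff L t * g t.
have [G' G'E] : exists F : R -> R, F = fun t =>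
    (cutoff1 L t * cutoff L t + cutoff L t * cutoff1 L t) * g t + cutoff L t * cutoff L t * g' t.
  by eexists.
have dG : half_deriv G G'.
  have hc := @cutoff_deriv R L; rewrite G'E.
  exact: (half_derivM (half_derivM hc hc) dg).
have cG : half_cont G'.
  have k1 := half_deriv_cont (@cutoff_deriv R L).
  have k2 := half_deriv_cont (@cutoff1_deriv R L).
  rewrite G'E; apply: half_contD; apply: half_contM => //.
  - by apply: half_contD; apply: half_contM.
  - exact: half_deriv_cont dg.
  - exact: half_contM.
have limG := gsum_cvg L0 dG cG.
have GL : G L = 0 by rewrite /G /cutoff subrr !(mulr0, mul0r).
have G0 : G 0 = 0 by rewrite /G /cutoff !(mul0r, mulr0).
(* The cutoff vanishes at both ends, so the exact derivative contributes nothing in the limit. *)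
rewrite GL G0 subrr in limG.
have limz := gsum_dissipation L0 yz; have limq := gsum_dissipation L0 pq.
have limc := gsum_cutoff L0.
apply/ler_addgt0Pr => e eps0.
have [pdom _ _ _] := pq.
have e6 : 0 < e / 6 by rewrite divr_gt0.
have dWA t : 0 <= t -> dom A (W t) by move=> /pdom[dA _]; apply: domZ.
have W0 : W 0 = 0 by rewrite /W /cutoff mul0r mulr0 scale0r.
have WL : W L = 0 by rewrite /W /cutoff subrr !mulr0 scale0r.
have [N0 hN0] := dirichlet_inequality HdotH HdotY Alin C0 hautusC L0 e6 dW dW1 cW2 dWA W0 WL.
pose kz N := gsum L N (fun s => rnorm (Bs (z s)) ^+ 2).
pose kq N := gsum L N (fun s => rnorm (Bs (q s)) ^+ 2).
have [c1 c1E] : exists k, k = 6 * r ^+ 2 + 2 * c * e0 * L^-1 by eexists.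
have e00 : 0 <= e0 by rewrite /e0 addr_ge0// sqr_ge0.
have K00 : 0 <= K0.
  have b2 := mulr_ge0 (mulr_ge0 (sqr_ge0 b) (sqr_ge0 r)) (ltW L0).
  by have := sqr_ge0 r; have := sqr_ge0 m; rewrite /K0; lra.
have bound N : (N0 <= N)%N -> e2 y z L * gsum L N (fun s => cutoff L s ^+ 2) <=
    6 * (2 * C ^+ 2 * (K0 + (8 * bB ^+ 2 * kq N + 2 * kz N)) + e / 6) + L * c1
    + - 2 * gsum L N G' + c ^+ 2 * bB ^+ 2 * kz N.
  move=> NN0; rewrite -gsumZ.
  have h1 : gsum L N (fun s => e2 y z L * cutoff L s ^+ 2) <=
      gsum L N (fun s => 6 * n (W s) ^+ 2 + c1 + - 2 * G' s + c ^+ 2 * bB ^+ 2 * rnorm (Bs (z s)) ^+ 2).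
    apply: gsum_le; first exact: ltW.
    by move=> s sL; have /andP[s0 _] := sL; rewrite c1E G'E; apply: energy_le (gle _ s0) (Xle _ s0).
  apply: (le_trans h1); rewrite !gsumD !gsumZ -/(kz N).
  have h2 := hN0 N NN0; rewrite gsumD gsumZ in h2.
  have h3 := gsum_le N (ltW L0) source_le; rewrite !gsumD !gsumZ -/(kz N) -/(kq N) in h3.
  have h4 : K0 * gsum L N (fun=> L^-1) <= K0.
    rewrite -gsumZ; apply: (le_trans (gsum_cst_le _ (ltW L0) _)); first by rewrite mulr_ge0// ltW.
    by rewrite mulrCA mulfV ?mulr1// gt_eqF.
  have h5 : gsum L N (fun=> c1) <= L * c1.
    apply: gsum_cst_le; first exact: ltW.
    have ce := mulr_ge0 (mulr_ge0 c0 e00) (ltW Li0).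
    by have := sqr_ge0 r; rewrite c1E; lra.
  have C20 : 0 <= 12 * C ^+ 2 by rewrite mulr_ge0// sqr_ge0.
  have := ler_wpM2l C20 (le_trans h3 (lerD h4 (lexx _))); move: h2 h5.
  move: (gsum L N (fun s => n (W s) ^+ 2)) (gsum L N (fun s => n (A (W s) + W2 s) ^+ 2)) (gsum L N (fun s => rnorm (Bs (W s)) ^+ 2)) => X1 X2 X7.
  move: (gsum L N (fun=> c1)) (gsum L N G') (kz N) (kq N) => X3 X4 X5 X6.
  move: (C ^+ 2) (bB ^+ 2) => C2 B2; lra.
have lim1 : e2 y z L * gsum L N (fun s => cutoff L s ^+ 2) @[N --> \oo] --> e2 y z L * (L / 30).
  by apply: cvgM => //; exact: cvg_cst.
have lim2 : 6 * (2 * C ^+ 2 * (K0 + (8 * bB ^+ 2 * kq N + 2 * kz N)) + e / 6) + L * c1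
    + - 2 * gsum L N G' + c ^+ 2 * bB ^+ 2 * kz N @[N --> \oo] -->
    6 * (2 * C ^+ 2 * (K0 + (8 * bB ^+ 2 * ((e2 p q 0 - e2 p q L) / 2) +
      2 * ((e2 y z 0 - e2 y z L) / 2))) + e / 6) + L * c1
    + - 2 * 0 + c ^+ 2 * bB ^+ 2 * ((e2 y z 0 - e2 y z L) / 2).
  have cst k : (fun=> k : R) @ \oo --> k by exact: cvg_cst.
  apply: cvgD; last by apply: cvgM.
  apply: cvgD; last by apply: cvgM.
  apply: cvgD => //; apply: cvgM => //; apply: cvgD => //; apply: cvgM => //.
  by apply: cvgD => //; apply: cvgD; apply: cvgM.
have : e2 y z L * (L / 30) <= 6 * (2 * C ^+ 2 * (K0 + (8 * bB ^+ 2 * ((e2 p q 0 - e2 p q L) / 2) +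
      2 * ((e2 y z 0 - e2 y z L) / 2))) + e / 6) + L * c1
    + - 2 * 0 + c ^+ 2 * bB ^+ 2 * ((e2 y z 0 - e2 y z L) / 2).
  by apply: ler_cvg_to lim1 lim2 _; exists N0 => // N /= NN0; apply: bound.
rewrite -/e0 mulrC => /le_trans; apply.
have q1 : 0 <= e2 p q L by rewrite addr_ge0// sqr_ge0.
have z1 : 0 <= e2 y z L by rewrite addr_ge0// sqr_ge0.
have CB : 0 <= C ^+ 2 * bB ^+ 2 by rewrite mulr_ge0// sqr_ge0.
have cB : 0 <= c ^+ 2 * bB ^+ 2 by rewrite mulr_ge0// sqr_ge0.
have d1 : e2 p q 0 - e2 p q L <= m ^+ 2.
  by rewrite lerBlDr; apply: (le_trans epq); rewrite lerDl.
have d2 : e0 - e2 y z L <= e0 by rewrite lerBlDr lerDl.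
have d3 : e0 - e2 y z L <= 2 * e0 by lra.
have t1 := ler_wpM2l CB d1.
have t2 := ler_wpM2l (sqr_ge0 C) d2.
have t3 := ler_wpM2l cB d3.
(* The coefficient 396 is 12 (32 + 1): 32 e0 from [K0], and e0 from the dissipation of (y, z), all
   multiplied by 6 times 2 C^2. *)
have Lc : L * c1 = 6 * L * r ^+ 2 + 2 * c * e0 by rewrite c1E; field; rewrite gt_eqF.
rewrite Lc /K0; move: t1 t2 t3.
move: (e2 p q 0) (e2 p q L) (e2 y z L) (C ^+ 2) (bB ^+ 2) (c ^+ 2) (r ^+ 2) (m ^+ 2) (b ^+ 2).
move=> x1 x2 x3 x4 x5 x6 x7 x8 x9; lra.
Qed.

End MainEstimate.

(** * Decay of the energy *)

Section Decay.
Context {R : realType} {H Y : completeNormedModType R[i]}.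
Variables (dotH : {dot H for @conjc R}) (dotY : {dot Y for @conjc R}).
Hypotheses (HdotH : hilbert dotH) (HdotY : hilbert dotY).
Local Notation ip := (inner dotH).
Local Notation n := (@rnorm R H).
Variables (A S S1 : operator H) (B : {linear Y -> H}) (Bs : {linear H -> Y}).
Hypotheses (Asa : selfadjoint dotH A) (Age0 : nonnegative dotH A).
Hypotheses (SA : is_sqrt dotH A S) (S1A : is_sqrt dotH (add_id A) S1).
Hypothesis Badj : forall (y : Y) (x : H), dotH (B y) x = dotY y (Bs x).
Let Alin : linear_operator A. Proof. exact: sa_linear Asa. Qed.
Let Slin : linear_operator S. Proof. by case: SA => /sa_linear. Qed.
Variables (P : H -> H) (C c bB b : R).
Hypotheses (hP : kernel_projector dotH A P).
Hypotheses (C0 : 0 <= C) (c0 : 0 <= c) (bB0 : 0 <= bB) (b0 : 0 <= b).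
Hypothesis hautusC : forall (mu : R) x, dom A x ->
  rnorm x <= C * (rnorm (A x - mu%:C *: x) + rnorm (Bs x)).
Hypothesis poincareC : forall x, dom S x ->
  (forall z, in_kernel A z -> ip x z = 0) -> n x <= c * n (S x).
Hypothesis bBP : forall y, n (B y) <= bB * rnorm y.
Hypothesis bP : forall x, rnorm (Bs x) <= b * n x.

(** The resolvent estimate at mu = 0 bounds the kernel component by its observation; the rest is
    controlled by the spectral gap. *)
Lemma low_frequency x : dom S x ->
  n x <= C * rnorm (Bs x) + (C * b * c + c) * n (S x).
Proof.
move=> dx; have [kp _] := hP x; have h1 := kernel_complement_le HdotH SA hP poincareC dx.
have := hautusC 0 kp.1; rewrite kp.2 scale0r subr0 rnorm0 add0r => h2.
have h3 := ler_rnorm_dist x (P x).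
have h4 : rnorm (Bs (P x)) <= rnorm (Bs x) + b * (c * n (S x)).
  have := ler_rnorm_dist (Bs (P x)) (Bs x); rewrite rnormBC -linearB => h4.
  by apply: (le_trans h4); rewrite lerD2l; apply: (le_trans (bP _)); rewrite ler_wpM2l.
have := ler_wpM2l C0 h4; lra.
Qed.

Lemma sqrt_le_operator x : dom A x -> n (S x) <= c * n (A x).
Proof.
move=> dx; have [kp op] := hP x; have dS := sqrt_dom SA dx.
have h1 := kernel_complement_le HdotH SA hP poincareC dS.
have h2 : n (S x) ^+ 2 <= n (A x) * (c * n (S x)).
  rewrite (sqrt_rnorm HdotH SA dx).
  have -> : ip (A x) x = ip (A x) (x - P x).
    by rewrite innerDr innerNr (sa_sym Asa dx kp.1) kp.2 inner0r subr0.
  by apply: (le_trans (inner_le HdotH _ _)); rewrite ler_wpM2l ?rnorm_ge0.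
have [->|S0] := eqVneq (n (S x)) 0; first by rewrite mulr_ge0 ?rnorm_ge0.
have Sp : 0 < n (S x) by rewrite lt_neqAle rnorm_ge0 andbT eq_sym.
by rewrite -(ler_pM2r Sp) -expr2; apply: (le_trans h2); rewrite mulrCA mulrA.
Qed.

(** [main_estimate] contains the energy of the data, while the stability rate allows only the
    generator applied to them. Pairing its second component G with u1 isolates |Bs u1|^2, and the
    previous two lemmas recover u1 and S u0 from it. *)
Lemma static_estimate : exists2 K : R, 0 <= K & forall u0 u1, dom A u0 -> dom S u1 ->
  n (S u0) ^+ 2 + n u1 ^+ 2 <= K * (n (S u1) ^+ 2 + n (- A u0 - B (Bs u1)) ^+ 2).
Proof.
pose k1 := C + c * bB; pose k2 := C * b * c + 2 * c; pose k := k1 + k2 + 1.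
have k10 : 0 <= k1 by rewrite addr_ge0// mulr_ge0.
have k20 : 0 <= k2 by rewrite addr_ge0// !mulr_ge0.
have k0 : 0 <= k by rewrite /k; lra.
pose s1 := c * (1 + bB * k); pose s2 := C * k + (C * b * c + c).
exists (s1 ^+ 2 + s2 ^+ 2); first by rewrite addr_ge0// sqr_ge0.
move=> u0 u1 d0 d1; set G := - A u0 - B (Bs u1).
pose a := Num.sqrt (n (S u1) ^+ 2 + n G ^+ 2).
have a20 : 0 <= n (S u1) ^+ 2 + n G ^+ 2 by rewrite addr_ge0// sqr_ge0.
have a0 : 0 <= a by apply: sqrtr_ge0.
have aE : n (S u1) ^+ 2 + n G ^+ 2 = a ^+ 2 by rewrite sqr_sqrtr.
rewrite aE.
have Su1 : n (S u1) <= a.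
  by rewrite -(ler_pXn2r (n := 2)) ?nnegrE ?rnorm_ge0// -aE lerDl sqr_ge0.
have Ga : n G <= a.
  by rewrite -(ler_pXn2r (n := 2)) ?nnegrE ?rnorm_ge0// -aE lerDr sqr_ge0.
set be := rnorm (Bs u1).
have be0 : 0 <= be by apply: rnorm_ge0.
have h1 : n u1 <= C * be + (C * b * c + c) * a.
  apply: (le_trans (low_frequency d1)); rewrite lerD2l ler_wpM2l//.
  by rewrite addr_ge0// !mulr_ge0.
have h2 : n (S u0) <= c * (a + bB * be).
  apply: (le_trans (sqrt_le_operator d0)); rewrite ler_wpM2l//.
  have -> : A u0 = - (G + B (Bs u1)) by rewrite /G subrK opprK.
  rewrite rnormN; apply: (le_trans (ler_rnormD _ _)); apply: lerD => //.
have h3 : be ^+ 2 <= a * (k1 * be + k2 * a).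
  have -> : be ^+ 2 = - ip G u1 - ip (S u0) (S u1).
    rewrite (sqrt_inner SA d0 d1) /G innerDl !innerNl (inner_damping Badj) (inner_rnorm HdotY).
    by rewrite /be; ring.
  have e1 : - ip G u1 <= a * n u1.
    rewrite -innerNl; apply: (le_trans (inner_le HdotH _ _)); rewrite rnormN.
    by rewrite ler_wpM2r ?rnorm_ge0.
  have e2 : - ip (S u0) (S u1) <= n (S u0) * a.
    rewrite -innerNr; apply: (le_trans (inner_le HdotH _ _)); rewrite rnormN.
    by rewrite ler_wpM2l ?rnorm_ge0.
  have e3 := ler_wpM2l a0 h1; have e4 := ler_wpM2l a0 h2.
  rewrite /k1 /k2; lra.
have hbe : be <= k * a.
  (* If be > k a, then a <= be, so [h3] bounds be^2 by (k1 + k2) a be, below be^2 because k = k1 +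
     k2 + 1. *)
  rewrite leNgt; apply/negP => hlt.
  have ab : a <= be by apply: le_trans (ltW hlt); rewrite /k; have := mulr_ge0 (addr_ge0 k10 k20) a0; lra.
  have bp : 0 < be by apply: le_lt_trans hlt; apply: mulr_ge0.
  have e1 : be * (k * a) < be * be by rewrite ltr_pM2l.
  have e2 := ler_wpM2l (mulr_ge0 k20 a0) ab.
  have e3 := mulr_ge0 a0 be0.
  rewrite /k in e1; lra.
have h4 : n (S u0) <= s1 * a.
  have := ler_wpM2l (mulr_ge0 c0 bB0) hbe; rewrite /s1; lra.
have h5 : n u1 <= s2 * a by have := ler_wpM2l C0 hbe; rewrite /s2; lra.
rewrite mulrDl -!exprMn; apply: lerD; rewrite ler_pXn2r ?nnegrE ?rnorm_ge0//.
- exact: le_trans (rnorm_ge0 _) h4.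
- exact: le_trans (rnorm_ge0 _) h5.
Qed.

Lemma dq_le (f f' : R -> H) (M h t : R) : vderiv f f' -> 0 < h -> 0 <= t ->
  (forall s, t < s < t + h -> n (f' s) <= M) -> n (dq h f t) <= M.
Proof.
move=> df h0 t0 hM; rewrite /dq rnormZ (ger0_norm (ltW (ltac:(by rewrite invr_gt0) : 0 < h^-1))).
rewrite mulrC ler_pdivrMr//.
have := vderiv_lipschitz HdotH df t0 (ltac:(lra) : t <= t + h) hM.
by rewrite addrAC subrr add0r.
Qed.

Lemma dq_acceleration (y z : R -> H) h t : dom A (y t) -> dom A (y (t + h)) ->
  dq h (fun s => - A (y s) - B (Bs (z s))) t = - A (dq h y t) - B (Bs (dq h z t)).
Proof.
move=> d1 d2; rewrite /dq (opZ Alin) ?(opB Alin)//; last exact: domB.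
rewrite !linearZ /= -scalerDr; congr (_ *: _); rewrite !linearB /=.
by apply: (inner_ext HdotH) => w; rewrite !(innerDl, innerNl); ring.
Qed.

Lemma vcont_congr (f g : R -> H) : (forall t, 0 <= t -> f t = g t) -> vcont f -> vcont g.
Proof.
move=> fg hf t t0.
apply: (@cvg0_le_ge0 _ _ _ _ _ (half_nbhs_ge0 t) _ (hf t t0)) => s s0.
by rewrite rnorm_ge0 /= !fg.
Qed.

Lemma vcont_dq h (f : R -> H) : 0 <= h -> vcont f -> vcont (dq h f).
Proof. by move=> h0 hf; apply: vcontZ; apply: vcontB => //; apply: vcont_shift. Qed.

Lemma wave_vcont (U : R -> H * H) : wave_solution A S S1 B Bs U -> vcont (fun t => (U t).2).
Proof.
move=> [US cU _] t t0.
apply: (@cvg0_le_ge0 _ _ _ _ _ (half_nbhs_ge0 t) _ (cU t t0)) => s s0.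
have dX : dom S (U s - U t).1 by apply: domB => //; apply: US.
by rewrite rnorm_ge0 /=; have [] := energy_norm_ge HdotH Asa Age0 SA S1A dX.
Qed.

(** For t >= 1, [main_estimate] is applied on [0, t] to the quotients of the primitive and to their
    own quotients with the same step h, with m = 3 a and r = 2 a h. *)
Lemma wave_energy_decay : exists2 K : R, 0 <= K &
  forall U : R -> H * H, wave_solution A S S1 B Bs U ->
  dom A (U 0).1 -> dom S (U 0).2 -> forall t, 0 < t ->
  t * (n (S (U t).1) ^+ 2 + n (U t).2 ^+ 2) <=
  K * (n (S (U 0).2) ^+ 2 + n (- A (U 0).1 - B (Bs (U 0).2)) ^+ 2).
Proof.
have [Ks Ks0 static] := static_estimate.
pose al := 396 * C ^+ 2 + 2 * c + c ^+ 2 * bB ^+ 2.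
pose be := 12 * C ^+ 2 * (32 + 4 * bB ^+ 2).
have C2 : 0 <= C ^+ 2 by apply: sqr_ge0.
have B2 : 0 <= bB ^+ 2 by apply: sqr_ge0.
have CB : 0 <= C ^+ 2 * bB ^+ 2 by apply: mulr_ge0.
have al0 : 0 <= al.
  exact: (addr_ge0 (addr_ge0 (mulr_ge0 (ler0n R 396) C2) (mulr_ge0 (ler0n R 2) c0))
    (mulr_ge0 (sqr_ge0 c) B2)).
have be0 : 0 <= be.
  by apply: mulr_ge0; [apply: mulr_ge0 | apply: addr_ge0 => //; apply: mulr_ge0].
have K10 : 0 <= 30 * (al * Ks + be * 9) by have := mulr_ge0 al0 Ks0; lra.
exists (30 * (al * Ks + be * 9) + Ks); first by lra.
move=> U hU dU1 dU2 t t0.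
have [y0 [z0 [dyz dy dSy dz UE]]] := wave_primitive HdotH Asa Age0 SA S1A hU.
have stat := static _ _ dU1 dU2.
set a2 := n (S (U 0).2) ^+ 2 + n (- A (U 0).1 - B (Bs (U 0).2)) ^+ 2 in stat *.
have a20 : 0 <= a2 by rewrite addr_ge0// sqr_ge0.
pose a := Num.sqrt a2.
have a0 : 0 <= a by apply: sqrtr_ge0.
have aE : a ^+ 2 = a2 by rewrite sqr_sqrtr.
have inc h s : 0 < h -> 0 <= s ->
    n (S (U (s + h)).1 - S (U s).1) <= 2 * h * a /\ n ((U (s + h)).2 - (U s).2) <= 2 * h * a.
  exact: (increment_le HdotH HdotY Asa SA Badj dyz dy dSy dz UE dU1 dU2).
pose e h := energy2 S (dq h y0) (dq h z0).
have strong h : 0 < h -> strong_pair A S B Bs (dq h y0) (dq h z0).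
  by move=> h0; apply: (strong_dq_primitive HdotH Asa SA dyz dy dSy dz UE (ltW h0)).
have lim s : 0 <= s -> e h s @[h --> 0^'+] --> n (S (U s).1) ^+ 2 + n (U s).2 ^+ 2.
  by move=> s0; apply: (energy2_dq_primitive SA dyz dSy dz s0).
have lim0 := lim 0 (lexx 0).
set E0 := n (S (U 0).1) ^+ 2 + n (U 0).2 ^+ 2 in stat lim0.
have limt := lim t (ltW t0).
set Et := n (S (U t).1) ^+ 2 + n (U t).2 ^+ 2 in limt *.
(* [main_estimate] needs L >= 1; for shorter times monotonicity of the energy and the stationary
   estimate suffice. *)
have [t1|t1] := leP 1 t; last first.
  have EtE0 : Et <= E0.
    apply: ler_cvg_to limt lim0 _; apply: filterS (at_right_gt0 (R := R)) => h h0.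
    by apply: (energy2_noninc HdotH HdotY SA Badj (strong h h0)) => //; apply: ltW.
  have Et0 : 0 <= Et by rewrite addr_ge0// sqr_ge0.
  have : t * Et <= Et by rewrite ler_piMl// ltW.
  have := mulr_ge0 K10 a20; lra.
pose ga := 12 * C ^+ 2 * (32 + 2 * b ^+ 2 * t) + 6 * t.
have est h : 0 < h -> t / 30 * e h t <= al * e h 0 + be * (3 * a) ^+ 2 + ga * (2 * a * h) ^+ 2.
  move=> h0; have h0' := ltW h0.
  set y := dq h y0; set z := dq h z0.
  have hs := strong h h0; rewrite -/y -/z in hs.
  have hs2 := strong_pair_dq HdotH Asa SA h0' hs.
  have [hdom hy hSy hz] := hs.
  have hi : 0 < h^-1 by rewrite invr_gt0.
  (* The acceleration of the regularised solution is a difference quotient of (U s).2, so the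
     Lipschitz bound on U controls it by 2 a uniformly in h. *)
  have acc s : 0 <= s -> dq h (fun s => (U s).2) s = - A (y s) - B (Bs (z s)).
    move=> s0; have s1 := addr_ge0 s0 h0'.
    have [e1 _ _] := dyz s s0; have [e2 _ _] := dyz _ s1.
    rewrite /y /z -dq_acceleration// /dq (UE s s0).2 (UE _ s1).2; congr (_ *: _).
    by apply: (inner_ext HdotH) => w; rewrite !(innerDl, innerNl); ring.
  have scale2 (x : H) : n x <= 2 * h * a -> n (h^-1%:C *: x) <= 2 * a.
    by move=> hx; rewrite rnormZ (ger0_norm (ltW hi)) mulrC ler_pdivrMr// mulrAC.
  have accle s : 0 <= s -> n (- A (y s) - B (Bs (z s))) <= 2 * a.
    by move=> s0; rewrite -acc//; apply: scale2; have [] := inc h s h0 s0.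
  have Szle s : 0 <= s -> n (S (z s)) <= 2 * a.
    move=> s0; rewrite /z -(dq_U1 HdotH UE h0' s0) /dq.
    have [_ _ e1] := dyz s s0; have [_ _ e2] := dyz _ (addr_ge0 s0 h0').
    rewrite (opZ Slin) ?(opB Slin)//; last exact: domB.
    by apply: scale2; have [] := inc h s h0 s0.
  have cacc : vcont (fun s => - A (y s) - B (Bs (z s))).
    by apply: (vcont_congr acc); apply: vcont_dq => //; apply: wave_vcont.
  have cacc2 : vcont (fun s => - A (dq h y s) - B (Bs (dq h z s))).
    apply: vcont_congr (vcont_dq h0' cacc) => s s0.
    by rewrite dq_acceleration//; [case: (hdom s s0) | case: (hdom _ (addr_ge0 s0 h0'))].
  have qle s : 0 <= s -> n (dq h z s) <= 2 * a.
    move=> s0; apply: (dq_le hz h0 s0) => r /andP[r1 _].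
    by apply: accle; apply: le_trans (ltW r1).
  have pz s : 0 <= s -> n (dq h y s - z s) <= 2 * a * h.
    move=> s0.
    have dl : vderiv (fun r => y r - r%:C *: z s) (fun r => z r - z s).
      apply: vderivB => //; apply: vderiv_ext (vderiv_smul (z s) half_deriv_id) _ => r _.
      by rewrite scale1r.
    have -> : dq h y s - z s = dq h (fun r => y r - r%:C *: z s) s.
      apply: (inner_ext HdotH) => w; rewrite /dq !(innerDl, innerNl, innerZl).
      by field; rewrite gt_eqF.
    apply: (dq_le dl h0 s0) => r /andP[r1 r2].
    have lip := vderiv_lipschitz HdotH hz s0 (ltW r1) (M := 2 * a).
    apply: (@le_trans _ _ (2 * a * (r - s))).
      apply: lip => v /andP[v1 _]; apply: accle; exact: le_trans (ltW v1).
    by rewrite ler_wpM2l ?mulr_ge0// lerBlDl ltW.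
  (* Both terms of the energy are at most 4 a^2, and 8 <= 9 explains the choice m = 3 a. *)
  have epq : energy2 S (dq h y) (dq h z) 0 <= (3 * a) ^+ 2.
    have p1 : n (S (dq h y 0)) <= 2 * a.
      have [d1 _] := hdom 0 (lexx 0); have [d2 _] := hdom _ (addr_ge0 (lexx 0) h0').
      have e1 := sqrt_dom SA d1; have e2 := sqrt_dom SA d2.
      have -> : S (dq h y 0) = dq h (fun s => S (y s)) 0.
        by rewrite /dq (opZ Slin) ?(opB Slin)//; apply: domB.
      by apply: (dq_le hSy h0 (lexx 0)) => r /andP[r1 _]; apply: Szle; apply: ltW.
    have q1 := qle 0 (lexx 0).
    have sq (x : H) : n x <= 2 * a -> n x ^+ 2 <= 4 * a ^+ 2.
      move=> hx; have -> : 4 * a ^+ 2 = (2 * a) ^+ 2 by ring.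
      by rewrite ler_pXn2r ?nnegrE ?rnorm_ge0// mulr_ge0.
    have := sq _ p1; have := sq _ q1; rewrite /energy2 exprMn.
    by have := sqr_ge0 a; lra.
  have m0 : 0 <= 3 * a by rewrite mulr_ge0.
  have r0 : 0 <= 2 * a * h by rewrite !mulr_ge0.
  have qm s : 0 <= s -> n (dq h z s) <= 3 * a by move=> /qle; lra.
  exact: (main_estimate HdotH HdotY Asa SA Badj hP C0 c0 bB0 b0 hautusC poincareC bBP bP
    hs hs2 cacc cacc2 t1 m0 r0 pz qm epq).
(* [ga] grows with t, but t is fixed here, so its term disappears with h. *)
have limR : al * e h 0 + be * (3 * a) ^+ 2 + ga * (2 * a * h) ^+ 2 @[h --> 0^'+] -->
    al * E0 + be * (3 * a) ^+ 2 + ga * (2 * a * 0) ^+ 2.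
  have cst (k : R) : (fun=> k : R) @ 0^'+ --> k by exact: cvg_cst.
  have idc : (fun h : R => h) @ 0^'+ --> (0 : R) by apply: cvg_at_right_filter; exact: cvg_id.
  apply: cvgD.
    by apply: cvgD; [apply: cvgM; [exact: cst | exact: lim0] | exact: cst].
  apply: cvgM; first exact: cst.
  rewrite expr2; under eq_fun do rewrite expr2.
  by apply: cvgM; apply: cvgM; [exact: cst | exact: idc | exact: cst | exact: idc].
have limL : t / 30 * e h t @[h --> 0^'+] --> t / 30 * Et.
  by apply: cvgM => //; exact: cvg_cst.
have : t / 30 * Et <= al * E0 + be * (3 * a) ^+ 2 + ga * (2 * a * 0) ^+ 2.
  by apply: ler_cvg_to limL limR _; apply: filterS (at_right_gt0 (R := R)) => h; apply: est.
rewrite mulr0 expr0n mulr0 addr0 exprMn aE => h1.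
have h2 := ler_wpM2l al0 stat; have h3 := mulr_ge0 Ks0 a20.
lra.
Qed.

End Decay.

Theorem theorem2p3 (R : realType) (H Y : completeNormedModType R[i])
  (dotH : {dot H for @conjc R}) (dotY : {dot Y for @conjc R})
  (hilbertH : hilbert dotH) (hilbertY : hilbert dotY)
  (A : operator H)
  (A_sa : selfadjoint dotH A) (A_ge0 : nonnegative dotH A)
  (A_cpt : compact_resolvent A)
  (S S1 : operator H)
  (S_sqrt : is_sqrt dotH A S) (S1_sqrt : is_sqrt dotH (add_id A) S1)
  (B : {linear Y -> H}) (Bs : {linear H -> Y})
  (B_bounded : continuous B) (Bs_bounded : continuous Bs)
  (B_adjoint : forall (y : Y) (x : H), dotH (B y) x = dotY y (Bs x)) :
  (exists2 T : R, 0 < T & observable A Bs T) ->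
  stable_at_rate A S S1 B Bs (fun t : R => 1 / Num.sqrt t).
Proof.
move=> [T T0 obs]; split.
  apply/cvgrPdist_lt => e e0; exists (e^-1 ^+ 2); split; first exact: num_real.
  move=> t ht; have ei : 0 < e^-1 by rewrite invr_gt0.
  have t0 : 0 < t by apply: le_lt_trans ht; apply: sqr_ge0.
  have st : 0 < Num.sqrt t by rewrite sqrtr_gt0.
  rewrite sub0r normrN div1r ger0_norm ?invr_ge0 ?(ltW st)//.
  rewrite invf_plt ?posrE// -(ltr_pXn2r (n := 2)) ?nnegrE ?(ltW ei) ?(ltW st)//.
  by rewrite sqr_sqrtr// ltW.
have [C C0 hautusC] := hautus hilbertH A_sa A_ge0 A_cpt Bs_bounded T0 obs.
have [c c0 poincareC] := poincare hilbertH A_sa A_ge0 A_cpt S_sqrt.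
have [P hP] := kernel_projector_exists hilbertH A_sa.
have [bB bB0 bBP] := linear_rnorm_bounded B_bounded.
have [b b0 bP] := linear_rnorm_bounded Bs_bounded.
have [K K0 decay] := wave_energy_decay hilbertH hilbertY A_sa A_ge0 S_sqrt S1_sqrt B_adjoint hP
  C0 c0 bB0 b0 hautusC poincareC bBP bP.
(* K may be 0 whereas the constant must be positive, hence K + 1. *)
exists (Num.sqrt (K + 1)); first by rewrite sqrtr_gt0; lra.
move=> u0 u1 [d0 d1] U hU U0 t t0.
have := decay U hU; rewrite U0 /= => /(_ d0 d1 t t0).
rewrite /energy_seminorm /= /energy.
set Et := _ + _; set a2 := _ + _ => h.
have a20 : 0 <= a2 by rewrite addr_ge0// sqr_ge0.
have Et0 : 0 <= Et by rewrite addr_ge0// sqr_ge0.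
have K1 : 0 <= K + 1 by lra.
have Kt : 0 <= (K + 1) * t^-1 by rewrite mulr_ge0// invr_ge0 ltW.
rewrite div1r -sqrtrV ?(ltW t0)// -(sqrtrM _ K1) -(sqrtrM _ Kt).
apply: ler_wsqrtr; rewrite mulrAC ler_pdivlMr//.
by have := mulr_ge0 (ltW t0) Et0; lra.
Qed.
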